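(* Given a cEOS $\mathfrak E=(\hat N,\mathcal N,d,\Theta)$, there is a c-$\nu$PN $W=(P,T,F,G)$, constructible in polynomial time from $\mathfrak E$, that simulates $\mathfrak E$.
   Context: EOS/cEOS: A PN is $(P,T,F)$ with $F:(P\times T)\cup(T\times P)\to\mathbb N$, ${\tt pre}_N(t)(p)=F(p,t)$, ${\tt post}_N(t)(p)=F(t,p)$; $\blacksquare=(\emptyset,\emptyset,\emptyset)$ with unique marking $\varepsilon$. An EOS is $(\hat N,\mathcal N,d,\Theta)$: system PN $\hat N=(\hat P,\hat T,\hat F)$ containing idle transitions $id_p$ ($p\in\hat P$) consuming and producing one token on $p$ only; finite set $\mathcal N\ni\blacksquare$ of object PNs, all nets pairwise disjoint; typing $d:\hat P\to\mathcal N$; finite event set $\Theta$ of pairs $(\hat\tau,\theta)$, $\hat\tau\in\hat T$, $\theta(N)$ a finite multiset of transitions of $N$ for each $N$, with $\theta(d(p))\ne\emptyset$ if $\hat\tau=id_p$. Configurations: finite multisets of nested tokens $(\hat p,m)$, $m$ a marking of $d(\hat p)$. With $\Pi^1(\sum_i(\hat p_i,m_i))=\sum_i\hat p_i$ and $\Pi^2_N(\sum_i(\hat p_i,m_i))=\sum_{d(\hat p_i)=N}m_i$, event $(\hat\tau,\theta)$ fires on $\mu$ with mode $(\lambda,\rho)$ iff $\lambda\sqsubseteq\mu$, $\Pi^1(\lambda)={\tt pre}_{\hat N}(\hat\tau)$, $\Pi^1(\rho)={\tt post}_{\hat N}(\hat\tau)$, and for all $N$: $\Pi^2_N(\lambda)\ge{\tt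 pre}_N(\theta(N))$, $\Pi^2_N(\rho)=\Pi^2_N(\lambda)-{\tt pre}_N(\theta(N))+{\tt post}_N(\theta(N))$; result $\mu-\lambda+\rho$. A cEOS is an EOS with $d(\mathrm{supp}\,{\tt pre}_{\hat N}(\hat t))\subseteq d(\mathrm{supp}\,{\tt post}_{\hat N}(\hat t))$ for all $\hat t\in\hat T$. $\nu$PN: disjoint infinite variable sets $\mathcal X$ (standard), $\Upsilon$ (fresh). A $\nu$PN is $(P,T,F)$ with $F:(P\times T)\cup(T\times P)\to(\mathcal X\cup\Upsilon)^\oplus$, such that fresh variables never occur in presets and every standard variable in a postset of $t$ occurs in a preset of $t$. $\mathcal X(t),\Upsilon(t)$: standard/fresh variables of $t$; $F_x(P,t),F_x(t,P)\in\mathbb N^P$ the multiplicities of $x$ on arcs. Configurations: finite multisets of tuples in $\mathbb N^P$. Mode: injective $e$ from $\mathcal X(t)$ to tuples of $M$ with $F_x(P,t)\le m_{e(x)}$. c-$\nu$PN: $(P,T,F,G)$ with $(P,T,F)$ a $\nu$PN and $G$ mapping each $t$ to $G_t:\mathcal X(t)\times\mathcal X(t)\to\{0,1\}^{P\times P}$ such that for all $x_i\in\mathcal X(t)$, $p\in P$: (a) each row $G_t(x_i,x_j)[p]$ contains at most one $1$; (b) if $G_t(x_i,x_j)[p]=\delta_q$ for some $q\in P$ and $x_j\ne x_i$, then $G_t(x_i,x_k)[p]=0$ for all $x_k\ne x_j$; otherwise $G_t(x_i,x_i)[p]=\delta_p$ ($\delta_q$ the unit vector at $q$). Firing $t$ with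 mode $e$ (enabled as in $(P,T,F)$): $M=M''+\sum_{x\in\mathcal X(t)}\{\!\{m_{e(x)}\}\!\}$, $M'=M''+\sum_{\nu\in\Upsilon(t)}\{\!\{F_\nu(t,P)\}\!\}+\sum_{x\in\mathcal X(t)}\{\!\{m'_{e(x)}\}\!\}$, with $m''_{e(x_i)}=m_{e(x_i)}-F_{x_i}(P,t)$ and $m'_{e(x_j)}=\sum_{x_i\in\mathcal X(t)}m''_{e(x_i)}\cdot G_t(x_i,x_j)+F_{x_j}(t,P)$ (row vector times matrix). Simulation (as used in the paper): the places of $W$ include, for each $\hat p\in\hat P$ with $d(\hat p)=N$, a disjoint copy $p^{\hat p}$ of each place $p$ of $N$ and an identifier place $\mathrm{Id}_{\hat p}$, plus a control place $p^{init}$ and auxiliary places; a configuration $M=\sum_i(\hat p_i,m_i)$ of $\mathfrak E$ is encoded as $\hat M=\sum_i\{\!\{\sum_{p}m_i(p)\delta_{p^{\hat p_i}}+\delta_{\mathrm{Id}_{\hat p_i}}\}\!\}+\{\!\{\delta_{p^{init}}\}\!\}$, and $M\to M'$ by an event firing in $\mathfrak E$ iff $\hat M\to^*\hat M'$ in $W$.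
   Formalization: An event firing M→M' is matched with a nonempty run of W having no encoded configuration strictly in between (not arbitrary →*, which is reflexive and transitive), and configurations of W are compared up to all-zero tuples, which firings never remove; numbers are coded in unary. *)

(* Defs.v *)
From HB Require Import structures.
From mathcomp Require Import all_boot.
From mathcomp Require Import finmap multiset.

Set Implicit Arguments.
Unset Strict Implicit.
Unset Printing Implicit Defensive.

Local Open Scope mset_scope.

Record pn := PN {
  place : finType;
  trans : finType;
  arc_in : place -> trans -> nat;
  arc_out : trans -> place -> nat }.

Definition marking (N : pn) := {ffun place N -> nat}.

Definition pre (N : pn) (t : trans N) : marking N := [ffun p => arc_in p t].
Definition post (N : pn) (t : trans N) : marking N := [ffun p => arc_out t p].

Definition pre_ms (N : pn) (th : {ffun trans N -> nat}) : marking N :=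
  [ffun p => \sum_(t : trans N) th t * pre t p].
Definition post_ms (N : pn) (th : {ffun trans N -> nat}) : marking N :=
  [ffun p => \sum_(t : trans N) th t * post t p].

(* The object nets form a family indexed by a finite type, which makes them
   pairwise disjoint and disjoint from the system net.  [black] is the index of
   the net without places and transitions; as the object nets form a set, it is
   the only such index.  The finite set of events is given by a duplicate-free
   enumeration. *)
Record eos := EOS {
  sys : pn;
  idle : place sys -> trans sys;
  idle_pre : forall p, pre (idle p) = [ffun q => (q == p : nat)];
  idle_post : forall p, post (idle p) = [ffun q => (q == p : nat)];
  net : finType;
  obj : net -> pn;
  black : net;
  blackP : forall N,
    (N == black) = (#|place (obj N)| == 0) && (#|trans (obj N)| == 0);
  typ : place sys -> net;
  events : seq (trans sys *
                {dffun forall N : net, {ffun trans (obj N) -> nat}});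
  events_uniq : uniq events;
  events_idle : forall ev p, ev \in events -> ev.1 = idle p ->
    exists t : trans (obj (typ p)), 0 < ev.2 (typ p) t }.

Definition event (E : eos) : Type :=
  trans (sys E) * {dffun forall N : net E, {ffun trans (obj N) -> nat}}.

Definition conservative (E : eos) : Prop :=
  forall (t : trans (sys E)) (p : place (sys E)), 0 < pre t p ->
  exists q, 0 < post t q /\ typ q = typ p.

Definition token (E : eos) := {p : place (sys E) & marking (obj (typ p))}.

Definition eos_conf (E : eos) := {mset (token E)}.
Identity Coercion mset_of_eos_conf : eos_conf >-> multiset_of.

Definition Pi1 (E : eos) (mu : eos_conf E) : marking (sys E) :=
  [ffun p => \sum_(k <- mu) (tag k == p)].

Definition token_at (E : eos) (N : net E) (k : token E) : marking (obj N) :=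
  if typ (tag k) =P N is ReflectT e
  then ecast M (marking (obj M)) e (tagged k) else [ffun=> 0].

Definition Pi2 (E : eos) (N : net E) (mu : eos_conf E) : marking (obj N) :=
  [ffun q => \sum_(k <- mu) token_at N k q].

Definition enabled_mode (E : eos) (ev : event E) (la rho : eos_conf E) : Prop :=
  [/\ Pi1 la = pre ev.1,
      Pi1 rho = post ev.1
    & forall N : net E,
        (forall q, pre_ms (ev.2 N) q <= Pi2 N la q) /\
        (forall q, Pi2 N rho q =
           Pi2 N la q - pre_ms (ev.2 N) q + post_ms (ev.2 N) q)].

Definition eos_fires (E : eos) (ev : event E) (mu mu' : eos_conf E) : Prop :=
  exists la rho : eos_conf E,
    [/\ la `<=` mu, enabled_mode ev la rho & mu' = (mu `\` la) `+` rho].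

Definition eos_step (E : eos) (mu mu' : eos_conf E) : Prop :=
  exists2 ev, ev \in events E & eos_fires ev mu mu'.

(* [inl x] is a standard variable, [inr y] a fresh one. *)
Definition var : Type := nat + nat.

(* The multisets of variables labelling the arcs are given by listings;
   only the multiplicities [count_mem] are used by the semantics. *)
Record nupn := NuPN {
  nplace : finType;
  ntrans : finType;
  narc_in : nplace -> ntrans -> seq var;
  narc_out : ntrans -> nplace -> seq var;
  nu_fresh : forall p t (y : nat), inr y \notin narc_in p t;
  nu_std : forall t p (x : nat), inl x \in narc_out t p ->
    exists q, inl x \in narc_in q t }.

Section NuPN.
Variable W : nupn.
Implicit Types (t : ntrans W) (p : nplace W).

Definition arc_vars t : seq var :=
  flatten [seq narc_in p t | p <- enum (nplace W)] ++
  flatten [seq narc_out t p | p <- enum (nplace W)].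

Definition std_vars t : seq nat :=
  undup (pmap (fun v => if v is inl x then Some x else None) (arc_vars t)).
Definition fresh_vars t : seq nat :=
  undup (pmap (fun v => if v is inr y then Some y else None) (arc_vars t)).

Definition flow_in t (v : var) p : nat := count_mem v (narc_in p t).
Definition flow_out t (v : var) p : nat := count_mem v (narc_out t p).

Definition ntuple := {ffun nplace W -> nat}.
Definition nu_conf := {mset ntuple}.

End NuPN.

Identity Coercion mset_of_nu_conf : nu_conf >-> multiset_of.

(* [chan t x y p q] is the entry (p,q) of G_t(x,y); its values for x, y outside
   [std_vars t] are never used. *)
Record cnupn := CNuPN {
  net_of :> nupn;
  chan : ntrans net_of -> nat -> nat -> nplace net_of -> nplace net_of -> bool;
  chan_row : forall t x y p, x \in std_vars t -> y \in std_vars t ->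
    forall q q', chan t x y p q -> chan t x y p q' -> q = q';
  chan_move : forall t x y p q, x \in std_vars t -> y \in std_vars t ->
    y != x -> chan t x y p =1 pred1 q ->
    forall z, z \in std_vars t -> z != y -> chan t x z p =1 pred0;
  chan_stay : forall t x p, x \in std_vars t ->
    ~ (exists y q, [/\ y \in std_vars t, y != x & chan t x y p =1 pred1 q]) ->
    chan t x x p =1 pred1 p }.

(* [m x] is the tuple selected for x by the mode; an injective choice of tuple
   occurrences of M amounts to the decomposition of M below. *)
Definition nu_fires (W : cnupn) (t : ntrans W) (M M' : nu_conf W) : Prop :=
  exists (m : nat -> ntuple W) (R : nu_conf W),
    let X := std_vars t in
    let m'' x := [ffun p => m x p - flow_in t (inl x) p] : ntuple W in
    let m' y := [ffun q =>
      \sum_(x <- X) \sum_(p : nplace W) m'' x p * chan t x y p q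
      + flow_out t (inl y) q] : ntuple W in
    let new v := [ffun q => flow_out t (inr v) q] : ntuple W in
    [/\ forall x p, x \in X -> flow_in t (inl x) p <= m x p,
        M = R `+` seq_mset [seq m x | x <- X]
      & M' = R `+` seq_mset [seq new v | v <- fresh_vars t]
               `+` seq_mset [seq m' y | y <- X]].

Definition nu_step (W : cnupn) (M M' : nu_conf W) : Prop :=
  exists t : ntrans W, nu_fires t M M'.

(* Equality of configurations up to tuples that mark no place.  Such tuples are
   inert, since each standard variable of t occurs in the preset of t, and they
   are never removed by a firing. *)
Definition conf_eq (W : nupn) (M M' : nu_conf W) : Prop :=
  forall m : ntuple W, m != [ffun=> 0] -> M m = M' m.

(* The places of W that represent E: [None] is the control place,
   [Some (inl p)] the identifier place of p, and
   [Some (inr (Tagged _ q))], with q a place of the object net of p, the copy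
   of q for p. *)
Definition sim_place (E : eos) : finType :=
  option (place (sys E) + {p : place (sys E) & place (obj (typ p))}).

Section Simulation.
Variables (E : eos) (W : cnupn) (L : sim_place E -> nplace W).

Definition p_init : nplace W := L None.
Definition p_id (p : place (sys E)) : nplace W := L (Some (inl p)).
Definition p_copy (p : place (sys E)) (q : place (obj (typ p))) : nplace W :=
  L (Some (inr (Tagged (fun p => place (obj (typ p))) q))).

Definition enc_token (k : token E) : ntuple W :=
  [ffun w => \sum_(q : place (obj (typ (tag k)))) tagged k q * (w == p_copy q)
             + (w == p_id (tag k))].

Definition enc_conf (M : eos_conf E) : nu_conf W :=
  seq_mset [seq enc_token k | k <- M]
    `+` [mset ([ffun w => (w == p_init : nat)] : ntuple W)].

(* Nonempty runs without encoded configurations strictly in between. *)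
Inductive macro_step : nu_conf W -> nu_conf W -> Prop :=
| macro_last C C' : nu_step C C' -> macro_step C C'
| macro_more C C1 C' : nu_step C C1 ->
    (forall M : eos_conf E, ~ conf_eq C1 (enc_conf M)) ->
    macro_step C1 C' -> macro_step C C'.

Definition simulates : Prop :=
  injective L /\
  forall M M' : eos_conf E,
    eos_step M M' <->
    exists2 C, macro_step (enc_conf M) C & conf_eq C (enc_conf M').

End Simulation.

(* While programs over binary trees.  The cost of an assignment includes the
   size of the assigned value, so that running time is polynomially related to
   the running time of Turing machines. *)
Inductive data := Leaf | Node of data & data.

Fixpoint data_size (d : data) : nat :=
  if d is Node a b then (data_size a + data_size b).+1 else 1.

Inductive expr :=
  Var of nat | ELeaf | ENode of expr & expr | EHd of expr | ETl of expr.

Definition store := nat -> data.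

Definition hd (d : data) := if d is Node a _ then a else Leaf.
Definition tl (d : data) := if d is Node _ b then b else Leaf.

Fixpoint eval (s : store) (e : expr) : data :=
  match e with
  | Var i => s i
  | ELeaf => Leaf
  | ENode e1 e2 => Node (eval s e1) (eval s e2)
  | EHd e1 => hd (eval s e1)
  | ETl e1 => tl (eval s e1)
  end.

Inductive cmd :=
  Assign of nat & expr | Seq of cmd & cmd
| If of expr & cmd & cmd | While of expr & cmd.

(* [exec c s s' k]: from the store s, the program c halts in the store s' after
   time k.  [Leaf] is false, all other values are true. *)
Inductive exec : cmd -> store -> store -> nat -> Prop :=
| exec_assign i e s :
    exec (Assign i e) s (fun j => if j == i then eval s e else s j)
         (data_size (eval s e)).+1
| exec_seq c1 c2 s1 s2 s3 k1 k2 :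
    exec c1 s1 s2 k1 -> exec c2 s2 s3 k2 -> exec (Seq c1 c2) s1 s3 (k1 + k2)
| exec_if_true e c1 c2 s s' k :
    eval s e <> Leaf -> exec c1 s s' k -> exec (If e c1 c2) s s' k.+1
| exec_if_false e c1 c2 s s' k :
    eval s e = Leaf -> exec c2 s s' k -> exec (If e c1 c2) s s' k.+1
| exec_while_true e c s1 s2 s3 k1 k2 :
    eval s1 e <> Leaf -> exec c s1 s2 k1 -> exec (While e c) s2 s3 k2 ->
    exec (While e c) s1 s3 (k1 + k2).+1
| exec_while_false e c s :
    eval s e = Leaf -> exec (While e c) s s 1.

(* Input and output are in variable 0; all other variables start at [Leaf]. *)
Definition runs_in (c : cmd) (input output : data) (time : nat) : Prop :=
  exists s' k, [/\ exec c (fun j => if j == 0 then input else Leaf) s' k,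
                   s' 0 = output & k <= time].

(* Elements of finite types are given by their rank, functions by value tables,
   and numbers in unary, i.e., multisets have the size of their listing. *)
Definition enc_nat (n : nat) : data := iter n (Node Leaf) Leaf.
Definition enc_bool (b : bool) : data := enc_nat b.
Definition enc_seq (A : Type) (f : A -> data) (s : seq A) : data :=
  foldr (fun x r => Node (f x) r) Leaf s.
Definition enc_list (s : seq data) : data := enc_seq id s.
Definition enc_elt (A : finType) (a : A) : data := enc_nat (enum_rank a).
Definition enc_table (A : finType) (f : A -> data) : data := enc_seq f (enum A).

Definition enc_pn (N : pn) : data :=
  enc_list [:: enc_nat #|place N|; enc_nat #|trans N|;
    enc_table (fun p : place N => enc_table (fun t => enc_nat (arc_in p t)));
    enc_table (fun t : trans N => enc_table (fun p => enc_nat (arc_out t p)))].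

Definition enc_event (E : eos) (ev : event E) : data :=
  Node (enc_elt ev.1)
    (enc_table (fun N : net E => enc_table (fun t => enc_nat (ev.2 N t)))).

Definition enc_eos (E : eos) : data :=
  enc_list [:: enc_pn (sys E); enc_table (fun p => enc_elt (@idle E p));
    enc_table (fun N : net E => enc_pn (obj N)); enc_elt (black E);
    enc_table (fun p : place (sys E) => enc_elt (typ p));
    enc_seq (@enc_event E) (events E)].

Definition enc_var (v : var) : data :=
  match v with
  | inl x => Node (enc_bool false) (enc_nat x)
  | inr y => Node (enc_bool true) (enc_nat y)
  end.

Definition enc_nupn (W : nupn) : data :=
  enc_list [:: enc_nat #|nplace W|; enc_nat #|ntrans W|;
    enc_table (fun p : nplace W => enc_table (fun t =>
      enc_seq enc_var (narc_in p t)));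
    enc_table (fun t : ntrans W => enc_table (fun p =>
      enc_seq enc_var (narc_out t p)))].

Definition enc_chan (W : cnupn) (t : ntrans W) : data :=
  enc_seq (fun x => enc_seq (fun y =>
    Node (Node (enc_nat x) (enc_nat y))
      (enc_table (fun p => enc_table (fun q => enc_bool (chan t x y p q)))))
    (std_vars t)) (std_vars t).

Definition enc_cnupn (W : cnupn) : data :=
  Node (enc_nupn W) (enc_table (@enc_chan W)).

Definition enc_layout (E : eos) (W : cnupn) (L : sim_place E -> nplace W) :
    data :=
  enc_list [:: enc_elt (p_init L); enc_table (fun p => enc_elt (p_id L p));
    enc_table (fun p : place (sys E) =>
      enc_table (fun q : place (obj (typ p)) => enc_elt (p_copy L q)))].

(* Main.v *)
Require Import Defs.
From mathcomp Require Import all_boot finmap multiset zify.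

(** Idea.  An event of the cEOS is executed by a straight-line program over
    instructions that involve a control tuple and at most one further tuple.  A
    token of the control tuple marks the current control state; the idle state is
    the initial place.  First the consumed tokens are taken one
    by one: a channel merges the content of each of them into buffer places of
    the control tuple, one for every place of an object net.  Then the preset of
    the object transitions is subtracted from the buffers and their postset is
    added.  Finally the produced tokens are created as fresh tuples and filled
    from the buffers, unit by unit, in an arbitrary way; the last created token
    of each type receives the whole rest of the buffers of that type through a
    channel.  Conservativity makes sure that no other buffer is ever nonempty at
    the end, so that no zero test is needed.

    The net is computed in polynomial time because it is obtained from the
    encoding of the cEOS by nested maps, concatenations, sums and comparisons,
    and the functions computed by polynomial while programs are closed under
    iteration along a list with polynomially bounded intermediate values. *)

Set Implicit Arguments.
Unset Strict Implicit.
Unset Printing Implicit Defensive.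

(** * Polynomial-time while programs *)

(** Macro steps may not meet an encoded configuration strictly in between. The control state settles
    this: an encoded configuration has its control token on state 0, whereas an event in progress
    always has it on a positive state. A run that blocks does so in a positive state and thus yields
    no macro step, so blocking can stand in for the missing test of an event's applicability. What
    remains to be excluded is a return to state 0 with nonempty buffers; the last [Close] of each
    produced type excludes it, whatever was chosen by the [Fill] loops before. Buffers belong to
    object nets and not to system places, because an event constrains only the sum of the markings
    of each object net. A consumed token leaves a zero tuple behind, which no transition can remove;
    hence all statements about runs are up to [conf_eq]. On the computational side, the types of
    places, transitions and events vary with the input. The closure lemmas are therefore stated for
    families of types over the input, and a loop body is a function on a sigma type. A loop also
    needs an explicit size bound on its accumulators, since iterating a polynomial-time body may
    grow exponentially. *)

Definition polyb (f : nat -> nat) := exists d, forall n, f n <= (n + d) ^ d.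

Lemma leq_poly n d e : 0 < d -> d <= e -> (n + d) ^ d <= (n + e) ^ e.
Proof.
move=> d0 de; apply: (@leq_trans ((n + e) ^ d)).
  by rewrite leq_exp2r // leq_add2l.
by rewrite leq_pexp2l //; lia.
Qed.

Lemma polyb_pos f : polyb f -> exists2 d, 0 < d & forall n, f n <= (n + d) ^ d.
Proof.
case=> -[|d] H; last by exists d.+1.
by exists 1 => // n; apply: leq_trans (H n) _; rewrite expn0 expn1; lia.
Qed.

Lemma polyb_const c : polyb (fun=> c).
Proof. by exists c.+1 => n; apply: leq_trans (leq_pexp2l _ (ltn0Sn c)); lia. Qed.

Lemma polyb_id : polyb id.
Proof. by exists 1 => n; rewrite expn1; lia. Qed.

Lemma polyb_add f g : polyb f -> polyb g -> polyb (fun n => f n + g n).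
Proof.
move=> /polyb_pos[d d0 Hf] /polyb_pos[e e0 Hg]; exists (d + e).+1 => n.
have H1 : f n <= (n + (d + e)) ^ (d + e).
  by apply: leq_trans (Hf n) _; apply: leq_poly => //; lia.
have H2 : g n <= (n + (d + e)) ^ (d + e).
  by apply: leq_trans (Hg n) _; apply: leq_poly => //; lia.
(* The sum of the two bounds is at most twice this power, and the additional factor of the next
   power is at least 2. *)
have : (n + (d + e)) ^ (d + e) <= (n + (d + e).+1) ^ (d + e).
  by rewrite leq_exp2r; lia.
by rewrite expnS; nia.
Qed.

Lemma polyb_mul f g : polyb f -> polyb g -> polyb (fun n => f n * g n).
Proof.
move=> /polyb_pos[d d0 Hf] /polyb_pos[e e0 Hg]; exists (d + e) => n.
rewrite expnD; apply: leq_mul.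
  by apply: leq_trans (Hf n) _; rewrite leq_exp2r //; lia.
by apply: leq_trans (Hg n) _; rewrite leq_exp2r //; lia.
Qed.

Lemma polyb_exp f e : polyb f -> polyb (fun n => f n ^ e).
Proof.
move=> Hf; elim: e => [|e IH]; first by apply: (polyb_const 1).
have [d Hd] := polyb_mul Hf IH.
by exists d => n; rewrite expnS.
Qed.

Create HintDb polyb.
#[local] Hint Resolve polyb_const polyb_id polyb_add polyb_mul polyb_exp : polyb.

Lemma data_size_gt0 d : 0 < data_size d.
Proof. by case: d. Qed.

(** An assignment costs at least the size of the assigned value, so no variable grows by more than
    the elapsed time. This bounds outputs and intermediate values without inspecting the program. *)
Lemma exec_size c s s' t i :
  exec c s s' t -> data_size (s' i) <= data_size (s i) + t.
Proof.
elim=> {c s s' t} //=; try by move=> *; lia.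
by move=> j e s; case: eqP => _; lia.
Qed.

(* The parameter of the program is the variable that holds its input and output:
   smaller variables are preserved, larger ones are scratch and may initially
   hold arbitrary values, so that programs compose without renaming. *)
Definition PT (A : Type) (I O : A -> data) : Prop :=
  exists (c : nat -> cmd) (d : nat), forall x k s, s k = I x ->
  exists s' t, [/\ exec (c k) s s' t, s' k = O x, forall j, j < k -> s' j = s j
    & t <= (data_size (I x) + d) ^ d].

Definition upd (s : store) i v : store := fun j => if j == i then v else s j.

Lemma exec_upd i e s : exec (Assign i e) s (upd s i (eval s e)) (data_size (eval s e)).+1.
Proof. exact: exec_assign. Qed.

(** * Composition and branching of polynomial-time programs *)

Section Basic.
Variable A : Type.
Implicit Types I f g : A -> data.

Lemma PT_intro I f (c : nat -> cmd) (b : nat -> nat) :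
  polyb b ->
  (forall x k s, s k = I x -> exists s' t,
     [/\ exec (c k) s s' t, s' k = f x, forall j, j < k -> s' j = s j
       & t <= b (data_size (I x))]) -> PT I f.
Proof.
case=> d Hd H; exists c, d => x k s Hs; have [s' [t [? ? ? Ht]]] := H x k s Hs.
by exists s', t; split=> //; apply: leq_trans Ht (Hd _).
Qed.

Lemma PT_size I f : PT I f ->
  exists2 b, polyb b & forall x, data_size (f x) <= b (data_size (I x)).
Proof.
case=> c [d H]; exists (fun n => n + (n + d) ^ d); first by auto with polyb.
move=> x; have [s' [t [He <- _ Ht]]] := H x 0 (fun=> I x) erefl.
by apply: leq_trans (exec_size 0 He) _; rewrite leq_add2l.
Qed.

Lemma PT_ext I f g : f =1 g -> PT I f -> PT I g.
Proof.
move=> fg [c [d H]]; exists c, d => x k s Hs.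
by have := H x k s Hs; rewrite fg.
Qed.

Lemma PT_expr I f (e : nat -> expr) :
  (forall x k s, s k = I x -> eval s (e k) = f x) ->
  (exists2 b, polyb b & forall x, data_size (f x) <= b (data_size (I x))) -> PT I f.
Proof.
move=> He [b Hb Hs].
apply: (@PT_intro _ _ (fun k => Assign k (e k)) (fun n => 1 + b n)).
  by auto with polyb.
move=> x k s Hk; exists (upd s k (eval s (e k))), (data_size (eval s (e k))).+1.
split; first exact: exec_upd.
- by rewrite /upd eqxx (He x).
- by move=> j jk; rewrite /upd ltn_eqF.
- by rewrite (He x) // ltnS.
Qed.

Lemma PT_id I : PT I I.
Proof.
apply: (@PT_expr _ _ Var) => //=; exists id => //; exact: polyb_id.
Qed.

Lemma PT_leaf I : PT I (fun=> Leaf).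
Proof. by apply: (@PT_expr _ _ (fun=> ELeaf)) => //; exists (fun=> 1) => //;
    exact: polyb_const. Qed.

(** Both programs run in the same variable. By [exec_size] the intermediate value is at most the
    input plus the first running time, so the second polynomial is evaluated at a polynomial. *)
Lemma PT_comp I f g : PT I f -> PT f g -> PT I g.
Proof.
case=> c [d Hc] [c' [d' Hc']].
apply: (@PT_intro _ _ (fun k => Seq (c k) (c' k))
  (fun n => (n + d) ^ d + ((n + (n + d) ^ d) + d') ^ d')); first by auto 10 with polyb.
move=> x k s Hs.
have [s1 [t1 [E1 O1 P1 T1]]] := Hc x k s Hs.
have [s2 [t2 [E2 O2 P2 T2]]] := Hc' x k s1 O1.
exists s2, (t1 + t2); split=> //; first exact: exec_seq E1 E2.
  by move=> j jk; rewrite P2 // P1.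
have := exec_size k E1; rewrite O1 Hs => Hsz.
apply: leq_add => //; apply: leq_trans T2 _.
case: (d') => // e; rewrite leq_exp2r // leq_add2r.
by apply: leq_trans Hsz _; rewrite leq_add2l.
Qed.

Lemma PT_hd I f : PT I f -> PT I (fun x => hd (f x)).
Proof.
move=> H; apply: (PT_comp H); apply: (@PT_expr _ _ (fun k => EHd (Var k))).
  by move=> x k s /= ->.
exists id; first exact: polyb_id.
by move=> x; case: (f x) => //= a b; lia.
Qed.

Lemma PT_tl I f : PT I f -> PT I (fun x => tl (f x)).
Proof.
move=> H; apply: (PT_comp H); apply: (@PT_expr _ _ (fun k => ETl (Var k))).
  by move=> x k s /= ->.
exists id; first exact: polyb_id.
by move=> x; case: (f x) => //= a b; lia.
Qed.

(** A form of the program that reads its input from an expression and writes to a chosen variable.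
    With [k] above the variable that holds the input, the input survives and can be used again. *)
Lemma PT_call I f : PT I f ->
  exists (c : nat -> expr -> cmd) (b : nat -> nat), polyb b /\
  forall x k e s, eval s e = I x -> exists s' t,
     [/\ exec (c k e) s s' t, s' k = f x, forall j, j < k -> s' j = s j
       & t <= b (data_size (I x))].
Proof.
case=> c [d H]; exists (fun k e => Seq (Assign k e) (c k)), (fun n => (n + 1) + (n + d) ^ d).
split; first by auto with polyb.
move=> x k e s He.
have Hk : upd s k (eval s e) k = I x by rewrite /upd eqxx.
have [s' [t [E1 O1 P1 T1]]] := H x k _ Hk.
exists s', ((data_size (I x)).+1 + t); split=> //.
- by apply: exec_seq E1; rewrite -He; exact: exec_upd.
- by move=> j jk; rewrite P1 // /upd ltn_eqF.
- by rewrite addn1; apply: leq_add.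
Qed.

Lemma PT_node I f g : PT I f -> PT I g -> PT I (fun x => Node (f x) (g x)).
Proof.
move=> Hf Hg.
have [bf Pf Sf] := PT_size Hf; have [bg Pg Sg] := PT_size Hg.
have [c [b [Pb Hc]]] := PT_call Hf; have [c' [b' [Pb' Hc']]] := PT_call Hg.
apply: (@PT_intro _ _ (fun k => Seq (c k.+1 (Var k)) (Seq (c' k.+2 (Var k))
          (Assign k (ENode (Var k.+1) (Var k.+2)))))
  (fun n => b n + (b' n + (bf n + bg n + 2)))); first by auto 20 with polyb.
move=> x k s Hs.
have [s1 [t1 [E1 O1 P1 T1]]] := Hc x k.+1 (Var k) s Hs.
have Hs1 : s1 k = I x by rewrite P1.
have [s2 [t2 [E2 O2 P2 T2]]] := Hc' x k.+2 (Var k) s1 Hs1.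
have E3 := exec_upd k (ENode (Var k.+1) (Var k.+2)) s2.
eexists; eexists; split.
- apply: exec_seq E1 _; apply: exec_seq E2 E3.
- by rewrite /upd eqxx /= O2 P2 // O1.
- by move=> j jk; rewrite /upd ltn_eqF // P2 ?P1 //; lia.
- rewrite /= O2 P2 // O1; have := Sf x; have := Sg x; lia.
Qed.

Lemma PT_case I d f g : PT I d -> PT I f -> PT I g ->
  PT I (fun x => if d x is Leaf then f x else g x).
Proof.
move=> Hd Hf Hg.
have [c [b [Pb Hc]]] := PT_call Hd.
case: Hf => cf [df Hcf]; case: Hg => cg [dg Hcg].
(* A leaf counts as false, so the program for [f] is the second branch. *)
apply: (@PT_intro _ _ (fun k => Seq (c k.+1 (Var k)) (If (Var k.+1) (cg k) (cf k)))
  (fun n => b n + ((n + df) ^ df + (n + dg) ^ dg + 1))); first by auto 20 with polyb.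
move=> x k s Hs.
have [s1 [t1 [E1 O1 P1 T1]]] := Hc x k.+1 (Var k) s Hs.
have Hs1 : s1 k = I x by rewrite P1.
case Ed: (d x) => [|u v].
  have [s2 [t2 [E2 O2 P2 T2]]] := Hcf x k s1 Hs1.
  exists s2, (t1 + t2.+1); split=> //.
  - by apply: exec_seq E1 _; apply: exec_if_false E2; rewrite /= O1.
  - by move=> j jk; rewrite P2 // P1 //; lia.
  - lia.
have [s2 [t2 [E2 O2 P2 T2]]] := Hcg x k s1 Hs1.
exists s2, (t1 + t2.+1); split=> //.
- by apply: exec_seq E1 _; apply: exec_if_true E2; rewrite /= O1 Ed.
- by move=> j jk; rewrite P2 // P1 //; lia.
- lia.
Qed.
End Basic.

(** Reindexing along [h]: compute the encoding of [h y] first, then run the given program on it.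
    This is how a program is moved into a larger context. *)
Lemma PT_at (A A' : Type) (h : A' -> A) (I f : A -> data) (I' : A' -> data) :
  PT I f -> PT I' (fun y => I (h y)) -> PT I' (fun y => f (h y)).
Proof.
move=> [c [d H]] H'; apply: PT_comp H' _.
by exists c, d => y; exact: H.
Qed.

Lemma data_size_mem (B : Type) (e : B -> data) (s1 s2 : seq B) y :
  data_size (e y) <= data_size (enc_seq e (s1 ++ y :: s2)).
Proof. by elim: s1 => //= [|z s1 IH]; lia. Qed.

Lemma size_enc_seq (B : Type) (e : B -> data) s : size s < data_size (enc_seq e s).
Proof. by elim: s => //= y s IH; lia. Qed.

(** The input of a loop body: the global input together with a local value whose type may depend on
    it. Nested loops nest [ctx]. *)
Definition ctx (A : Type) (B : A -> Type) (I : A -> data) (e : forall x, B x -> data)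
  (y : {x : A & B x}) : data := Node (I (tag y)) (e _ (tagged y)).

(** The only lemma of the development that uses [While]; all iteration is reduced to it. The last
    hypothesis bounds the accumulator only after prefixes of the actual list, which is all that the
    loop visits. *)
Lemma PT_foldl (A : Type) (B C : A -> Type) (I : A -> data)
    (eB : forall x, B x -> data) (eC : forall x, C x -> data)
    (s : forall x, seq (B x)) (c0 : forall x, C x) (g : forall x, C x -> B x -> C x) :
  PT I (fun x => enc_seq (@eB x) (s x)) ->
  PT I (fun x => eC x (c0 x)) ->
  PT (ctx I (fun x (bc : B x * C x) => Node (eB x bc.1) (eC x bc.2)))
     (fun y => eC (tag y) (g _ (tagged y).2 (tagged y).1)) ->
  (exists2 b, polyb b & forall x s1 s2, s x = s1 ++ s2 ->
     data_size (eC x (foldl (g x) (c0 x) s1)) <= b (data_size (I x))) ->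
  PT I (fun x => eC x (foldl (g x) (c0 x) (s x))).
Proof.
move=> Hs Hc Hg [ba Pa Ha].
have [bs Ps Ss] := PT_size Hs.
have [cs [ts [Pts Hcs]]] := PT_call Hs; have [cc [tc [Ptc Hcc]]] := PT_call Hc.
case: Hg => cg [d Hcg].
pose body k := Seq (Assign k.+3 (ENode (Var k) (ENode (EHd (Var k.+1)) (Var k.+2))))
  (Seq (cg k.+3) (Seq (Assign k.+2 (Var k.+3)) (Assign k.+1 (ETl (Var k.+1))))).
(* [cb] bounds every value handled in one iteration, with 10 as slack for the constructors. In [tb]
   the power pays for the body; the four further summands pay for the three assignments and the loop
   test. *)
pose cb n := n + bs n + ba n + 10.
pose tb n := (cb n + d) ^ d + cb n + cb n + cb n + cb n.
have Pcb : polyb cb by rewrite /cb; auto 20 with polyb.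
have Ptb : polyb tb by rewrite /tb; auto 20 with polyb.
apply: (@PT_intro _ _ _ (fun k => Seq (cs k.+1 (Var k)) (Seq (cc k.+2 (Var k))
   (Seq (While (Var k.+1) (body k)) (Assign k (Var k.+2)))))
   (fun n => ts n + (tc n + ((bs n * tb n + 1) + (ba n + 1))))).
  by auto 20 with polyb.
move=> x k st Hst; set n := data_size (I x).
have loop l s1 st0 : s x = s1 ++ l -> st0 k = I x -> st0 k.+1 = enc_seq (@eB x) l ->
    st0 k.+2 = eC x (foldl (g x) (c0 x) s1) ->
    exists st1 t, [/\ exec (While (Var k.+1) (body k)) st0 st1 t,
      st1 k.+2 = eC x (foldl (g x) (c0 x) (s x)), forall j, j <= k -> st1 j = st0 j
      & t <= size l * tb n + 1].
  elim: l s1 st0 => [|y l IH] s1 st0 Es Ek El Ec.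
    exists st0, 1; split=> //; last by rewrite Ec Es cats0.
    by apply: exec_while_false; rewrite /= El.
  set acc := foldl _ _ s1 in Ec.
  have Sacc : data_size (eC x acc) <= ba n by apply: Ha Es.
  have Sacc' : data_size (eC x (g x acc y)) <= ba n.
    have := Ha x (rcons s1 y) l; rewrite -cats1 -catA foldl_cat; exact.
  have Sl : data_size (Node (eB x y) (enc_seq (@eB x) l)) <= bs n.
    apply: leq_trans (Ss x); rewrite Es -/(enc_seq _ (y :: l)).
    by elim: (s1) => //= z s2; lia.
  pose e3 := ENode (Var k) (ENode (EHd (Var k.+1)) (Var k.+2)).
  have E1 := exec_upd k.+3 e3 st0; set st1 := upd _ _ _ in E1.
  have v1 : eval st0 e3 = Node (I x) (Node (eB x y) (eC x acc)) by rewrite /= Ek El Ec.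
  pose z : {x : A & (B x * C x)%type} := existT _ x (y, acc).
  have [|st2 [t2 [E2 O2 P2 T2]]] := Hcg z k.+3 st1.
    by rewrite /st1 /upd eqxx v1.
  have E3 := exec_upd k.+2 (Var k.+3) st2; set st3 := upd _ _ _ in E3.
  have E4 := exec_upd k.+1 (ETl (Var k.+1)) st3; set st4 := upd _ _ _ in E4.
  have U1 j : j < k.+3 -> st1 j = st0 j by move=> ?; rewrite /st1 /upd ltn_eqF.
  have v3 : st3 k.+1 = enc_seq (@eB x) (y :: l).
    by rewrite /st3 /upd ltn_eqF // P2 // U1 // El.
  have U4 j : j <= k -> st4 j = st0 j.
    move=> jk; rewrite /st4 /upd ltn_eqF; last lia.
    rewrite /st3 /upd ltn_eqF; last lia.
    by rewrite P2 ?U1 //; lia.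
  have [||||st5 [t5 [E5 O5 P5 T5]]] := IH (rcons s1 y) st4.
  - by rewrite Es cat_rcons.
  - by rewrite U4.
  - by rewrite /st4 /upd eqxx /= v3.
  - by rewrite /st4 /upd gtn_eqF // /st3 /upd eqxx /= O2 /= -cats1 foldl_cat.
  eexists; eexists; split.
  - apply: exec_while_true E5; first by rewrite /= El.
    by apply: exec_seq E1 _; apply: exec_seq E2 _; apply: exec_seq E3 E4.
  - by [].
  - by move=> j jk; rewrite P5 // U4.
  - rewrite v1 /= v3 O2 /=.
    have Hd : (data_size (ctx I (fun x (bc : B x * C x) => Node (eB x bc.1)
        (eC x bc.2)) z) + d) ^ d
       <= (cb n + d) ^ d.
      case: (d) => // d'; rewrite leq_exp2r // leq_add2r /cb /ctx /=.
      by move: Sl Sacc => /=; rewrite -/n; lia.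
    move: T5 Sl Sacc Sacc' (leq_trans T2 Hd); rewrite mulSn /tb /cb /= -/n.
    set X := (_ + d) ^ d; set Y := size l * _; lia.
have [s1 [t1 [E1 O1 P1 T1]]] := Hcs x k.+1 (Var k) st Hst.
have Hs1 : s1 k = I x by rewrite P1.
have [s2 [t2 [E2 O2 P2 T2]]] := Hcc x k.+2 (Var k) s1 Hs1.
have [||||s3 [t3 [E3 O3 P3 T3]]] := loop (s x) [::] s2 => //.
- by rewrite P2 // ltnW.
- by rewrite P2.
have E4 := exec_upd k (Var k.+2) s3.
eexists; eexists; split.
- by apply: exec_seq E1 _; apply: exec_seq E2 _; apply: exec_seq E3 E4.
- by rewrite /upd eqxx /= O3.
- by move=> j jk; rewrite /upd ltn_eqF // P3 ?P2 ?P1 //; lia.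
- rewrite /= O3; apply: leq_add => //; apply: leq_add => //; apply: leq_add.
    apply: leq_trans T3 _; rewrite leq_add2r leq_mul2r; apply/orP; right.
    by apply: leq_trans (Ss x); apply: ltnW; exact: size_enc_seq.
  by rewrite addn1 ltnS; apply: (Ha x _ [::]); rewrite cats0.
Qed.

Lemma data_size_cat (B : Type) (e : B -> data) s1 s2 :
  (data_size (enc_seq e (s1 ++ s2))).+1 = data_size (enc_seq e s1) + data_size (enc_seq e s2).
Proof. by elim: s1 => //= y s1 IH; lia. Qed.

Lemma data_size_rev (B : Type) (e : B -> data) s :
  data_size (enc_seq e (rev s)) = data_size (enc_seq e s).
Proof.
elim: s => //= y s IH; rewrite rev_cons -cats1.
by have := data_size_cat e (rev s) [:: y]; rewrite /= IH; lia.
Qed.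

Lemma eq_enc_seq (B : Type) (e e' : B -> data) s : e =1 e' -> enc_seq e s = enc_seq e' s.
Proof. by move=> ee; elim: s => //= y s ->; rewrite ee. Qed.

Lemma enc_seq_map (B B' : Type) (e : B' -> data) (h : B -> B') s :
  enc_seq e (map h s) = enc_seq (fun b => e (h b)) s.
Proof. by elim: s => //= y s ->. Qed.

Lemma enc_natE n : enc_nat n = enc_seq (fun=> Leaf) (nseq n tt).
Proof. by elim: n => //= n ->. Qed.

Lemma iter_tl_nat m n : iter m tl (enc_nat n) = enc_nat (n - m).
Proof.
elim: m => [|m IH]; first by rewrite subn0.
by rewrite iterS IH subnS; case: (n - m).
Qed.

Lemma iter_tl_seq (B : Type) (e : B -> data) m s :
  iter m tl (enc_seq e s) = enc_seq e (drop m s).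
Proof.
elim: m => [|m IH]; first by rewrite drop0.
by rewrite iterS IH -addn1 addnC -drop_drop; case: (drop m s) => //= y s'; rewrite drop0.
Qed.

Lemma data_size_iter_tl m d : data_size (iter m tl d) <= data_size d.
Proof. by elim: m => //= m IH; apply: leq_trans IH; case: (iter m tl d) => //= a b; lia. Qed.

Lemma data_size_enc_nat n : data_size (enc_nat n) = n.*2.+1.
Proof. by elim: n => //= n ->; lia. Qed.

(** The explicit form of the bound is monotone, which an arbitrary [polyb] function need not be.
    Monotonicity matters when the size of an argument is itself only bounded. *)
Lemma PT_bound A (I f : A -> data) : PT I f ->
  exists d, forall x, data_size (f x) <= (data_size (I x) + d) ^ d.
Proof.
by move=> /PT_size[b [d Hd] H]; exists d => x; apply: leq_trans (H x) (Hd _).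
Qed.

(** * Closure under operations on lists *)

Section Closure.
Variable A : Type.
Implicit Types (I : A -> data) (B C : A -> Type).

Lemma PT_env I B (e : forall x, B x -> data) : PT (ctx I e) (fun y => I (tag y)).
Proof. by have := PT_hd (PT_id (ctx I e)). Qed.

Lemma PT_lift I B (e : forall x, B x -> data) f :
  PT I f -> PT (ctx I e) (fun y => f (tag y)).
Proof. by move=> H; exact: PT_at H (PT_env _ _). Qed.

Lemma PT_here I B (e : forall x, B x -> data) :
  PT (ctx I e) (fun y => e _ (tagged y)).
Proof. by have := PT_tl (PT_id (ctx I e)). Qed.

Lemma PT_rev I B (e : forall x, B x -> data) (s : forall x, seq (B x)) :
  PT I (fun x => enc_seq (@e x) (s x)) -> PT I (fun x => enc_seq (@e x) (rev (s x))).
Proof.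
move=> H.
have revE (T : Type) (r : seq T) : rev r = foldl (fun c b => b :: c) [::] r.
  by rewrite -{2}[r]revK foldl_rev; elim: (rev r) => //= y r' <-.
apply: (@PT_ext _ _ (fun x => enc_seq (@e x) (foldl (fun c b => b :: c) [::] (s x)))).
  by move=> x; rewrite -revE.
apply: (@PT_foldl _ B (fun x => seq (B x)) I e (fun x => enc_seq (@e x)) s
   (fun=> [::]) (fun x c b => b :: c)) => //.
- exact: PT_leaf.
- exact: (PT_tl (PT_id _)).
- have [b Pb Hb] := PT_size H; exists b => // x s1 s2 Es; apply: leq_trans (Hb x).
  rewrite -revE Es data_size_rev; have := data_size_cat (@e x) s1 s2.
  by have := data_size_gt0 (enc_seq (@e x) s2); lia.
Qed.

(** A left fold over the reversed list. Its prefixes are reversed suffixes of the original list, so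
    here the size condition concerns suffixes. *)
Lemma PT_foldr I B C (eB : forall x, B x -> data) (eC : forall x, C x -> data)
    (s : forall x, seq (B x)) (c0 : forall x, C x) (g : forall x, B x -> C x -> C x) :
  PT I (fun x => enc_seq (@eB x) (s x)) ->
  PT I (fun x => eC x (c0 x)) ->
  PT (ctx I (fun x (bc : B x * C x) => Node (eB x bc.1) (eC x bc.2)))
     (fun y => eC (tag y) (g _ (tagged y).1 (tagged y).2)) ->
  (exists2 b, polyb b & forall x s1 s2, s x = s1 ++ s2 ->
     data_size (eC x (foldr (g x) (c0 x) s2)) <= b (data_size (I x))) ->
  PT I (fun x => eC x (foldr (g x) (c0 x) (s x))).
Proof.
move=> Hs Hc Hg [b Pb Hb].
apply: (@PT_ext _ _ (fun x => eC x (foldl (fun c b => g x b c) (c0 x) (rev (s x))))).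
  by move=> x; rewrite foldl_rev.
apply: (@PT_foldl _ B C I eB eC (fun x => rev (s x)) c0 (fun x c b => g x b c)) => //.
  exact: PT_rev.
exists b => // x s1 s2 Es; rewrite -[s1]revK foldl_rev; apply: (Hb x (rev s2)).
by rewrite -rev_cat -Es revK.
Qed.

(** The images are collected as raw data by a right fold. Each element is part of the encoded list,
    so one polynomial [F] bounds every image, and the result has size about the length times [F]. *)
Lemma PT_map I B (e : forall x, B x -> data) (s : forall x, seq (B x))
    (f : forall x, B x -> data) :
  PT I (fun x => enc_seq (@e x) (s x)) ->
  PT (ctx I e) (fun y => f (tag y) (tagged y)) ->
  PT I (fun x => enc_seq (f x) (s x)).
Proof.
move=> Hs Hf.
apply: (@PT_ext _ _ (fun x => enc_list (foldr (fun b r => f x b :: r) [::] (s x)))).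
  by move=> x; elim: (s x) => //= y s' <-.
apply: (@PT_foldr I B (fun=> seq data) e (fun _ => enc_list) s
   (fun=> [::]) (fun x b r => f x b :: r)) => //.
- exact: PT_leaf.
- apply: (@PT_node _ _ (fun y : {x : A & (B x * seq data)%type} => f (tag y) (tagged y).1)
     (fun y => enc_list (tagged y).2)); last first.
    exact: PT_tl (PT_tl (PT_id _)).
  pose h (y : {x : A & (B x * seq data)%type}) : {x : A & B x} :=
    existT _ (tag y) (tagged y).1.
  apply: (@PT_at _ _ h (ctx I e) (fun y => f (tag y) (tagged y))) => //.
  apply: PT_node; first exact: PT_env.
  exact: PT_hd (PT_tl (PT_id _)).
- have [b Pb Hb] := PT_size Hs; have [d Hd] := PT_bound Hf.
  exists (fun n => b n * ((n + b n + 1 + d) ^ d + 1) + 1); first by auto 20 with polyb.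
  move=> x s1 s2 Es; set n := data_size (I x).
  set F := (_ + d) ^ d.
  have Hsz : size s2 <= b n.
    apply: leq_trans (Hb x); rewrite Es; apply: ltnW.
    by apply: leq_ltn_trans (size_enc_seq _ _); rewrite size_cat leq_addl.
  have HF y r1 r2 : s x = r1 ++ y :: r2 -> data_size (f x y) <= F.
    move=> Er; have := Hd (existT _ x y); rewrite /ctx /= => /leq_trans; apply.
    rewrite /F; case: (d) => // d'; rewrite leq_exp2r //.
    have : data_size (e x y) <= b n.
      by apply: leq_trans (Hb x); rewrite Er; exact: data_size_mem.
    by rewrite -/n; lia.
  suff: data_size (enc_list (foldr (fun b r => f x b :: r) [::] s2)) <= size s2 * (F + 1) + 1.
    by move=> /leq_trans; apply; rewrite leq_add2r leq_mul2r Hsz orbT.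
  elim: s2 s1 Es {Hsz} => //= y s2 IH s1 Es.
  have := IH (rcons s1 y); rewrite cat_rcons => /(_ Es).
  have := HF _ _ _ Es; rewrite mulSn -/(enc_list _); lia.
Qed.

Lemma PT_cat I B (e : forall x, B x -> data) (s r : forall x, seq (B x)) :
  PT I (fun x => enc_seq (@e x) (s x)) -> PT I (fun x => enc_seq (@e x) (r x)) ->
  PT I (fun x => enc_seq (@e x) (s x ++ r x)).
Proof.
move=> Hs Hr.
have catE (T : Type) (s1 s2 : seq T) : s1 ++ s2 = foldr cons s2 s1 by elim: s1 => //= y s1 ->.
apply: (@PT_ext _ _ (fun x => enc_seq (@e x) (foldr cons (r x) (s x)))).
  by move=> x; rewrite -catE.
apply: (@PT_foldr I B (fun x => seq (B x)) e (fun x => enc_seq (@e x)) s r (fun x =>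
    cons)) => //.
  exact: PT_tl (PT_id _).
have [b Pb Hb] := PT_size Hs; have [b' Pb' Hb'] := PT_size Hr.
exists (fun n => b n + b' n); first by auto with polyb.
move=> x s1 s2 Es; rewrite -catE.
have := data_size_cat (@e x) s2 (r x); have := data_size_cat (@e x) s1 s2.
have := Hb x; have := Hb' x; rewrite Es.
by have := data_size_gt0 (enc_seq (@e x) s1); lia.
Qed.

End Closure.

Lemma PT_flatten A (I : A -> data) (B : A -> Type) (e : forall x, B x -> data)
    (s : forall x, seq (seq (B x))) :
  PT I (fun x => enc_seq (enc_seq (@e x)) (s x)) ->
  PT I (fun x => enc_seq (@e x) (flatten (s x))).
Proof.
move=> Hs.
apply: (@PT_foldr _ I (fun x => seq (B x)) (fun x => seq (B x)) (fun x => enc_seq (@e x))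
   (fun x => enc_seq (@e x)) s (fun=> [::]) (fun x => cat)) => //.
- exact: PT_leaf.
- apply: (@PT_cat _ _ (fun y => B (tag y)) (fun y => @e (tag y))).
    exact: PT_hd (PT_tl (PT_id _)).
  exact: PT_tl (PT_tl (PT_id _)).
- have [b Pb Hb] := PT_size Hs; exists b => // x s1 s2 Es; apply: leq_trans (Hb x).
  rewrite Es; apply: (@leq_trans (data_size (enc_seq (enc_seq (@e x)) s2))).
    elim: s2 {Es} => //= r s2 IH; have := data_size_cat (@e x) r (flatten s2).
    by rewrite -/(flatten s2) in IH *; lia.
  have := data_size_cat (enc_seq (@e x)) s1 s2.
  by have := data_size_gt0 (enc_seq (enc_seq (@e x)) s1); lia.
Qed.

(** * Arithmetic and Booleans on unary numbers *)

Section Arith.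
Variable A : Type.
Implicit Types (I : A -> data) (B C : A -> Type) (m n : A -> nat).

Lemma PT_nat I k : PT I (fun=> enc_nat k).
Proof. by elim: k => [|k IH]; [exact: PT_leaf | apply: PT_node => //; exact: PT_leaf]. Qed.

Lemma PT_size_seq I B (e : forall x, B x -> data) (s : forall x, seq (B x)) :
  PT I (fun x => enc_seq (@e x) (s x)) -> PT I (fun x => enc_nat (size (s x))).
Proof.
move=> Hs; apply: (@PT_ext _ _ (fun x => enc_seq (fun=> Leaf) (s x))).
  by move=> x; elim: (s x) => //= y s' ->.
by apply: (PT_map Hs); exact: PT_leaf.
Qed.

Lemma PT_nat_seq I n : PT I (fun x => enc_nat (n x)) ->
  PT I (fun x => enc_seq (fun=> Leaf) (nseq (n x) tt)).
Proof. by apply: PT_ext => x; rewrite enc_natE. Qed.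

Lemma PT_nseq I B (e : forall x, B x -> data) n (b : forall x, B x) :
  PT I (fun x => enc_nat (n x)) -> PT I (fun x => e x (b x)) ->
  PT I (fun x => enc_seq (@e x) (nseq (n x) (b x))).
Proof.
move=> Hn Hb; apply: (@PT_ext _ _ (fun x => enc_seq (fun=> e x (b x)) (nseq (n x) tt))).
  by move=> x; elim: (n x) => //= k ->.
apply: (@PT_map _ I (fun=> unit) (fun _ _ => Leaf) _ (fun x _ => e x (b x))).
  exact: PT_nat_seq.
exact: (PT_lift _ Hb).
Qed.

Lemma PT_succ I n : PT I (fun x => enc_nat (n x)) -> PT I (fun x => enc_nat (n x).+1).
Proof. by move=> Hn; apply: PT_node => //; exact: PT_leaf. Qed.

(** A unary number is a list of leaves, so a sum is a flattened list of blocks. *)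
Lemma PT_sum I B (e : forall x, B x -> data) (s : forall x, seq (B x))
    (f : forall x, B x -> nat) :
  PT I (fun x => enc_seq (@e x) (s x)) ->
  PT (ctx I e) (fun y => enc_nat (f (tag y) (tagged y))) ->
  PT I (fun x => enc_nat (\sum_(b <- s x) f x b)).
Proof.
move=> Hs Hf.
apply: (@PT_ext _ _ (fun x => enc_seq (fun=> Leaf) (flatten [seq nseq (f x b) tt | b <- s x]))).
  move=> x; rewrite enc_natE; congr enc_seq.
  elim: (s x) => [|y s' IH]; first by rewrite big_nil.
  by rewrite big_cons nseqD /= IH.
apply: (@PT_flatten _ I (fun=> unit) (fun _ _ => Leaf)).
apply: (@PT_ext _ _ (fun x => enc_seq (fun b => enc_nat (f x b)) (s x))).
  by move=> x; rewrite enc_seq_map; apply: eq_enc_seq => b; rewrite enc_natE.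
by apply: (PT_map Hs).
Qed.

Lemma PT_mul I m n : PT I (fun x => enc_nat (m x)) -> PT I (fun x => enc_nat (n x)) ->
  PT I (fun x => enc_nat (m x * n x)).
Proof.
move=> Hm Hn; apply: (@PT_ext _ _ (fun x => enc_nat (\sum_(b <- nseq (m x) tt) n x))).
  by move=> x; rewrite big_const_seq count_predT size_nseq iter_addn_0 mulnC.
by apply: (PT_sum (PT_nat_seq Hm)); exact: (PT_lift _ Hn).
Qed.

Lemma PT_iter_tl I n d : PT I (fun x => enc_nat (n x)) -> PT I d ->
  PT I (fun x => iter (n x) tl (d x)).
Proof.
move=> Hn Hd.
have E k c : iter k tl c = foldl (fun c (_ : unit) => tl c) c (nseq k tt).
  by elim: k c => //= k IH c; rewrite -IH -iterSr.
apply: (@PT_ext _ _ (fun x => foldl (fun c (_ : unit) => tl c) (d x) (nseq (n x) tt))).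
  by move=> x; rewrite -E.
apply: (@PT_foldl _ (fun=> unit) (fun=> data) I (fun _ _ => Leaf) (fun _ => id) _ d
  (fun _ c _ => tl c)) => //.
- exact: PT_nat_seq.
- exact: PT_tl (PT_tl (PT_tl (PT_id _))).
- have [b Pb Hb] := PT_size Hd; exists b => // x s1 s2 Es; apply: leq_trans (Hb x).
  have -> : s1 = nseq (size s1) tt by elim: (s1) => //= -[] s' <-.
  by rewrite -E; exact: data_size_iter_tl.
Qed.

(** The tail of a leaf is a leaf, so repeated tails compute exactly the truncated subtraction. *)
Lemma PT_sub I m n : PT I (fun x => enc_nat (m x)) -> PT I (fun x => enc_nat (n x)) ->
  PT I (fun x => enc_nat (m x - n x)).
Proof.
move=> Hm Hn; apply: PT_ext (PT_iter_tl Hn Hm) => x; exact: iter_tl_nat.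
Qed.

Lemma PT_if I (b : A -> bool) f g : PT I (fun x => enc_bool (b x)) -> PT I f -> PT I g ->
  PT I (fun x => if b x then f x else g x).
Proof.
move=> Hb Hf Hg; apply: PT_ext (PT_case Hb Hg Hf) => x; by case: (b x).
Qed.

Lemma PT_bool I b : PT I (fun=> enc_bool b).
Proof. exact: PT_nat. Qed.

Lemma PT_not I (b : A -> bool) :
  PT I (fun x => enc_bool (b x)) -> PT I (fun x => enc_bool (~~ b x)).
Proof.
move=> Hb; apply: PT_ext (PT_if Hb (PT_bool I false) (PT_bool I true)) => x.
by case: (b x).
Qed.

Lemma PT_and I (b c : A -> bool) :
  PT I (fun x => enc_bool (b x)) -> PT I (fun x => enc_bool (c x)) ->
  PT I (fun x => enc_bool (b x && c x)).
Proof.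
by move=> Hb Hc; apply: PT_ext (PT_if Hb Hc (PT_bool I false)) => x; case: (b x).
Qed.

Lemma PT_nilp I B (e : forall x, B x -> data) (s : forall x, seq (B x)) :
  PT I (fun x => enc_seq (@e x) (s x)) -> PT I (fun x => enc_bool (nilp (s x))).
Proof.
move=> H; apply: PT_ext (PT_case H (PT_bool I true) (PT_bool I false)) => x.
by case: (s x).
Qed.

Lemma PT_leq I m n : PT I (fun x => enc_nat (m x)) -> PT I (fun x => enc_nat (n x)) ->
  PT I (fun x => enc_bool (m x <= n x)).
Proof.
move=> Hm Hn.
apply: PT_ext (PT_case (PT_sub Hm Hn) (PT_bool I true) (PT_bool I false)) => x.
by rewrite -subn_eq0; case: (m x - n x).
Qed.

Lemma PT_eqn I m n : PT I (fun x => enc_nat (m x)) -> PT I (fun x => enc_nat (n x)) ->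
  PT I (fun x => enc_bool (m x == n x)).
Proof.
move=> Hm Hn; apply: PT_ext (PT_and (PT_leq Hm Hn) (PT_leq Hn Hm)) => x.
by rewrite -eqn_leq.
Qed.

End Arith.

(** * Searching in lists and looking up tables *)

Section Search.
Variable A : Type.
Implicit Types (I : A -> data) (B C : A -> Type).

Lemma PT_find I B (e : forall x, B x -> data) (s : forall x, seq (B x)) (a : forall x, pred
    (B x)) :
  PT I (fun x => enc_seq (@e x) (s x)) ->
  PT (ctx I e) (fun y => enc_bool (a (tag y) (tagged y))) ->
  PT I (fun x => enc_nat (find (a x) (s x))).
Proof.
move=> Hs Ha.
have E (T : Type) (p : pred T) r : find p r = foldr (fun b k => if p b then 0 else k.+1) 0 r.
  by elim: r => //= y r ->.
apply: (@PT_ext _ _ (fun x => enc_nat (foldr (fun b k => if a x b then 0 else k.+1) 0 (s x)))).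
  by move=> x; rewrite -E.
apply: (@PT_foldr _ I B (fun=> nat) e (fun _ => enc_nat) s (fun=> 0)
   (fun x b k => if a x b then 0 else k.+1)) => //.
- exact: PT_leaf.
- pose h (y : {x : A & (B x * nat)%type}) : {x : A & B x} := existT _ (tag y) (tagged y).1.
  apply: (@PT_ext _ _ (fun y => if a (tag y) (tagged y).1 then enc_nat 0
     else Node Leaf (enc_nat (tagged y).2))); first by move=> y; case: ifP.
  apply: PT_if.
  + apply: (@PT_at _ _ h (ctx I e) (fun y => enc_bool (a (tag y) (tagged y)))) => //.
    apply: PT_node; first exact: PT_env.
    exact: PT_hd (PT_tl (PT_id _)).
  + exact: PT_leaf.
  + apply: PT_node; first exact: PT_leaf.
    exact: PT_tl (PT_tl (PT_id _)).
- have [b Pb Hb] := PT_size Hs.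
  exists (fun n => b n + b n + 1); first by auto with polyb.
  move=> x s1 s2 Es; rewrite -E data_size_enc_nat.
  have Hsz : size (s x) = size s1 + size s2 by rewrite Es size_cat.
  by have := find_size (a x) s2; have := size_enc_seq (@e x) (s x); have := Hb x; lia.
Qed.

Lemma PT_has I B (e : forall x, B x -> data) (s : forall x, seq (B x)) (a : forall x, pred
    (B x)) :
  PT I (fun x => enc_seq (@e x) (s x)) ->
  PT (ctx I e) (fun y => enc_bool (a (tag y) (tagged y))) ->
  PT I (fun x => enc_bool (has (a x) (s x))).
Proof.
move=> Hs Ha.
apply: PT_ext (PT_leq (PT_succ (PT_find Hs Ha)) (PT_size_seq Hs)) => x.
by rewrite has_find.
Qed.

Lemma PT_count I B (e : forall x, B x -> data) (s : forall x, seq (B x)) (a : forall x, pred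
    (B x)) :
  PT I (fun x => enc_seq (@e x) (s x)) ->
  PT (ctx I e) (fun y => enc_bool (a (tag y) (tagged y))) ->
  PT I (fun x => enc_nat (count (a x) (s x))).
Proof.
move=> Hs Ha; apply: PT_ext (@PT_sum _ I B e s (fun x b => a x b) Hs Ha) => x.
have -> // : \sum_(b <- s x) a x b = count (a x) (s x).
by elim: (s x) => [|y r IH]; rewrite ?big_nil // big_cons IH.
Qed.

(** An element is encoded by its rank, so its entry is the head of the table after that many
    tails. *)
Lemma PT_table I (B : A -> finType) (f : forall x, B x -> data) (b : forall x, B x) :
  PT I (fun x => enc_table (f x)) -> PT I (fun x => enc_elt (b x)) ->
  PT I (fun x => f x (b x)).
Proof.
move=> Ht Hb; apply: PT_ext (PT_hd (PT_iter_tl Hb Ht)) => x.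
rewrite iter_tl_seq (drop_nth (b x)) /= ?nth_enum_rank //.
by rewrite -cardE.
Qed.

End Search.

(** * Nets with a control tuple *)

Local Open Scope mset_scope.
Local Open Scope nat_scope.

(** This order fixes both the order in which the arcs are scanned for variables and the ranks of the
    places in the encoded net. *)
Lemma enum_sum (T1 T2 : finType) :
  enum {: T1 + T2} = map inl (enum T1) ++ map inr (enum T2).
Proof. by rewrite !enumT {1}unlock. Qed.

(* A transition with at most two standard variables: 0 for the control tuple,
   which also moves a token from the control state src to dst, and 1 for a
   further tuple.  mv10 lists the pairs of places such that the whole content of
   the first place of tuple 1 is transferred to the second place of tuple 0,
   and mv01 the transfers in the other direction. *)
Record desc (Q : eqType) := Desc {
  src : nat; dst : nat;
  in0 : seq Q; in1 : seq Q; out0 : seq Q; out1 : seq Q; new : seq Q;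
  mv10 : seq (Q * Q); mv01 : seq (Q * Q) }.

(** Variable 1 may occur in postsets and channels only if it occurs in a preset, which the third
    condition ensures. Distinct sources of the transfers give at most one 1 in each row of a channel
    matrix. *)
Definition wf_desc (Q : eqType) n (d : desc Q) : bool :=
  [&& src d <= n, dst d <= n,
      (in1 d == [::]) ==> [&& out1 d == [::], mv10 d == [::] & mv01 d == [::]],
      uniq (unzip1 (mv10 d)) & uniq (unzip1 (mv01 d))].

Section DescNet.
Variables (Q : finType) (n : nat) (ds : seq (desc Q)).
Hypothesis wf_ds : all (wf_desc n) ds.

Let P : finType := (Q + 'I_n.+1)%type.
Let T : finType := 'I_(size ds).

Definition dnth (t : 'I_(size ds)) : desc Q := tnth (in_tuple ds) t.

Lemma wf_dnth t : wf_desc n (dnth t).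
Proof.
rewrite /dnth (tnth_nth (dnth t)) /=; exact: (all_nthP _ wf_ds).
Qed.

Implicit Types (d : desc Q) (w : Q + 'I_n.+1).

Definition cnt (l : seq Q) w : nat := if w is inl q then count_mem q l else 0.
Definition pcm (s : nat) w : nat := if w is inr i then (i == s :> nat) else 0.

Definition darc_in w d : seq var :=
  nseq (pcm (src d) w + cnt (in0 d) w) (inl 0) ++ nseq (cnt (in1 d) w) (inl 1).
Definition darc_out d w : seq var :=
  nseq (cnt (out1 d) w) (inl 1) ++ nseq (cnt (new d) w) (inr 0) ++
  nseq (pcm (dst d) w + cnt (out0 d) w) (inl 0).

(** A place that is the source of a transfer loses its diagonal entry, as condition (b) on channels
    demands. Every other place, in particular every control state, keeps its content. *)
Definition dchan d (x y : nat) w w' : bool :=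
  match w, w' with
  | inl q, inl q' =>
      let mv := if x == 0 then mv01 d else mv10 d in
      if x == y then (q == q') && (q \notin unzip1 mv) else (q, q') \in mv
  | inr i, inr j => (x == y) && (i == j)
  | _, _ => false
  end.

Lemma darc_fresh w t y : inr y \notin darc_in w (dnth t).
Proof. by rewrite mem_cat !mem_nseq !andbF. Qed.

Lemma darc_std t w x : inl x \in darc_out (dnth t) w ->
  exists w', inl x \in darc_in w' (dnth t).
Proof.
have /and5P[Hs _ Ho _ _] := wf_dnth t; set d := dnth t in Hs Ho *.
rewrite !mem_cat !mem_nseq andbF /= => /orP[/andP[H /eqP[->]]|/andP[_ /eqP[->]]].
  case Ein: (in1 d) Ho => [|q l] /=.
    by case/and3P=> /eqP Eo; rewrite Eo in H; case: w H.
  by exists (inl q); rewrite mem_cat !mem_nseq Ein /= eqxx orbT.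
exists (inr (inord (src d))); rewrite mem_cat mem_nseq /=.
by rewrite inordK ?ltnS // eqxx.
Qed.

Definition desc_nupn : nupn :=
  @NuPN P T (fun w t => darc_in w (dnth t)) (fun t w => darc_out (dnth t) w)
    darc_fresh darc_std.

Definition has1 d := in1 d != [::].

(** [undup] keeps the last occurrence of each element, so a final 0 stays at the end. *)
Lemma undup_rcons01 (s : seq nat) : {subset s <= [:: 0; 1]} ->
  undup (rcons s 0) = if 1 \in s then [:: 1; 0] else [:: 0].
Proof.
elim: s => //= x s IH Hs.
have Hs' : {subset s <= [:: 0; 1]} by move=> y ys; apply: Hs; rewrite inE ys orbT.
have := Hs x; rewrite inE eqxx => /(_ isT); rewrite !inE mem_rcons inE IH // => /orP[]/eqP->.
  by rewrite eqxx.
by rewrite /=; case: (1 \in s).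
Qed.

Lemma pmap_nseq (A B : Type) (f : A -> option B) k a :
  pmap f (nseq k a) = if f a is Some b then nseq k b else [::].
Proof. by elim: k => [|k IH] /=; [case: (f a) | rewrite IH; case: (f a)]. Qed.

Lemma pmap_flatten (A B C : Type) (f : A -> option B) (g : C -> seq A) s :
  pmap f (flatten [seq g x | x <- s]) = flatten [seq pmap f (g x) | x <- s].
Proof. by elim: s => //= x s <-; rewrite pmap_cat. Qed.

Lemma flatten_pc (A : Type) (a : A) s : s <= n ->
  flatten [seq nseq (i == s :> nat) a | i : 'I_n.+1 <- enum 'I_n.+1] = [:: a].
Proof.
move=> sn; transitivity (flatten [seq nseq (i == s) a | i <- iota 0 n.+1]).
  by rewrite -val_enum_ord -[in RHS]map_comp; congr flatten; apply: eq_map.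
have -> : n.+1 = s + (1 + (n - s)) by lia.
rewrite iotaD map_cat flatten_cat iotaD map_cat flatten_cat /= add0n eqxx.
have E m k : ~~ (m <= s < m + k) -> flatten [seq nseq (i == s) a | i <- iota m k] = [::].
  elim: k m => //= k IH m Hm; rewrite IH; last lia.
  by have -> : (m == s) = false by lia.
by rewrite !E //; lia.
Qed.

Lemma has1P t : 1 \in std_vars (W := desc_nupn) t = has1 (dnth t).
Proof.
have /and5P[Hs _ Ho _ _] := wf_dnth t; set d := dnth t in Hs Ho *.
rewrite /std_vars mem_undup mem_pmap; apply/mapP/idP; last first.
  rewrite /has1; case Ein: (in1 d) => [|q l] // _.
  exists (inl 1) => //; rewrite mem_cat; apply/orP; left; apply/flatten_mapP.
  exists (inl q); first by rewrite mem_enum.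
  by rewrite mem_cat !mem_nseq -/d Ein /= eqxx orbT.
case=> -[[|[|x]]|y] //; rewrite mem_cat => /orP[] /flatten_mapP[w _] + _.
  rewrite mem_cat !mem_nseq /= andbF /= andbT -/d /has1.
  by apply: contraTneq => ->; case: w.
rewrite !mem_cat !mem_nseq /= !andbF !orbF andbT -/d /has1 => H.
by apply: contraTneq Ho => ->; rewrite eqxx /=; case: (w) H => //= q; case: (out1 d).
Qed.

(** The order is part of the result: the encoding of the channels follows the order of [std_vars],
    and the program must reproduce it. *)
Lemma std_varsE t :
  std_vars (W := desc_nupn) t = if has1 (dnth t) then [:: 1; 0] else [:: 0].
Proof.
have := has1P t; have /and5P[_ Hd _ _ _] := wf_dnth t; set d := dnth t in Hd *.
rewrite /std_vars /arc_vars pmap_cat; set f := fun v => _; set s1 := pmap _ _.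
rewrite pmap_flatten [X in _ ++ flatten
    (map _ X)]enum_sum map_cat flatten_cat -(map_comp _ inl) -(map_comp _ inr).
set s2 := flatten _; set s3 := flatten _.
(* The arcs into control states are scanned last, and there is exactly one of them, labelled with
   variable 0. *)
have -> : s3 = [:: 0].
  rewrite -(flatten_pc 0 Hd) /s3; congr flatten; apply: eq_map => i /=.
  by rewrite pmap_nseq addn0.
rewrite catA cats1 => H.
have Hsub : {subset s1 ++ s2 <= [:: 0; 1]}.
  move=> x; rewrite mem_cat => /orP[].
    rewrite mem_pmap => /mapP[v /flatten_mapP[w _]]; rewrite mem_cat !mem_nseq.
    by case/orP=> /andP[_ /eqP->] [->].
  case/flatten_mapP=> w _; rewrite /= !pmap_cat !pmap_nseq !mem_cat !mem_nseq !inE.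
  by case/orP=> /andP[_ ->]; rewrite ?orbT.
rewrite undup_rcons01 // -H mem_undup mem_rcons inE /=.
by [].
Qed.

Lemma fresh_varsE t :
  fresh_vars (W := desc_nupn) t = nseq (new (dnth t) != [::]) 0.
Proof.
rewrite /fresh_vars; set f := fun v => _; set s := pmap _ _.
have Hs : s = nseq (size s) 0.
  apply/all_pred1P/allP => x; rewrite mem_pmap => /mapP[v].
  rewrite mem_cat => /orP[] /flatten_mapP[w _]; rewrite !mem_cat !mem_nseq.
    by case/orP=> /andP[_ /eqP->].
  by case/or3P=> /andP[_ /eqP->] // [->] /=.
have U k : undup (nseq k 0) = nseq (k != 0) 0.
  by elim: k => //= k IH; rewrite IH mem_nseq eqxx andbT; case: k {IH}.
rewrite Hs U; congr nseq; congr nat_of_bool.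
rewrite size_eq0; case Hn: (new (dnth t)) => [|q l] /=.
  apply/negbF/eqP; case E: s => [|x s'] //.
  have : x \in s by rewrite E mem_head.
  rewrite mem_pmap => /mapP[v]; rewrite mem_cat => /orP[] /flatten_mapP[w _].
    by rewrite mem_cat !mem_nseq => /orP[] /andP[_ /eqP->].
  rewrite !mem_cat !mem_nseq Hn => /or3P[] /andP[H /eqP->] //.
  by case: (w) H.
suff : 0 \in s by case: (s).
rewrite mem_pmap; apply/mapP; exists (inr 0) => //; rewrite mem_cat; apply/orP; right.
apply/flatten_mapP; exists (inl q); first by rewrite mem_enum.
by rewrite !mem_cat !mem_nseq Hn /= eqxx orbT.
Qed.

Lemma std_vars_leq1 t x : x \in std_vars (W := desc_nupn) t -> x = 0 \/ x = 1 /\ has1 (dnth t).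
Proof.
rewrite std_varsE; case: ifP => H; rewrite !inE; last by move/eqP; left.
by case/orP=> /eqP->; [right | left].
Qed.

Lemma uniq_unzip1 (q q1 q2 : Q) mv : uniq (unzip1 mv) ->
  (q, q1) \in mv -> (q, q2) \in mv -> q1 = q2.
Proof.
elim: mv => //= -[u v] mv IH /andP[nu U]; rewrite !inE.
have N r : (u, r) \in mv -> False by move=> H; case/negP: nu; apply/mapP; exists (u, r).
case/orP=> [/eqP[-> ->]|H1] /orP[/eqP[]|H2] //.
- by case: (N _ H2).
- by move=> Eq _; rewrite Eq in H1; case: (N _ H1).
- exact: IH.
Qed.

Lemma dchan_row t x y w :
  x \in std_vars (W := desc_nupn) t -> y \in std_vars (W := desc_nupn) t ->
  forall w1 w2, dchan (dnth t) x y w w1 -> dchan (dnth t) x y w w2 -> w1 = w2.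
Proof.
move=> _ _ [q1|i1] [q2|i2]; case: w => [q|i] //=.
- have /and5P[_ _ _ U1 U2] := wf_dnth t.
  case: ifP => _; first by move=> /andP[/eqP<- _] /andP[/eqP<- _].
  by move=> H1 H2; congr inl; apply: uniq_unzip1 H1 H2; case: ifP.
- by move=> /andP[_ /eqP<-] /andP[_ /eqP<-].
Qed.

(** With only the variables 0 and 1 available, [z] must be [x], so the claim is about the diagonal
    block: it loses the row of a transferred place. *)
Lemma dchan_move t x y w w1 :
  x \in std_vars (W := desc_nupn) t -> y \in std_vars (W := desc_nupn) t ->
  y != x -> dchan (dnth t) x y w =1 pred1 w1 ->
  forall z, z \in std_vars (W := desc_nupn) t -> z != y -> dchan (dnth t) x z w =1 pred0.
Proof.
move=> /std_vars_leq1 Hx /std_vars_leq1 Hy yx Hw z /std_vars_leq1 Hz zy w2.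
have -> : z = x by move: Hx Hy Hz yx zy; case=> [->|[-> _]] [->|[-> _]] [->|[-> _]].
have := Hw w1; rewrite /= eqxx; case: w {Hw} => [q|i]; case: w1 => [q1|i1] //=.
  rewrite (negbTE (_ : x != y)) 1?eq_sym // => Hm.
  case: w2 => // q2; rewrite eqxx.
  by rewrite (_ : q \in _) ?andbF //; apply/mapP; exists (q, q1).
by rewrite (negbTE (_ : x != y)) 1?eq_sym.
Qed.

(** If the diagonal entry at [w] is missing, then [w] is the source of a transfer, and this transfer
    is a unit row towards the other variable, against the hypothesis. *)
Lemma dchan_stay t x w : x \in std_vars (W := desc_nupn) t ->
  ~ (exists y w1, [/\ y \in std_vars (W := desc_nupn) t, y != x
                   & dchan (dnth t) x y w =1 pred1 w1]) ->
  dchan (dnth t) x x w =1 pred1 w.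
Proof.
move=> Hx H w2; case: w H => [q|i] H; last by case: w2 => [q2|i2] //=; rewrite eqxx eq_sym.
case: w2 => [q2|i2] //=; rewrite eqxx; set mv := if _ then _ else _.
rewrite [RHS]eq_sym (_ : q \notin unzip1 mv) ?andbT //; apply/negP => /mapP[[u q1] Hm /= Eu].
rewrite -{}Eu in Hm *; have /and5P[_ _ Ho U1 U2] := wf_dnth t.
have Hh : has1 (dnth t).
  apply: contraTT Ho; rewrite negbK => /eqP ->; rewrite /= !negb_and.
  by move: Hm; rewrite /mv; case: (x == 0); [case: (mv01 _) | case: (mv10 _)] => //= *;
      rewrite !orbT.
(* [1 - x] is the other one of the two variables; it belongs to the transition because of [Hh]. *)
apply: H; exists (1 - x), (inl q1); split.
- by rewrite std_varsE Hh; case/std_vars_leq1: Hx => [->|[-> _]].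
- by case/std_vars_leq1: Hx => [->|[-> _]].
move=> [q2'|i2'] //=; have -> : (x == 1 - x) = false.
  by case/std_vars_leq1: Hx => [->|[-> _]].
rewrite -/mv; apply/idP/eqP => [H2|[->]] //.
congr inl; apply: uniq_unzip1 H2 Hm; by rewrite /mv; case: ifP.
Qed.

Definition desc_net : cnupn :=
  @CNuPN desc_nupn (fun t => dchan (dnth t)) dchan_row dchan_move dchan_stay.

Implicit Type f : Q + 'I_n.+1 -> nat.

Definition transfer (mv : seq (Q * Q)) f w : nat :=
  if w is inl q then \sum_(m <- mv) f (inl m.1) * (m.2 == q) else 0.
Definition kept (mv : seq (Q * Q)) f w : nat :=
  if w is inl q then if q \in unzip1 mv then 0 else f w else f w.

Definition rem0 d f w := f w - (pcm (src d) w + cnt (in0 d) w).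
Definition rem1 d f w := f w - cnt (in1 d) w.

Definition next0 d (m1 m0 : ntuple desc_net) : ntuple desc_net :=
  [ffun w => kept (mv01 d) (rem0 d m0) w + transfer (mv10 d) (rem1 d m1) w
             + (pcm (dst d) w + cnt (out0 d) w)].
Definition next1 d (m1 m0 : ntuple desc_net) : ntuple desc_net :=
  [ffun w => kept (mv10 d) (rem1 d m1) w + transfer (mv01 d) (rem0 d m0) w
             + cnt (out1 d) w].

(** Distinct sources mean that no [u] is counted twice on the right, which turns a column of the
    channel matrix into a sum over the list of transfers. *)
Lemma sum_transfer (g : Q -> nat) (mv : seq (Q * Q)) q : uniq (unzip1 mv) ->
  \sum_u g u * ((u, q) \in mv) = \sum_(m <- mv) g m.1 * (m.2 == q).
Proof.
elim: mv => [|[u v] mv IH] /=.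
  by rewrite big_nil big1 // => u _; rewrite muln0.
case/andP=> nu U; rewrite big_cons -IH //= (bigD1 u) //= [in RHS](bigD1 u) //=.
rewrite !inE xpair_eqE eqxx /= [q == v]eq_sym.
have -> : ((u, q) \in mv) = false.
  by apply: contraNF nu => H; apply/mapP; exists (u, q).
rewrite orbF muln0 add0n; congr (_ + _); apply: eq_bigr => u' Hu'.
by rewrite inE xpair_eqE (negbTE Hu').
Qed.

Lemma sum_chan_move t (x y : nat) f w : x != y -> x < 2 ->
  \sum_(w' : Q + 'I_n.+1) f w' * dchan (dnth t) x y w' w =
  transfer (if x == 0 then mv01 (dnth t) else mv10 (dnth t)) f w.
Proof.
move=> xy x2; have /and5P[_ _ _ U1 U2] := wf_dnth t.
rewrite big_sumType /=; case: w => [q|i] /=; rewrite (negbTE xy).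
  rewrite [X in _ + X]big1 ?addn0 => [|i _]; last by rewrite muln0.
  by rewrite (sum_transfer (fun u => f (inl u))) //; case: ifP.
by rewrite !big1 // => u _; rewrite muln0.
Qed.

Lemma sum_chan_stay t (x : nat) f w :
  \sum_(w' : Q + 'I_n.+1) f w' * dchan (dnth t) x x w' w =
  kept (if x == 0 then mv01 (dnth t) else mv10 (dnth t)) f w.
Proof.
rewrite (bigD1 w) //= big1 ?addn0 => [|w' Hw'].
  case: w => [q|i] /=; last by rewrite !eqxx muln1.
  by rewrite !eqxx /=; case: (_ \in _); rewrite ?muln0 ?muln1.
case: w w' Hw' => [q|i] [q'|i'] //= H; rewrite ?muln0 ?eqxx //=.
  by rewrite (negbTE (_ : q' != q)) ?muln0.
by rewrite (negbTE (_ : i' != i)) ?muln0.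
Qed.

Lemma flow_in0 t w : flow_in (W := desc_nupn) t (inl 0) w =
  pcm (src (dnth t)) w + cnt (in0 (dnth t)) w.
Proof. by rewrite /flow_in count_cat !count_nseq /= mul1n mul0n addn0. Qed.

Lemma flow_in1 t w : flow_in (W := desc_nupn) t (inl 1) w = cnt (in1 (dnth t)) w.
Proof. by rewrite /flow_in count_cat !count_nseq /= mul1n mul0n. Qed.

Lemma flow_out0 t w : flow_out (W := desc_nupn) t (inl 0) w =
  pcm (dst (dnth t)) w + cnt (out0 (dnth t)) w.
Proof. by rewrite /flow_out !count_cat !count_nseq /= mul1n !mul0n. Qed.

Lemma flow_out1 t w : flow_out (W := desc_nupn) t (inl 1) w = cnt (out1 (dnth t)) w.
Proof. by rewrite /flow_out !count_cat !count_nseq /= mul1n !mul0n !addn0. Qed.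

Lemma flow_new t w : flow_out (W := desc_nupn) t (inr 0) w = cnt (new (dnth t)) w.
Proof. by rewrite /flow_out !count_cat !count_nseq /= mul1n !mul0n !addn0. Qed.

(** Replaces modes and matrix products by an explicit pair of tuples. If the transition has no
    second tuple, [m1] has no influence, because well-formedness makes the transfers empty. *)
Lemma nu_firesE t d (M M' : nu_conf desc_net) : dnth t = d ->
  nu_fires (W := desc_net) t M M' <->
  exists (m1 m0 : ntuple desc_net) (R : nu_conf desc_net),
  [/\ forall w, pcm (src d) w + cnt (in0 d) w <= m0 w,
      has1 d -> forall w, cnt (in1 d) w <= m1 w,
      M = R `+` seq_mset (rcons (nseq (has1 d) m1) m0)
    & M' = R `+` seq_mset (nseq (new d != [::]) [ffun w => cnt (new d) w])
             `+` seq_mset (rcons (nseq (has1 d) (next1 d m1 m0)) (next0 d m1 m0))].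
Proof.
move=> Ed; rewrite -{d}Ed; set d := dnth t.
pose m'' (m : nat -> ntuple desc_net) x : ntuple desc_net :=
  [ffun p => m x p - flow_in (W := desc_nupn) t (inl x) p].
pose m' (m : nat -> ntuple desc_net) y : ntuple desc_net := [ffun q =>
      \sum_(x <- std_vars (W := desc_net) t) \sum_(p : nplace desc_net)
         m'' m x p * dchan (dnth t) x y p q + flow_out (W := desc_nupn) t (inl y) q].
have E0 m : m' m 0 = next0 d (m 1) (m 0).
  apply/ffunP => w; rewrite !ffunE flow_out0; congr (_ + _).
  have Hk : \sum_(p : nplace desc_net) m'' m 0 p * dchan (dnth t) 0 0 p w
       = kept (mv01 d) (rem0 d (m 0)) w.
    rewrite sum_chan_stay /=; case: (w) => [q|i] /=; rewrite ?ffunE ?flow_in0 //.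
  rewrite std_varsE -/d; case: ifP => H; rewrite !big_cons big_nil addn0 Hk.
    rewrite [RHS]addnC; congr (_ + _); rewrite sum_chan_move //=; case: (w) => [q|i] //=.
    by apply: eq_bigr => k _; rewrite ffunE flow_in1.
  (* Without a second tuple, [mv10] is empty, so the transfer term of [next0] vanishes. *)
  have /and5P[_ _ + _ _] := wf_dnth t; rewrite -/d (eqP (negbFE H)) /= => /and3P[_ /eqP-> _].
  by case: (w) => [q|i] /=; rewrite ?big_nil addn0.
have E1 m : has1 d -> m' m 1 = next1 d (m 1) (m 0).
  move=> H; apply/ffunP => w; rewrite !ffunE flow_out1; congr (_ + _).
  rewrite std_varsE -/d H !big_cons big_nil addn0; congr (_ + _).
    by rewrite sum_chan_stay /=; case: (w) => [q|i] /=; rewrite ?ffunE ?flow_in1.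
  rewrite sum_chan_move //=; case: (w) => [q|i] //=.
  by apply: eq_bigr => k _; rewrite ffunE flow_in0.
have EN : [seq [ffun q => flow_out (W := desc_nupn) t (inr v) q] : ntuple desc_net
            | v <- fresh_vars (W := desc_net) t]
          = nseq (new d != [::]) [ffun w => cnt (new d) w].
  rewrite fresh_varsE -/d; case: (_ != _) => //=; congr [:: _].
  by apply/ffunP => w; rewrite !ffunE flow_new.
have EM (g : nat -> ntuple desc_net) :
    [seq g x | x <- std_vars (W := desc_net) t] = rcons (nseq (has1 d) (g 1)) (g 0).
  by rewrite std_varsE -/d; case: (has1 d).
have EM' m : [seq m' m x | x <- std_vars (W := desc_net) t] =
    rcons (nseq (has1 d) (next1 d (m 1) (m 0))) (next0 d (m 1) (m 0)).
  by rewrite EM E0; case: (boolP (has1 d)) => //= H; rewrite E1.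
split.
  case=> m [R [Hin EqM EqM']]; exists (m 1), (m 0), R; split.
  - by move=> w; rewrite -flow_in0; apply: Hin; rewrite std_varsE; case: ifP.
  - move=> H w; rewrite -flow_in1; apply: Hin; rewrite std_varsE; by rewrite -/d H.
  - by rewrite EqM EM.
  - by rewrite EqM' EN -EM'.
case=> m1 [m0 [R [H0 H1 EqM EqM']]].
pose m x := if x == 0 then m0 else m1.
exists m, R; split.
- move=> x w /std_vars_leq1[->|[-> H]]; first by rewrite flow_in0.
  by rewrite flow_in1; apply: H1.
- by rewrite EqM EM.
- by rewrite EqM' -EN -(EM' m).
Qed.

End DescNet.

(** * The net of a cEOS *)

Notation copyT E := {p : place (sys E) & place (obj (@typ E p))}.
Notation bufT E := {N : net E & place (obj N)}.
Notation qplace E := (place (sys E) + copyT E + (bufT E + unit))%type.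

Definition copy_of (E : eos) (p : place (sys E)) (q : place (obj (typ p))) : copyT E :=
  existT _ p q.
Definition buf_of (E : eos) (N : net E) (q : place (obj N)) : bufT E := existT _ N q.
Definition to_buf (E : eos) (c : copyT E) : bufT E := buf_of (tagged c).

Definition qid (E : eos) (p : place (sys E)) : qplace E := inl (inl p).
Definition qcopy (E : eos) (c : copyT E) : qplace E := inl (inr c).
Definition qbuf (E : eos) (b : bufT E) : qplace E := inr (inl b).
(** Marks the tuple under construction. It is exchanged for the identifier place only when the token
    is complete, so [Fill] cannot touch other tokens and [Take] cannot consume an unfinished one. *)
Definition qcur (E : eos) : qplace E := inr (inr tt).
Arguments qcur {E}.

Inductive op (E : eos) :=
| Start | Stop
| Take of place (sys E) | Sub of bufT E | Add of bufT E
| Create of place (sys E) | Fill of copyT E | Close of place (sys E) & bool.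
Arguments Start {E}.
Arguments Stop {E}.

Section Construction.
Variable E : eos.
Local Notation SP := (place (sys E)).
Local Notation tok := (token E).

Definition moves (p : SP) : seq (qplace E * qplace E) :=
  [seq (qcopy (copy_of q), qbuf (buf_of q)) | q <- enum (place (obj (typ p)))].

Definition swap (A B : Type) (m : A * B) := (m.2, m.1).

(** [Take] consumes the identifier and transfers all copies, so its second tuple becomes zero.
    [Fill] has a looping transition that moves one unit and an exit that is always available;
    nothing is tested for zero. *)
Definition descs_of (l : nat * op E) : seq (desc (qplace E)) :=
  let: (s, o) := l in
  match o with
  | Start => [:: Desc 0 s [::] [::] [::] [::] [::] [::] [::]]
  | Stop => [:: Desc s.+1 0 [::] [::] [::] [::] [::] [::] [::]]
  | Take p => [:: Desc s.+1 s [::] [:: qid p] [::] [::] [::] (moves p) [::]]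
  | Sub b => [:: Desc s.+1 s [:: qbuf b] [::] [::] [::] [::] [::] [::]]
  | Add b => [:: Desc s.+1 s [::] [::] [:: qbuf b] [::] [::] [::] [::]]
  | Create _ => [:: Desc s.+1 s [::] [::] [::] [::] [:: qcur] [::] [::]]
  | Fill c => [:: Desc s.+1 s.+1 [:: qbuf (to_buf c)] [:: qcur] [::] [:: qcur; qcopy c]
                    [::] [::] [::];
                  Desc s.+1 s [::] [::] [::] [::] [::] [::] [::]]
  | Close p last => [:: Desc s.+1 s [::] [:: qcur] [::] [:: qid p] [::] [::]
                          (if last then [seq swap m | m <- moves p] else [::])]
  end.

(* The control state in front of an instruction is the number of instructions
   from there to the end, so that 0 is free for the initial state. *)
Fixpoint lines (l : seq (op E)) : seq (nat * op E) :=
  if l is o :: l' then (size l', o) :: lines l' else [::].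

Definition listing (A : finType) (f : A -> nat) : seq A :=
  flatten [seq nseq (f a) a | a <- enum A].

Definition preb (ev : event E) (b : bufT E) : nat := pre_ms (ev.2 (tag b)) (tagged b).
Definition postb (ev : event E) (b : bufT E) : nat := post_ms (ev.2 (tag b)) (tagged b).

Definition fills (p : SP) : seq (op E) :=
  [seq Fill (copy_of q) | q <- enum (place (obj (typ p)))].

(** The flag of [Close] is set for the last token of each type, which has to absorb the rest of the
    buffers of that type. *)
Fixpoint posts (l : seq SP) : seq (op E) :=
  if l is p :: l' then
    Create p :: fills p ++ Close p (typ p \notin [seq typ p' | p' <- l']) :: posts l'
  else [::].

(* If no token of type N is produced, then none is consumed, hence the buffers
   of N are empty and [Sub] blocks the events that would leave something
   in them. *)
Definition add_or_block (l : seq SP) (b : bufT E) : op E :=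
  if tag b \in [seq typ p | p <- l] then Add b else Sub b.

Definition evops (ev : event E) : seq (op E) :=
  [seq Take p | p <- listing (pre ev.1)] ++
  [seq Sub b | b <- listing (preb ev)] ++
  [seq add_or_block (listing (post ev.1)) b | b <- listing (postb ev)] ++
  posts (listing (post ev.1)).

Definition prog : seq (op E) :=
  flatten [seq Start :: rcons (evops ev) Stop | ev <- events E].

Definition descs : seq (desc (qplace E)) := flatten [seq descs_of l | l <- lines prog].

(** Membership is [List.In], as instructions and descriptions are not given a decidable equality. *)
Lemma In_flatten (A B : Type) (f : A -> seq B) s b :
  List.In b (flatten [seq f a | a <- s]) <-> exists2 a, List.In a s & List.In b (f a).
Proof.
elim: s => [|a s IH] /=; first by split=> // -[].
rewrite List.in_app_iff IH; split.
  by case=> [H|[a' H1 H2]]; [exists a | exists a'] => //; [left | right].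
by case=> a' [<-|H1] H2; [left | right; exists a'].
Qed.

Lemma In_lines s o l :
  List.In (s, o) (lines l) <-> exists l1 l2, l = l1 ++ o :: l2 /\ size l2 = s.
Proof.
elim: l => [|o' l IH] /=; first by split=> // -[[|? ?] [? []]].
rewrite IH; split.
  case=> [[<- <-]|[l1 [l2 [-> <-]]]]; first by exists [::], l.
  by exists (o' :: l1), l2.
case=> -[|o1 l1] [l2 [/= [-> ->] <-]]; first by left.
by right; exists l1, l2.
Qed.

(** The targets are distinct because [p] is fixed; copies for different places of the same type
    share their buffers. [Take] needs distinct sources, and [Close], which reverses the transfers,
    distinct targets. *)
Lemma uniq_moves p : uniq (unzip1 (moves p)) /\ uniq (unzip2 (moves p)).
Proof.
rewrite /moves /unzip1 /unzip2 -(map_comp fst) -(map_comp snd); split.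
  rewrite (map_inj_uniq (_ : injective _)) ?enum_uniq // => q q' [] H.
  exact: eq_from_Tagged H.
rewrite (map_inj_uniq (_ : injective _)) ?enum_uniq // => q q' [] H.
exact: eq_from_Tagged H.
Qed.

Lemma wf_descs_of n s o : s < n -> all (wf_desc n) (descs_of (s, o)).
Proof.
move=> sn; have sn' := ltnW sn.
case: o => //= *; rewrite /wf_desc /= ?sn ?sn' ?ltn0Sn //=.
  by rewrite andbT (uniq_moves _).1.
rewrite andbT; case: ifP => //= _.
by rewrite /unzip1 -(map_comp fst) (eq_map (_ : _ =1 snd)) // (uniq_moves _).2.
Qed.

Lemma wf_descs : all (wf_desc (size prog)) descs.
Proof.
rewrite /descs; elim: prog => //= o l IH; rewrite all_cat wf_descs_of //=.
apply: sub_all IH => d /and5P[H1 H2 H3 H4 H5].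
by apply/and5P; split=> //; apply: leqW.
Qed.

Definition simnet : cnupn := desc_net wf_descs.

Definition layout (a : sim_place E) : nplace simnet :=
  match a with
  | None => inr ord0
  | Some (inl p) => inl (qid p)
  | Some (inr c) => inl (qcopy c)
  end.

Lemma layout_inj : injective layout.
Proof. by move=> [[p|c]|] [[p'|c']|] // [->]. Qed.

Lemma In_dnth t : List.In (dnth (ds := descs) t) descs.
Proof.
have H (A : Type) (a0 : A) s i : i < size s -> List.In (nth a0 s i) s.
  by elim: s i => // a s IH [|i] /= Hi; [left | right; apply: IH].
by rewrite /dnth (tnth_nth (dnth t)); apply: H.
Qed.

Lemma dnth_In d : List.In d descs -> exists t, dnth (ds := descs) t = d.
Proof.
have H (A : Type) (a0 a : A) s : List.In a s -> exists2 i, i < size s & nth a0 s i = a.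
  elim: s => // a' s IH /= [->|/IH[i Hi E']]; first by exists 0.
  by exists i.+1.
by move=> /(H _ d)[i Hi Ed]; exists (Ordinal Hi); rewrite /dnth (tnth_nth d).
Qed.

(** * Abstract states and their encoding as configurations of the net *)

Local Notation buffer := {ffun bufT E -> nat}.
Definition st : Type := buffer * option tok * eos_conf E.

(** The sum with an equality test avoids a cast between object nets that are only provably equal;
    [cpy] below does the same for places. *)
Definition tokb (k : tok) : buffer :=
  [ffun b => \sum_q tagged k q * (buf_of q == b)].
Definition addb (b b' : buffer) : buffer := [ffun i => b i + b' i].
Definition bump (k : tok) (c : copyT E) : tok :=
  Tagged (fun p => marking (obj (typ p))) [ffun q => tagged k q + (copy_of q == c)].
Definition absorb (k : tok) (b : buffer) : tok :=
  Tagged (fun p => marking (obj (typ p))) [ffun q => tagged k q + b (buf_of q)].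
Definition drain (p : SP) (b : buffer) : buffer :=
  [ffun i => if tag i == typ p then 0 else b i].
Definition tok0 (p : SP) : tok :=
  Tagged (fun p => marking (obj (typ p))) ([ffun=> 0] : marking (obj (typ p))).

(* The effect of one transition of an instruction; the Boolean tells whether
   control passes to the next instruction. *)
Inductive ostep : op E -> st -> st -> bool -> Prop :=
| oTake p b cur M k : tag k = p ->
    ostep (Take p) (b, cur, k +` M) (addb b (tokb k), cur, M) true
| oSub i (b : buffer) cur M : 0 < b i ->
    ostep (Sub i) (b, cur, M) ([ffun j => b j - (j == i)], cur, M) true
| oAdd i (b : buffer) cur M :
    ostep (Add i) (b, cur, M) ([ffun j => b j + (j == i)], cur, M) true
| oCreate p b M :
    ostep (Create p) (b, None, M) (b, Some (tok0 p), M) true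
| oFill c (b : buffer) k M : 0 < b (to_buf c) -> tag k = tag c ->
    ostep (Fill c) (b, Some k, M)
      ([ffun j => b j - (j == to_buf c)], Some (bump k c), M) false
| oSkip c x : ostep (Fill c) x x true
| oClose p l b k M : tag k = p ->
    ostep (Close p l) (b, Some k, M)
      (if l then drain p b else b, None, (if l then absorb k b else k) +` M) true.

Local Notation tup := (ntuple simnet).

Definition ctrl (s : nat) (b : buffer) : tup := [ffun w : nplace simnet =>
  match w with inr i => (i == s :> nat) : nat | inl (inr (inl j)) => b j | _ => 0 end].
Definition cpy (k : tok) (c : copyT E) : nat := \sum_q tagged k q * (c == copy_of q).
Definition cur_tup (k : tok) : tup := [ffun w : nplace simnet =>
  match w with inl (inl (inr c)) => cpy k c | inl (inr (inr _)) => 1 | _ => 0 end].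
Definition tok_tup (k : tok) : tup := [ffun w : nplace simnet =>
  match w with
  | inl (inl (inr c)) => cpy k c | inl (inl (inl p)) => (p == tag k) : nat | _ => 0 end].

Lemma enc_tokenE k : enc_token layout k = tok_tup k.
Proof.
apply/ffunP => w; rewrite !ffunE; case: w => [[[p|c]|[j|u]]|i] /=.
- by rewrite big1 // => q _; rewrite muln0.
- by rewrite addn0; apply: eq_bigr => q _.
- by rewrite big1 // => q _; rewrite muln0.
- by rewrite big1 // => q _; rewrite muln0.
- by rewrite big1 // => q _; rewrite muln0.
Qed.

Lemma cpy_copy k q : cpy k (copy_of (p := tag k) q) = tagged k q.
Proof.
rewrite /cpy (bigD1 q) //= eqxx muln1 big1 ?addn0 // => q' Hq'.
have -> : (copy_of q == copy_of q') = false; last by rewrite muln0.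
by apply: contraNF Hq' => /eqP H; apply/eqP; rewrite (eq_from_Tagged H).
Qed.

Lemma cpy_neq k c : tag c != tag k -> cpy k c = 0.
Proof.
move=> H; rewrite /cpy big1 // => q _.
have -> : (c == copy_of q) = false; last by rewrite muln0.
by apply: contraNF H => /eqP ->.
Qed.

Lemma tokb_buf k q : tokb k (buf_of (N := typ (tag k)) q) = tagged k q.
Proof.
rewrite ffunE (bigD1 q) //= eqxx muln1 big1 ?addn0 // => q' Hq'.
have -> : (buf_of q' == buf_of q) = false; last by rewrite muln0.
by apply: contraNF Hq' => /eqP H; apply/eqP; rewrite (eq_from_Tagged H).
Qed.

Lemma tokb_neq k j : tag j != typ (tag k) -> tokb k j = 0.
Proof.
move=> H; rewrite ffunE big1 // => q _.
have -> : (buf_of q == j) = false; last by rewrite muln0.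
by apply: contraNF H => /eqP <-.
Qed.

Definition cmset (cur : option tok) : nu_conf simnet :=
  if cur is Some k then [mset (cur_tup k)] else mset0.
Definition tset (M : eos_conf E) : nu_conf simnet := seq_mset [seq tok_tup k | k <- M].

Definition encA (s : nat) (x : st) : nu_conf simnet :=
  ctrl s x.1.1 +` (cmset x.1.2 `+` tset x.2).

Lemma seq_mset_cat (K : choiceType) (s1 s2 : seq K) :
  seq_mset (s1 ++ s2) = seq_mset s1 `+` seq_mset s2.
Proof. by apply/msetP => a; rewrite msetE2 !mset_seqE count_cat. Qed.

Lemma perm_msetD (K : choiceType) (A B : {mset K}) : perm_eq (A `+` B) (A ++ B).
Proof. by apply/allP => k _ /=; rewrite count_cat !count_mem_mset msetE2. Qed.

Lemma perm_mset1 (K : choiceType) (a : K) : perm_eq [mset a] [:: a].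
Proof. by apply/allP => k _ /=; rewrite count_mem_mset msetnE addn0 [a == k]eq_sym; case:
    (k == a). Qed.

Lemma tsetD M M' : tset (M `+` M') = tset M `+` tset M'.
Proof.
rewrite /tset -seq_mset_cat -map_cat; apply/eq_seq_msetP; exact: perm_map (perm_msetD _ _).
Qed.

Lemma tset1 k M : tset (k +` M) = tok_tup k +` tset M.
Proof.
rewrite tsetD; congr (_ `+` _); rewrite -[RHS]msetD0 -[mset0](_ : seq_mset [::] = _).
  by rewrite -mset_cons; apply/eq_seq_msetP; exact: perm_map (perm_mset1 _).
by apply/msetP => a; rewrite mset_seqE mset0E.
Qed.

Lemma enc_confE M : enc_conf layout M = encA 0 ([ffun=> 0], None, M).
Proof.
rewrite /enc_conf /encA /= mset0D msetDC; congr (_ `+` _).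
  congr msetn; apply/ffunP => w; rewrite !ffunE.
  by case: w => [[[p|c]|[j|u]]|i] //=; rewrite ffunE.
by rewrite /tset; congr seq_mset; apply: eq_map => k; rewrite enc_tokenE.
Qed.

End Construction.

(** * Effect of single transitions on the control tuple and the second tuple *)

Section Steps.
Variable E : eos.
Local Notation SP := (place (sys E)).
Local Notation tok := (token E).
Local Notation buffer := {ffun bufT E -> nat}.
Local Notation W := (simnet E).
Local Notation n := (size (prog E)).
Local Notation pl := (qplace E + 'I_n.+1)%type.
Implicit Types (w : pl) (b : buffer) (k : tok) (M : eos_conf E) (p : SP).

Lemma cnt_buf i w :
  cnt [:: qbuf i] w = if w is inl (inr (inl j)) then (j == i) : nat else 0.
Proof. by case: w => [[[p|c]|[j|u]]|s] //=; rewrite addn0 eq_sym. Qed.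

Lemma cnt_id p w :
  cnt [:: qid p] w = if w is inl (inl (inl p')) then (p' == p) : nat else 0.
Proof. by case: w => [[[p'|c]|[j|u]]|s] //=; rewrite addn0 eq_sym. Qed.

Lemma cnt_cur w :
  cnt [:: qcur] w = if w is inl (inr (inr _)) then 1 else 0.
Proof. by case: w => [[[p|c]|[j|[]]]|s]. Qed.

Lemma cnt_cur_copy c w :
  cnt [:: qcur; qcopy c] w = match w with
    | inl (inr (inr _)) => 1 | inl (inl (inr c')) => (c' == c) : nat | _ => 0 end.
Proof. by case: w => [[[p|c']|[j|[]]]|s] //=; rewrite addn0 eq_sym. Qed.

Lemma transfer_moves p (f : pl -> nat) w :
  transfer (moves p) f w = if w is inl (inr (inl j)) then
    \sum_(q : place (obj (typ p))) f (inl (qcopy (copy_of q))) * (buf_of q == j) else 0.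
Proof.
case: w => [[[p'|c]|[j|u]]|s] //=; rewrite /moves big_map /=.
- by rewrite big1 // => q _; rewrite muln0.
- by rewrite big1 // => q _; rewrite muln0.
- by rewrite big_enum.
- by rewrite big1 // => q _; rewrite muln0.
Qed.

Lemma transfer_swap p (f : pl -> nat) w :
  transfer [seq swap m | m <- moves p] f w = if w is inl (inl (inr c)) then
    \sum_(q : place (obj (typ p))) f (inl (qbuf (buf_of q))) * (copy_of q == c) else 0.
Proof.
case: w => [[[p'|c]|[j|u]]|s] //=; rewrite /moves 2!big_map /=.
- by rewrite big1 // => q _; rewrite muln0.
- by rewrite big_enum.
- by rewrite big1 // => q _; rewrite muln0.
- by rewrite big1 // => q _; rewrite muln0.
Qed.

Lemma kept_moves p (f : pl -> nat) w :
  kept (moves p) f w = if w is inl (inl (inr c)) then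
    if tag c == p then 0 else f w else f w.
Proof.
case: w => [q|s] //=; rewrite /moves /unzip1 -(map_comp fst).
case: q => [[p'|c]|[j|u]]; try by rewrite (_ : _ \in _ = false) //; apply/mapP => -[].
rewrite (_ : _ \in _ = (tag c == p)) //; apply/mapP/eqP => [[q _ [->]] //|].
by case: c => p' q /= Ep; subst p'; exists q; rewrite ?mem_enum.
Qed.

Lemma kept_swap p (f : pl -> nat) w :
  kept [seq swap m | m <- moves p] f w = if w is inl (inr (inl j)) then
    if tag j == typ p then 0 else f w else f w.
Proof.
case: w => [q|s] //=; rewrite /moves /unzip1 -(map_comp fst) -(map_comp _ (fun _ => _)).
case: q => [[p'|c]|[j|u]]; try by rewrite (_ : _ \in _ = false) //; apply/mapP => -[].
rewrite (_ : _ \in _ = (tag j == typ p)) //; apply/mapP/eqP => [[q _ [->]] //|].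
by case: j => N q /= Ep; subst N; exists q; rewrite ?mem_enum.
Qed.

Lemma kept_nil (f : pl -> nat) w : kept [::] f w = f w.
Proof. by case: w. Qed.

Lemma transfer_nil (f : pl -> nat) w : transfer [::] f w = 0.
Proof. by case: w => //= q; rewrite big_nil. Qed.

Lemma cnt_nil w : cnt [::] w = 0.
Proof. by case: w. Qed.

Definition arcsE := (kept_nil, transfer_nil, cnt_nil, cnt_buf, cnt_id, cnt_cur, cnt_cur_copy).

Local Notation nx0 := (next0 (wf_ds := @wf_descs E)).
Local Notation nx1 := (next1 (wf_ds := @wf_descs E)).

(** Stated for arbitrary effects on other tuples, so that it serves [Start], [Stop], [Create] and
    the exit of [Fill] alike. *)
Lemma next0_jump s s' i1 o1 nw (m1 : ntuple W) b :
  nx0 (Desc s s' [::] i1 [::] o1 nw [::] [::]) m1 (ctrl s b) = ctrl s' b.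
Proof.
apply/ffunP => w; rewrite !ffunE /rem0 /= !arcsE /=.
by case: w => [[[p|c]|[j|u]]|i] //=; rewrite ?ffunE ?arcsE /= ?addn0 ?subn0 ?subnn.
Qed.

Lemma next0_sub s s' i i1 o1 nw (m1 : ntuple W) b :
  nx0 (Desc s s' [:: qbuf i] i1 [::] o1 nw [::] [::]) m1 (ctrl s b) =
  ctrl s' [ffun j => b j - (j == i)].
Proof.
apply/ffunP => w; rewrite !ffunE /rem0 /= !arcsE /=.
by case: w => [[[p|c]|[j|u]]|i'] //=; rewrite ?ffunE ?arcsE /= ?addn0 ?subn0 ?subnn.
Qed.

Lemma next0_add s s' i i1 o1 nw (m1 : ntuple W) b :
  nx0 (Desc s s' [::] i1 [:: qbuf i] o1 nw [::] [::]) m1 (ctrl s b) =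
  ctrl s' [ffun j => b j + (j == i)].
Proof.
apply/ffunP => w; rewrite !ffunE /rem0 /= !arcsE /=.
by case: w => [[[p|c]|[j|u]]|i'] //=; rewrite ?ffunE ?arcsE /= ?addn0 ?subn0 ?subnn.
Qed.

Lemma next0_take s s' k b :
  nx0 (Desc s s' [::] [:: qid (tag k)] [::] [::] [::] (moves (tag k)) [::]) (tok_tup k)
      (ctrl s b)
  = ctrl s' (addb b (tokb k)).
Proof.
apply/ffunP => w; rewrite !ffunE /rem0 /= !arcsE transfer_moves /=.
case: w => [[[p|c]|[j|u]]|i'] //=; rewrite ?ffunE ?arcsE /= ?addn0 ?subn0 ?subnn //.
by congr (_ + _); apply: eq_bigr => q _; rewrite /rem1 ffunE !arcsE subn0 /= cpy_copy.
Qed.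

(** The source of the zero tuples that [conf_eq] ignores. *)
Lemma next1_take s s' k b :
  nx1 (Desc s s' [::] [:: qid (tag k)] [::] [::] [::] (moves (tag k)) [::]) (tok_tup k)
      (ctrl s b)
  = [ffun=> 0].
Proof.
apply/ffunP => w; rewrite !ffunE [mv10 _]/= [mv01 _]/= kept_moves /rem1 /rem0 !arcsE.
case: w => [[[p|c]|[j|u]]|i']; rewrite ?ffunE /= ?addn0 ?subn0 ?subnn //.
by case: ifP => // H; rewrite cpy_neq ?H.
Qed.

Lemma copyP (k : tok) (c : copyT E) : tag c = tag k -> exists q, c = copy_of (p := tag k) q.
Proof. by case: c => p q /= Ep; subst p; exists q. Qed.

Lemma cpy_bump k c c' : tag k = tag c -> cpy (bump k c) c' = cpy k c' + (c' == c).
Proof.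
move=> Ec; have [Hc|Hc] := eqVneq (tag c') (tag k).
  have [q ->] := copyP Hc; rewrite (@cpy_copy E (bump k c) q) cpy_copy /= ffunE.
  by [].
rewrite !cpy_neq //; have [Eq|//] := eqVneq c' c.
by rewrite Eq Ec eqxx in Hc.
Qed.

Lemma cpy_absorb k b c :
  cpy (absorb k b) c =
  cpy k c + \sum_(q : place (obj (typ (tag k)))) b (buf_of q) * (copy_of q == c).
Proof.
have [Hc|Hc] := eqVneq (tag c) (tag k).
  have [q ->] := copyP Hc; rewrite (@cpy_copy E (absorb k b) q) cpy_copy /= ffunE; congr
      (_ + _).
  rewrite (bigD1 q) //= eqxx muln1 big1 ?addn0 // => q' Hq'.
  have -> : (copy_of q' == copy_of q) = false; last by rewrite muln0.
  by apply: contraNF Hq' => /eqP H; apply/eqP; rewrite (eq_from_Tagged H).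
rewrite !cpy_neq // big1 // => q _; case: eqP => [Eq|_]; last by rewrite muln0.
by rewrite -Eq eqxx in Hc.
Qed.

Lemma next1_fill s s' c k (m0 : ntuple W) : tag k = tag c ->
  nx1 (Desc s s' [:: qbuf (to_buf c)] [:: qcur] [::] [:: qcur; qcopy c] [::] [::] [::])
    (cur_tup k) m0 = cur_tup (bump k c).
Proof.
move=> Ec; apply/ffunP => w; rewrite !ffunE /rem0 /rem1 /= !arcsE /=.
case: w => [[[p|c']|[j|u]]|i'] //=; rewrite ?ffunE ?arcsE /= ?addn0 ?subn0 ?subnn //.
by rewrite cpy_bump.
Qed.

Definition close_desc s s' p (l : bool) : desc (qplace E) :=
  Desc s s' [::] [:: qcur] [::] [:: qid p] [::] [::]
       (if l then [seq swap m | m <- moves p] else [::]).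

Lemma next1_close s s' k l b :
  nx1 (close_desc s s' (tag k) l) (cur_tup k) (ctrl s b) =
  tok_tup (if l then absorb k b else k).
Proof.
apply/ffunP => w; rewrite !ffunE /rem1 /= !arcsE /=; case: l.
  rewrite transfer_swap.
  case: w => [[[p|c']|[j|u]]|i'] //=; rewrite ?ffunE ?arcsE /= ?addn0 ?subn0 ?subnn //.
  rewrite cpy_absorb; congr (_ + _); apply: eq_bigr => q _.
  by rewrite /rem0 ffunE !arcsE subn0.
by rewrite !arcsE; case: w => [[[p|c']|[j|u]]|i'] //=;
    rewrite ?ffunE ?arcsE /= ?addn0 ?subn0 ?subnn.
Qed.

Lemma next0_close s s' p k l b :
  nx0 (close_desc s s' p l) (cur_tup k) (ctrl s b) =
  ctrl s' (if l then drain p b else b).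
Proof.
apply/ffunP => w; rewrite !ffunE /rem0 /rem1 /= !arcsE /=; case: l.
  rewrite kept_swap.
  by case: w => [[[p'|c']|[j|u]]|i'] //=; rewrite ?ffunE ?arcsE /= ?addn0 ?subn0 ?subnn.
by case: w => [[[p'|c']|[j|u]]|i'] //=; rewrite ?ffunE ?arcsE /= ?addn0 ?subn0 ?subnn.
Qed.

Local Notation ln := (lines (prog E)).

Lemma sim_firesE t d (M M' : nu_conf W) : dnth (ds := descs E) t = d ->
  nu_fires (W := W) t M M' <->
  exists (m1 m0 : ntuple W) (R : nu_conf W),
  [/\ forall w, pcm (src d) w + cnt (in0 d) w <= m0 w,
      has1 d -> forall w, cnt (in1 d) w <= m1 w,
      M = R `+` seq_mset (rcons (nseq (has1 d) m1) m0)
    & M' = R `+` seq_mset (nseq (new d != [::]) [ffun w => cnt (new d) w])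
             `+` seq_mset (rcons (nseq (has1 d) (nx1 d m1 m0)) (nx0 d m1 m0))].
Proof. exact: nu_firesE. Qed.

Lemma step_intro d (m1 m0 : ntuple W) (R : nu_conf W) :
  List.In d (descs E) ->
  (forall w, pcm (src d) w + cnt (in0 d) w <= m0 w) ->
  (has1 d -> forall w, cnt (in1 d) w <= m1 w) ->
  nu_step (W := W) (R `+` seq_mset (rcons (nseq (has1 d) m1) m0))
    (R `+` seq_mset (nseq (new d != [::]) [ffun w => cnt (new d) w])
       `+` seq_mset (rcons (nseq (has1 d) (nx1 d m1 m0)) (nx0 d m1 m0))).
Proof.
move=> /dnth_In[t Et] H0 H1; exists t.
by apply/(sim_firesE _ _ Et); exists m1, m0, R.
Qed.

Lemma step_elim (M M' : nu_conf W) : nu_step M M' ->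
  exists s o d, [/\ List.In (s, o) ln, List.In d (descs_of (s, o))
  & exists (m1 m0 : ntuple W) (R : nu_conf W),
  [/\ forall w, pcm (src d) w + cnt (in0 d) w <= m0 w,
      has1 d -> forall w, cnt (in1 d) w <= m1 w,
      M = R `+` seq_mset (rcons (nseq (has1 d) m1) m0)
    & M' = R `+` seq_mset (nseq (new d != [::]) [ffun w => cnt (new d) w])
             `+` seq_mset (rcons (nseq (has1 d) (nx1 d m1 m0)) (nx0 d m1 m0))]].
Proof.
case=> t /(sim_firesE _ _ (erefl (dnth t))) H.
have /In_flatten[[s o] Hl Hd] := In_dnth t.
by exists s, o, (dnth t).
Qed.

Local Notation ceq := (conf_eq (W := W)).

Lemma ceq_refl C : ceq C C. Proof. by []. Qed.
Lemma ceq_sym C D : ceq C D -> ceq D C. Proof. by move=> H m /H. Qed.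
Lemma ceq_trans C D F : ceq C D -> ceq D F -> ceq C F.
Proof. by move=> H1 H2 m Hm; rewrite H1 // H2. Qed.

(* The tuples matched by a transition are not zero, since they carry a token
   that it consumes. *)
Lemma ceq_step (C C' D : nu_conf W) : ceq C D -> nu_step C C' ->
  exists2 D', nu_step D D' & ceq C' D'.
Proof.
move=> CD [t /(sim_firesE _ _ (erefl (dnth t)))[m1 [m0 [R [H0 H1 EC EC']]]]].
set d := dnth t in H0 H1 EC EC'.
set S := rcons _ m0 in EC; set F := seq_mset _ in EC'; set G := seq_mset _ in EC'.
have /and5P[Hs _ _ _ _] := wf_dnth (@wf_descs E) t.
have N0 : m0 != [ffun=> 0].
  apply/eqP => Em; have := H0 (inr (inord (src d))).
  by rewrite Em ffunE /= inordK // eqxx.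
have N1 : has1 d -> m1 != [ffun=> 0].
  move=> Hh; apply/eqP => Em; have := H1 Hh; move: Hh; rewrite /has1.
  by case: (in1 d) => // q l _ /(_ (inl q)); rewrite Em ffunE /= eqxx.
have HS m : m \in S -> m != [ffun=> 0].
  by rewrite mem_rcons inE mem_nseq => /orP[/eqP->|/andP[+ /eqP->]] //; rewrite lt0b.
have sub : seq_mset S `<=` D.
  apply/msubsetP => m; rewrite mset_seqE; have [Hm|Hm] := boolP (m \in S).
    by rewrite -CD ?HS // EC msetE2 mset_seqE leq_addl.
  by rewrite (count_memPn Hm).
exists ((D `\` seq_mset S) `+` F `+` G).
  exists t; apply/(sim_firesE _ _ (erefl (dnth t))); exists m1, m0, (D `\` seq_mset S);
      split=> //.
  by rewrite msetBDK.
move=> m Hm; rewrite EC' !msetE2 -CD // EC msetE2.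
by rewrite addnK.
Qed.

End Steps.

Lemma msetDE (K : choiceType) (A B : {mset K}) a : (A `+` B) a = A a + B a.
Proof. by rewrite msetE2. Qed.

Lemma seq_mset0 (K : choiceType) : seq_mset [::] = mset0 :> {mset K}.
Proof. by apply/msetP => a; rewrite mset_seqE mset0E. Qed.

Lemma seq_mset1 (K : choiceType) (a : K) : seq_mset [:: a] = [mset a].
Proof. by rewrite mset_cons seq_mset0 msetD0. Qed.

Lemma seq_mset2 (K : choiceType) (a b : K) : seq_mset [:: a; b] = a +` [mset b].
Proof. by rewrite mset_cons seq_mset1. Qed.

Lemma msetDI (K : choiceType) (C A B : {mset K}) : A `+` C = B `+` C -> A = B.
Proof.
by move=> H; apply/msetP => a; have := congr1 (fun M : {mset K} => M a) H; rewrite !msetDE; lia.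
Qed.

Definition seq_msetE := (seq_mset0, seq_mset1, seq_mset2).

Ltac mset_count := apply/msetP => ?; rewrite !msetDE ?mset0E; lia.

(** * Correspondence between transitions of the net and abstract steps *)

Section Firing.
Variable E : eos.
Local Notation SP := (place (sys E)).
Local Notation tok := (token E).
Local Notation buffer := {ffun bufT E -> nat}.
Local Notation W := (simnet E).
Local Notation pl := (qplace E + 'I_(size (prog E)).+1)%type.
Local Notation ln := (lines (prog E)).
Local Notation ceq := (conf_eq (W := W)).
Implicit Types (w : pl) (b : buffer) (k : tok) (M : eos_conf E) (p : SP) (x y : st E).

Local Notation nx0 := (next0 (wf_ds := @wf_descs E)).
Local Notation nx1 := (next1 (wf_ds := @wf_descs E)).

Lemma In_descs s o d : List.In (s, o) ln -> List.In d (descs_of (s, o)) ->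
  List.In d (descs E).
Proof. by move=> H1 H2; apply/In_flatten; exists (s, o). Qed.

Lemma pcm_ctrl s b w : pcm s w + cnt [::] w <= ctrl s b w.
Proof. by case: w => [[[p|c]|[j|u]]|i] //=; rewrite ffunE addn0. Qed.

Lemma pcm_ctrl_buf s b i w : 0 < b i -> pcm s w + cnt [:: qbuf i] w <= ctrl s b w.
Proof.
move=> Hb; rewrite cnt_buf; case: w => [[[p|c]|[j|u]]|s'] //=; rewrite ffunE ?addn0 //.
by rewrite add0n; case: eqP => // ->.
Qed.

Lemma cnt_cur_tup k w : cnt [:: qcur] w <= cur_tup k w.
Proof. by rewrite cnt_cur; case: w => [[[p|c]|[j|u]]|s'] //=; rewrite ffunE. Qed.

Lemma cnt_id_tup k w : cnt [:: qid (tag k)] w <= tok_tup k w.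
Proof. by rewrite cnt_id; case: w => [[[p|c]|[j|u]]|s'] //=; rewrite ffunE. Qed.

Lemma new_cur p : [ffun w => cnt [:: qcur] w] = cur_tup (tok0 p) :> ntuple W.
Proof.
apply/ffunP => w; rewrite !ffunE cnt_cur; case: w => [[[p'|c]|[j|u]]|s'] //.
by rewrite /cpy big1 // => q _; rewrite ffunE.
Qed.

Definition opt (h : bool) (m : ntuple W) : nu_conf W := if h then [mset m] else mset0.

Lemma opt_nseq (h : bool) (m : ntuple W) : seq_mset (nseq h m) = opt h m.
Proof. by case: h; rewrite !seq_msetE. Qed.

Lemma opt_rcons (h : bool) (m1 m0 : ntuple W) : seq_mset (rcons
    (nseq h m1) m0) = opt h m1 `+` opt true m0.
Proof. by rewrite -cats1 seq_mset_cat opt_nseq seq_mset1. Qed.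

Lemma encAE s b cur M : encA s (b, cur, M) = ctrl s b +` (cmset cur `+` tset M).
Proof. by []. Qed.

Lemma cmset_Some k : cmset (Some k) = [mset (cur_tup k)]. Proof. by []. Qed.
Lemma cmset_None : cmset None = mset0 :> nu_conf W. Proof. by []. Qed.

Lemma step_opt d h nw (m1 m0 : ntuple W) (R D : nu_conf W) :
  List.In d (descs E) -> has1 d = h -> (new d != [::]) = nw ->
  (forall w, pcm (src d) w + cnt (in0 d) w <= m0 w) ->
  (h -> forall w, cnt (in1 d) w <= m1 w) ->
  D = R `+` (opt h m1 `+` opt true m0) ->
  nu_step (W := W) D (R `+` opt nw [ffun w => cnt (new d) w]
       `+` (opt h (nx1 d m1 m0) `+` opt true (nx0 d m1 m0))).
Proof.
move=> Hd <- <- H0 H1 ->; rewrite -!opt_rcons -opt_nseq; exact: step_intro.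
Qed.

Lemma jump_step s s' x : List.In (Desc s s' [::] [::] [::] [::] [::] [::] [::]) (descs E) ->
  nu_step (encA s x) (encA s' x).
Proof.
case: x => [[b cur] M] Hd.
have := @step_opt _ false false (ctrl s b) (ctrl s b) (cmset cur `+` tset M) _ Hd erefl erefl
   (pcm_ctrl s b) (fun H => False_ind _ (notF H)) erefl.
by rewrite next0_jump !encAE /opt !mset0D msetD0 ![_ +` (_ `+` _)]msetDC.
Qed.

(** The target is reached only up to [ceq] because of [Take], whose emptied tuple stays in the
    configuration. *)
Lemma ostep_fwd s o x y adv : List.In (s, o) ln -> ostep o x y adv ->
  exists2 C, nu_step (encA s.+1 x) C & ceq C (encA (if adv then s else s.+1) y).
Proof.
move=> Hl Ho; have {}Hl := In_descs Hl; case: Ho Hl => {o x y adv}.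
- move=> p b cur M k <- Hl; eexists.
    apply: (@step_opt _ true false (tok_tup k) (ctrl s.+1 b) (cmset cur `+` tset M)
            _ (Hl _ (or_introl erefl)) erefl erefl (pcm_ctrl _ _) (fun _ => cnt_id_tup k)).
    by rewrite encAE tset1 /opt; mset_count.
  move=> m Hm; rewrite next0_take next1_take encAE /opt !msetDE mset0E.
  by rewrite [[mset [ffun=> 0]] m]msetnE (negbTE Hm); lia.
- move=> i b cur M Hb Hl; eexists.
    apply: (@step_opt _ false false (ctrl s.+1 b) (ctrl s.+1 b) (cmset cur `+` tset M)
            _ (Hl _ (or_introl erefl)) erefl erefl (fun w => pcm_ctrl_buf _ w Hb) (fun H =>
                False_ind _ (notF H))).
    by rewrite encAE /opt; mset_count.
  by move=> m Hm; rewrite next0_sub encAE /opt !msetDE mset0E; lia.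
- move=> i b cur M Hl; eexists.
    apply: (@step_opt _ false false (ctrl s.+1 b) (ctrl s.+1 b) (cmset cur `+` tset M)
            _ (Hl _ (or_introl erefl)) erefl erefl (pcm_ctrl _ _) (fun H => False_ind _
                (notF H))).
    by rewrite encAE /opt; mset_count.
  by move=> m Hm; rewrite next0_add encAE /opt !msetDE mset0E; lia.
- move=> p b M Hl; eexists.
    apply: (@step_opt _ false true (ctrl s.+1 b) (ctrl s.+1 b) (tset M)
            _ (Hl _ (or_introl erefl)) erefl erefl (pcm_ctrl _ _) (fun H => False_ind _
                (notF H))).
    by rewrite encAE cmset_None /opt; mset_count.
  by move=> m Hm; rewrite next0_jump (new_cur p) encAE cmset_Some /opt !msetDE mset0E; lia.
- move=> c b k M Hb Hk Hl; eexists.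
    apply: (@step_opt _ true false (cur_tup k) (ctrl s.+1 b) (tset M)
            _ (Hl _ (or_introl erefl)) erefl erefl (fun w => pcm_ctrl_buf _ w Hb) (fun _ =>
                cnt_cur_tup k)).
    by rewrite encAE cmset_Some /opt; mset_count.
  by move=> m Hm; rewrite next0_sub next1_fill // encAE cmset_Some /opt !msetDE mset0E; lia.
- move=> c x Hl; exists (encA s x) => //.
  by apply: jump_step; apply: Hl; right; left.
- move=> p l b k M <- Hl; eexists.
    apply: (@step_opt (close_desc s.+1 s (tag k) l) true false (cur_tup k) (ctrl s.+1 b)
        (tset M)
            _ (Hl _ (or_introl erefl)) erefl erefl (pcm_ctrl _ _) (fun _ => cnt_cur_tup k)).
    by rewrite encAE cmset_Some /opt; mset_count.
  by move=> m Hm; rewrite next0_close next1_close encAE cmset_None tset1 /opt !msetDE !mset0E; lia.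
Qed.

Lemma encA_mem s x m : m \in encA s x ->
  [\/ m = ctrl s x.1.1, exists2 k, x.1.2 = Some k & m = cur_tup k
    | exists2 k, k \in x.2 & m = tok_tup k].
Proof.
rewrite in_mset1D in_msetD => /orP[/eqP->|/orP[]]; first by constructor 1.
  case: x => [[b [k|]] M] /=; last by rewrite in_mset0.
  by rewrite in_mset1 => /eqP->; constructor 2; exists k.
rewrite (perm_mem (perm_eq_seq_mset _)) => /mapP[k Hk ->].
by constructor 3; exists k.
Qed.

(** Only the control tuple has a token on a control state, so a tuple that provides one must be it.
    Cancelling it determines the remaining tuples. The next two lemmas use identifier and [qcur]
    marks in the same way. *)
Lemma inv_ctrl s x (R : nu_conf W) l (m0 : ntuple W) s' : s' <= size (prog E) ->
  encA s x = R `+` seq_mset (rcons l m0) -> (forall w, pcm s' w <= m0 w) ->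
  [/\ m0 = ctrl s x.1.1, s' = s & cmset x.1.2 `+` tset x.2 = R `+` seq_mset l].
Proof.
move=> Hs' EM Hp.
have Hm : m0 \in encA s x.
  by rewrite EM in_msetD (perm_mem (perm_eq_seq_mset _)) mem_rcons inE eqxx orbT.
have := Hp (inr (inord s')); rewrite /= inordK // eqxx => Hpc.
case: (encA_mem Hm) => [E0|[k _ E0]|[k _ E0]].
- split=> //.
    by move: Hpc; rewrite E0 ffunE inordK //; case: eqP.
  move: EM; rewrite /encA E0 -cats1 seq_mset_cat seq_mset1 msetDC => /esym.
  by rewrite msetDA => /msetDI ->.
- by move: Hpc; rewrite E0 ffunE.
- by move: Hpc; rewrite E0 ffunE.
Qed.

Lemma inv_id cur M (R : nu_conf W) (m1 : ntuple W) p :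
  cmset cur `+` tset M = R `+` [mset m1] -> 0 < m1 (inl (qid p)) ->
  exists k M', [/\ M = k +` M', tag k = p, m1 = tok_tup k & R = cmset cur `+` tset M'].
Proof.
move=> EM Hp.
have Hm : m1 \in cmset cur `+` tset M by rewrite EM in_msetD in_mset1 eqxx orbT.
have {}Hm : m1 \in encA 0 ([ffun=> 0], cur, M) by rewrite in_mset1D Hm orbT.
case: (encA_mem Hm) => [E0|[k _ E0]|[k Hk E0]].
- by move: Hp; rewrite E0 ffunE.
- by move: Hp; rewrite E0 ffunE.
exists k, (M `\ k); rewrite /= in Hk; have EM' := msetB1K Hk; split=> //.
  by move: Hp; rewrite E0 ffunE /=; case: eqP.
move: EM; rewrite -{1}EM' tset1 E0 [tok_tup k +` _]msetDC msetDA => /msetDI <-.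
by [].
Qed.

Lemma inv_cur cur M (R : nu_conf W) (m1 : ntuple W) :
  cmset cur `+` tset M = R `+` [mset m1] -> 0 < m1 (inl qcur) ->
  exists k, [/\ cur = Some k, m1 = cur_tup k & R = tset M].
Proof.
move=> EM Hp.
have Hm : m1 \in cmset cur `+` tset M by rewrite EM in_msetD in_mset1 eqxx orbT.
have {}Hm : m1 \in encA 0 ([ffun=> 0], cur, M) by rewrite in_mset1D Hm orbT.
case: (encA_mem Hm) => [E0|[k /= Ek E0]|[k Hk E0]].
- by move: Hp; rewrite E0 ffunE.
- by exists k; split=> //; move: EM; rewrite Ek E0 /= msetDC => /msetDI.
- by move: Hp; rewrite E0 ffunE.
Qed.

(** What the net does not check by itself: a transition of [Create] would start a second unfinished
    tuple, and those of [Fill] and [Close] would mix the places of different system places. *)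
Definition wfop (o : op E) (cur : option tok) : Prop :=
  match o, cur with
  | Create _, Some _ => False
  | Fill c, Some k => tag k = tag c
  | Close p _, Some k => tag k = p
  | _, _ => True
  end.

Lemma step_opt_inv s b cur M (C : nu_conf W) : nu_step (encA s (b, cur, M)) C ->
  exists s0 o d (m1 : ntuple W) (R : nu_conf W),
  [/\ List.In (s0, o) ln, List.In d (descs_of (s0, o)),
      src d = s, forall w, pcm (src d) w + cnt (in0 d) w <= ctrl s b w &
  [/\ has1 d -> forall w, cnt (in1 d) w <= m1 w,
      cmset cur `+` tset M = R `+` opt (has1 d) m1
    & C = R `+` opt (new d != [::]) [ffun w => cnt (new d) w]
             `+` (opt (has1 d) (nx1 d m1 (ctrl s b)) `+` opt true (nx0 d m1 (ctrl s b)))]].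
Proof.
case/step_elim=> s0 [o [d [Hl Hd [m1 [m0 [R [H0 H1 EM EC]]]]]]].
have Hsz : s0 < size (prog E).
  by case/In_lines: Hl => l1 [l2 [-> <-]]; rewrite size_cat /=; lia.
have Hsrc : src d <= size (prog E).
  have := wf_descs_of o Hsz; elim: (descs_of _) Hd => //= d' l IH [->|H] /andP[/and5P[]] //.
  by move=> *; apply: IH.
have [Em0 Es EM'] := inv_ctrl Hsrc EM (fun w => leq_trans (leq_addr _ _) (H0 w)).
exists s0, o, d, m1, R; split=> //; first by rewrite -Em0.
by split=> //; [rewrite EM' opt_nseq | rewrite EC opt_nseq opt_rcons Em0].
Qed.

(** The converse of [ostep_fwd]. The marks identify the tuples that take part, and [wfop] makes sure
    that the result is again the encoding of an abstract state. *)
Lemma step_inv s x (C : nu_conf W) : nu_step (encA s x) C -> exists s0 o, List.In (s0, o) ln /\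
  match o with
  | Start => s = 0 /\ C = encA s0 x
  | Stop => s = s0.+1 /\ C = encA 0 x
  | _ => s = s0.+1 /\ (wfop o x.1.2 -> exists y adv,
           ostep o x y adv /\ ceq C (encA (if adv then s0 else s) y))
  end.
Proof.
case: x => [[b cur] M] /step_opt_inv[s0 [o [d [m1 [R [Hl Hd Es H0 [H1 EM EC]]]]]]].
exists s0, o; split=> //.
case: o Hl Hd => [||p|i|i|p|c|p l] _.
- case=> // Ed; have Eh : has1 d = false by rewrite -Ed.
  have En : (new d != [::]) = false by rewrite -Ed.
  rewrite {}Eh {}En /opt -{}Ed [src _]/= in Es H0 H1 EM EC; rewrite {}EC -{}Es in H0 *.
  by rewrite next0_jump encAE EM; split=> //; mset_count.
- case=> // Ed; have Eh : has1 d = false by rewrite -Ed.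
  have En : (new d != [::]) = false by rewrite -Ed.
  rewrite {}Eh {}En /opt -{}Ed [src _]/= in Es H0 H1 EM EC; rewrite {}EC -{}Es in H0 *.
  by rewrite next0_jump encAE EM; split=> //; mset_count.
- case=> // Ed; have Eh : has1 d = true by rewrite -Ed.
  have En : (new d != [::]) = false by rewrite -Ed.
  rewrite {}Eh {}En /opt -{}Ed [src _]/= in Es H0 H1 EM EC; rewrite {}EC -{}Es in H0 *.
  split=> // _; have [|k [M' [EMk Ek Em1 ER]]] := inv_id (p := p) EM.
    by apply: leq_trans (H1 isT _); rewrite /= eqxx.
  exists (addb b (tokb k), cur, M'), true; split; first by rewrite EMk; constructor.
  rewrite Em1 -Ek next0_take next1_take ER encAE => m Hm.
  by rewrite !msetDE mset0E [[mset [ffun=> 0]] m]msetnE (negbTE Hm); lia.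
- case=> // Ed; have Eh : has1 d = false by rewrite -Ed.
  have En : (new d != [::]) = false by rewrite -Ed.
  rewrite {}Eh {}En /opt -{}Ed [src _]/= in Es H0 H1 EM EC; rewrite {}EC -{}Es in H0 *.
  split=> // _; have Hb : 0 < b i.
    by have := H0 (inl (qbuf i)); rewrite ffunE /= eqxx.
  exists ([ffun j => b j - (j == i)], cur, M), true; split; first by constructor.
  by rewrite next0_sub encAE EM => m Hm; rewrite !msetDE mset0E; lia.
- case=> // Ed; have Eh : has1 d = false by rewrite -Ed.
  have En : (new d != [::]) = false by rewrite -Ed.
  rewrite {}Eh {}En /opt -{}Ed [src _]/= in Es H0 H1 EM EC; rewrite {}EC -{}Es in H0 *.
  split=> // _; exists ([ffun j => b j + (j == i)], cur, M), true; split; first by constructor.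
  by rewrite next0_add encAE EM => m Hm; rewrite !msetDE mset0E; lia.
- case=> // Ed; have Eh : has1 d = false by rewrite -Ed.
  have En : (new d != [::]) = true by rewrite -Ed.
  rewrite {}Eh {}En /opt -{}Ed [src _]/= in Es H0 H1 EM EC; rewrite {}EC -{}Es in H0 *.
  split=> //; case: cur EM => [k|] EM // _.
  exists (b, Some (tok0 p), M), true; split; first by constructor.
  rewrite next0_jump (new_cur p) encAE cmset_Some => m Hm.
  by have := congr1 (fun A : nu_conf W => A m) EM; rewrite cmset_None !msetDE !mset0E; lia.
- case=> [Ed|[Ed|//]]; last first.
    have Eh : has1 d = false by rewrite -Ed.
    have En : (new d != [::]) = false by rewrite -Ed.
    rewrite {}Eh {}En /opt -{}Ed [src _]/= in Es H0 H1 EM EC; rewrite {}EC -{}Es in H0 *.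
    split=> // _; exists (b, cur, M), true; split; first by constructor.
    by rewrite next0_jump encAE EM => m Hm; rewrite !msetDE mset0E; lia.
  have Eh : has1 d = true by rewrite -Ed.
  have En : (new d != [::]) = false by rewrite -Ed.
  rewrite {}Eh {}En /opt -{}Ed [src _]/= in Es H0 H1 EM EC; rewrite {}EC -{}Es in H0 *.
  split=> //; have [|k [Ek Em1 ER]] := inv_cur EM.
    exact: leq_trans (H1 isT _).
  rewrite Ek => Hk; have Hb : 0 < b (to_buf c).
    by have := H0 (inl (qbuf (to_buf c))); rewrite ffunE /= eqxx.
  exists ([ffun j => b j - (j == to_buf c)], Some (bump k c), M), false; split.
    by constructor.
  rewrite Em1 next0_sub next1_fill // encAE cmset_Some ER => m Hm.
  by rewrite !msetDE mset0E; lia.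
- case=> // Ed; have Eh : has1 d = true by rewrite -Ed.
  have En : (new d != [::]) = false by rewrite -Ed.
  rewrite {}Eh {}En /opt -{}Ed [src _]/= in Es H0 H1 EM EC; rewrite {}EC -{}Es in H0 *.
  split=> //; have [|k [Ek Em1 ER]] := inv_cur EM.
    exact: leq_trans (H1 isT _).
  rewrite Ek => Hk; rewrite -{p}Hk in H0 H1 *.
  exists (if l then drain (tag k) b else b, None, (if l then absorb k b else k) +` M), true.
  split; first by constructor.
  rewrite Em1 -/(close_desc _ _ _ _) next0_close next1_close encAE cmset_None tset1 ER => m Hm.
  by rewrite !msetDE !mset0E; lia.
Qed.

End Firing.

(** * Runs of the net and firings of events *)

Section Macro.
Variable E : eos.
Local Notation SP := (place (sys E)).
Local Notation tok := (token E).
Local Notation buffer := {ffun bufT E -> nat}.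
Local Notation W := (simnet E).
Local Notation ln := (lines (prog E)).
Local Notation ceq := (conf_eq (W := W)).
Implicit Types (b : buffer) (k : tok) (M : eos_conf E) (p : SP) (x y z : st E).

(** The complete execution of an instruction: finitely many rounds that stay at the instruction,
    then one that advances. Only [Fill] has rounds of the first kind. *)
Inductive dop (o : op E) : st E -> st E -> Prop :=
| dop_adv x y : ostep o x y true -> dop o x y
| dop_loop x z y : ostep o x z false -> dop o z y -> dop o x y.

Fixpoint den (l : seq (op E)) x y : Prop :=
  if l is o :: l' then exists2 z, dop o x z & den l' z y else x = y.

Lemma den_cat l1 l2 x y : den (l1 ++ l2) x y <-> exists2 z, den l1 x z & den l2 z y.
Proof.
elim: l1 x => [|o l1 IH] x /=; first by split=> [|[z ->]] //; exists x.
split=> [[z Hz /IH[z' H1 H2]]|[z [z' H1 H2] H3]].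
  by exists z' => //; exists z.
by exists z' => //; apply/IH; exists z.
Qed.

(** The control tuple is nonzero, hence visible to [ceq]. The bound on [s'] makes it an actual
    control state, so that [inord] does not fall back to its default. *)
Lemma encA_state s x s' x' : s' <= size (prog E) -> ceq (encA s x) (encA s' x') -> s = s'.
Proof.
move=> Hs' H; pose m := ctrl s' x'.1.1.
have Hm : m != [ffun=> 0].
  apply/eqP => /ffunP /(_ (inr (inord s'))); rewrite !ffunE inordK // eqxx.
  by [].
have : m \in encA s x by rewrite in_mset H // -in_mset in_mset1D eqxx.
have Hp : 0 < m (inr (inord s')) by rewrite ffunE inordK // eqxx.
case/encA_mem=> [Em|[k _ Em]|[k _ Em]]; move: Hp; rewrite Em ffunE //.
by rewrite inordK //; case: eqP.
Qed.

Lemma not_encoded s x C M : s != 0 -> ceq C (encA s x) -> ~ ceq C (enc_conf (@layout E) M).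
Proof.
move=> Hs H1 H2; have := ceq_trans (ceq_sym H1) H2; rewrite enc_confE.
by move/encA_state => /(_ isT) Es; rewrite Es in Hs.
Qed.

(** Induction on the remaining instructions, and inside on the rounds of the current one; each
    firing is transported along [ceq] by [ceq_step]. *)
Lemma den_macro l P1 P2 x y C : prog E = P1 ++ l ++ Stop :: P2 -> den l x y ->
  ceq C (encA (size l + (size P2).+1) x) ->
  exists2 C', macro_step (@layout E) C C' & ceq C' (encA 0 y).
Proof.
elim: l P1 x C => [|o l IH] P1 x C Ep /=.
  move=> <- HC.
  have Hstep : nu_step (encA (size P2).+1 x) (encA 0 x).
    apply: jump_step; apply: (@In_descs E (size P2) Stop); last by left.
    by apply/In_lines; exists P1, P2.
  have [C' H1 H2] := ceq_step (ceq_sym HC) Hstep.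
  by exists C'; [apply: macro_last | apply: ceq_sym].
case=> z Hz Hd; set s := size l + (size P2).+1.
have Hl : List.In (s, o) ln.
  by apply/In_lines; exists P1, (l ++ Stop :: P2); rewrite size_cat.
elim: Hz C Hd => {x z} [x z Ho|x z' z Ho _ IHo] C Hd HC.
  have [D H1 H2] := ostep_fwd Hl Ho.
  have [C1 H3 H4] := ceq_step (ceq_sym HC) H1.
  have H5 : ceq C1 (encA s z) := ceq_trans (ceq_sym H4) H2.
  have [|C' H6 H7] := IH (rcons P1 o) z C1 _ Hd H5; first by rewrite cat_rcons.
  (* [Stop] is still ahead, so the control state is positive and the configuration is not
     encoded. *)
  exists C' => //; apply: macro_more H3 _ H6 => M; apply: not_encoded H5.
  by rewrite /s addnS.
have [D H1 H2] := ostep_fwd Hl Ho.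
have [C1 H3 H4] := ceq_step (ceq_sym HC) H1.
have H5 : ceq C1 (encA s.+1 z') := ceq_trans (ceq_sym H4) H2.
have [C' H6 H7] := IHo C1 Hd H5.
by exists C' => //; apply: macro_more H3 _ H6 => M; apply: not_encoded H5.
Qed.

(** A static check that tracks the system place of the token under construction. It guarantees
    [wfop] along every execution and excludes [Start] and [Stop] inside an event. *)
Fixpoint wfs (cp : option SP) (l : seq (op E)) : Prop :=
  if l is o :: l' then
    match o with
    | Start | Stop => False
    | Create p => cp = None /\ wfs (Some p) l'
    | Fill c => cp = Some (tag c) /\ wfs cp l'
    | Close p _ => cp = Some p /\ wfs None l'
    | _ => wfs cp l'
    end
  else True.

Local Notation cp x := (omap tag x.1.2).

Lemma wfs_step o l x y adv : wfs (cp x) (o :: l) -> ostep o x y adv ->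
  if adv then wfs (cp y) l else wfs (cp y) (o :: l).
Proof.
move=> Hw Ho; case: Ho Hw => //=.
- by move=> p b M [_].
- by move=> c x' [].
- by move=> p l' b k M _ [].
Qed.

Lemma wfs_op o l x : wfs (cp x) (o :: l) -> wfop o x.1.2.
Proof. by case: x => [[b [k|]] M]; case: o => //= [p|c|p l'] [] // [<-]. Qed.

Lemma cat_eq_size (A : Type) (l1 l2 r1 r2 : seq A) :
  l1 ++ r1 = l2 ++ r2 -> size r1 = size r2 -> r1 = r2.
Proof.
move=> He Hs; have Hl : size l1 = size l2.
  by have := congr1 size He; rewrite !size_cat Hs; lia.
by have := congr1 (drop (size l1)) He; rewrite drop_size_cat // Hl drop_size_cat.
Qed.

(** The number of a line is the length of the rest of the program, so it determines the position and
    thus the instruction. *)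
Lemma line_uniq P1 o l s o' : prog E = P1 ++ o :: l -> s = size l ->
  List.In (s, o') ln -> o' = o.
Proof.
move=> Ep Es /In_lines[l1 [l2 [El Hs]]]; rewrite Ep in El.
by have [] : o :: l = o' :: l2 by apply: (cat_eq_size El) => /=; rewrite Hs Es.
Qed.

(** The run is followed until it executes [Stop]. It could continue beyond that point if the
    configuration there, although in control state 0, were not encoded; this is the second
    alternative, refuted later because the buffers are empty there. *)
Lemma macro_den C C' : macro_step (@layout E) C C' ->
  forall l P1 P2 x, prog E = P1 ++ l ++ Stop :: P2 -> wfs (cp x) l ->
  ceq C (encA (size l + (size P2).+1) x) ->
  (exists M, ceq C' (enc_conf (@layout E) M)) ->
  exists2 y, den l x y & ceq C' (encA 0 y) \/
    exists2 C1, ceq C1 (encA 0 y) & forall M, ~ ceq C1 (enc_conf (@layout E) M).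
Proof.
(* One firing: [step_inv] yields some line with the right source state, and [line_uniq] identifies
   it with the line that is due. *)
have one C0 C1 l P1 P2 x : nu_step C0 C1 -> prog E = P1 ++ l ++ Stop :: P2 -> wfs (cp x) l ->
    ceq C0 (encA (size l + (size P2).+1) x) ->
    if l is o :: l' then exists y adv, ostep o x y adv /\
      ceq C1 (encA (if adv then size l' + (size P2).+1 else (size l' + (size P2).+1).+1) y)
    else ceq C1 (encA 0 x).
  move=> Hstep Ep Hw HC; have [D /step_inv[s0 [o [Hl Ho]]] HD] := ceq_step HC Hstep.
  have Es : size l + size P2 = s0.
    by move: Ho; rewrite addnS; case: (o) => [||p|i|i|p|c|p l'] [] // [].
  case: l Ep Hw HC Ho Es => [|o' l] Ep Hw _ Ho Es.
    have Eo := line_uniq Ep (esym Es) Hl; rewrite Eo in Ho.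
    by case: Ho => _ <-.
  have Es' : s0 = size (l ++ Stop :: P2) by rewrite -Es size_cat /= addnS.
  have Eo := line_uniq Ep Es' Hl; rewrite {o Hl}Eo in Ho; rewrite -Es in Ho.
  have {Ho} [y [adv [H1 H2]]] : exists y adv, ostep o' x y adv /\
      ceq D (encA (if adv then size (o' :: l) + size P2 else size (o' :: l) + (size P2).+1) y).
    by have := wfs_op Hw; case: o' Ho Hw {Es Ep} => [||p|i|i|p|c|p l'] //= [_ H] _ /H.
  exists y, adv; split=> //; apply: ceq_trans HD _.
  by move: H2; rewrite /= !addnS !addSn.
elim=> {C C'} [C C' Hstep|C C1 C' Hstep Hn Hm IH] l P1 P2 x Ep Hw HC HM.
  have := one _ _ _ _ _ _ Hstep Ep Hw HC; case: l Ep Hw HC => [|o l] Ep Hw HC.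
    by exists x => //; left.
  case=> y [adv [_ H2]]; case: HM => M HM; exfalso; apply: not_encoded H2 HM.
  by case: (adv); rewrite ?addnS.
have := one _ _ _ _ _ _ Hstep Ep Hw HC; case: l Ep Hw HC => [|o l] Ep Hw HC.
  by exists x => //; right; exists C1.
case=> y [adv [H1 H2]]; have := wfs_step Hw H1; case: adv H1 H2 => H1 H2 Hw'.
  have [|z Hz Hd] := IH l (rcons P1 o) P2 y _ Hw' H2 HM; first by rewrite cat_rcons.
  by exists z => //; exists y => //; apply: dop_adv.
have [z [z' Hz1 Hz2] Hd] := IH (o :: l) P1 P2 y Ep Hw' H2 HM.
by exists z => //; exists z' => //; apply: dop_loop H1 Hz1.
Qed.

Definition is_start (o : op E) := if o is Start then true else false.

(** Ensures that a [Start] found in the program is the beginning of an event, which [start_line]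
    needs to recover the event from the control state. *)
Lemma wfs_start cp l : wfs cp l -> ~~ has is_start l.
Proof.
elim: l cp => //= o l IH cp; case: o => //= [p|i|i|p|c|p l'].
- exact: IH. - exact: IH. - exact: IH.
- by case=> _; exact: IH.
- by case=> _; exact: IH.
- by case=> _; exact: IH.
Qed.

Lemma start_split A rest l1 l2 : ~~ has is_start A -> A ++ rest = l1 ++ Start :: l2 ->
  exists l1', rest = l1' ++ Start :: l2.
Proof.
elim: A l1 => [|o A IH] l1 /=; first by exists l1.
rewrite negb_or => /andP[Ho HA]; case: l1 => [[Eo _]|o' l1 [_ H]]; last exact: IH HA H.
by rewrite Eo in Ho.
Qed.

Hypothesis wfs_evops : forall ev, wfs None (evops ev).

Lemma start_line s : List.In (s, Start) ln ->
  exists2 ev, ev \in events E & exists P1 P2,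
   prog E = P1 ++ evops ev ++ Stop :: P2 /\ s = size (evops ev) + (size P2).+1.
Proof.
case/In_lines=> l1 [l2 [Ep <-]].
suff [ev Hev [P2 E2]] : exists2 ev, ev \in events E & exists P2, l2 = evops ev ++ Stop :: P2.
  exists ev => //; exists (rcons l1 Start), P2; rewrite cat_rcons -E2; split=> //.
  by rewrite E2 size_cat.
move: Ep; rewrite /prog; elim: (events E) l1 => [|ev evs IH] l1 /=.
  by case: l1.
case: l1 => [[<-]|o l1 [_ H]].
  exists ev; first by rewrite inE eqxx.
  by exists (flatten [seq Start :: rcons (evops ev) Stop | ev <- evs]); rewrite cat_rcons.
have [|l1' H'] := start_split _ H.
  by rewrite has_rcons; exact: wfs_start (wfs_evops ev).
by have [ev' Hev' H2] := IH _ H'; exists ev' => //; rewrite inE Hev' orbT.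
Qed.

Lemma event_line ev : ev \in events E -> exists P1 P2,
  prog E = P1 ++ Start :: evops ev ++ Stop :: P2.
Proof.
rewrite /prog; elim: (events E) => // ev' evs IH; rewrite inE => /orP[/eqP<-|/IH[P1 [P2 H]]].
  by exists [::]; eexists; rewrite /= cat_rcons.
by exists (Start :: rcons (evops ev') Stop ++ P1), P2; rewrite /= H -catA.
Qed.

Lemma tok_tup_inj : injective (@tok_tup E).
Proof.
move=> k k' /ffunP H.
have Et : tag k = tag k'.
  by have := H (inl (qid (tag k))); rewrite !ffunE /= eqxx; case: eqP.
case: k k' Et H => p m [p' m'] /= Et; subst p' => H.
congr existT; apply/ffunP => q.
have := H (inl (qcopy (copy_of q))); rewrite !ffunE /=.
by rewrite (@cpy_copy E (existT _ p m)) (@cpy_copy E (existT _ p m')).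
Qed.

(** Token tuples are nonzero because of their identifier, so [ceq] sees their multiplicities, and
    [tok_tup] is injective. *)
Lemma enc_conf_inj M M' : ceq (enc_conf (@layout E) M) (enc_conf (@layout E) M') -> M = M'.
Proof.
move=> H; apply/msetP => k; have := H (tok_tup k).
have Hk : tok_tup k != [ffun=> 0].
  by apply/eqP => /ffunP /(_ (inl (qid (tag k)))); rewrite !ffunE /= eqxx.
move/(_ Hk); rewrite !enc_confE !encAE !msetDE => /addnI; rewrite cmset_None !mset0E.
have T N : tset N (tok_tup k) = N k.
  rewrite mset_seqE count_map -count_mem_mset; apply: eq_count => k' /=.
  exact: (inj_eq tok_tup_inj).
by rewrite !T.
Qed.

Hypothesis den_evops : forall ev M y,
  den (evops ev) ([ffun=> 0], None, M) y <->
  exists2 M', y = ([ffun=> 0], None, M') & eos_fires ev M M'.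

Lemma simnet_simulates : simulates (@layout E).
Proof.
split; first exact: layout_inj.
move=> M M'; split.
  case=> ev Hev Hf; have [P1 [P2 Ep]] := event_line Hev.
  have Hd : den (evops ev) ([ffun=> 0], None, M) ([ffun=> 0], None, M').
    by apply/den_evops; exists M'.
  have Ep' : prog E = rcons P1 Start ++ evops ev ++ Stop :: P2 by rewrite cat_rcons.
  have [C H1 H2] := den_macro Ep' Hd (@ceq_refl _ _).
  exists C; last by rewrite enc_confE.
  apply: macro_more _ _ H1; last first.
    by move=> M0; apply: not_encoded (@ceq_refl _ _); rewrite addnS.
  rewrite enc_confE; apply: jump_step.
  apply: (@In_descs E (size (evops ev) + (size P2).+1) Start); last by left.
  by apply/In_lines; exists P1, (evops ev ++ Stop :: P2); rewrite size_cat.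
case=> C Hm HC.
(* All transitions except those of [Start] leave a positive control state, so the first firing
   selects an event. *)
have first C1 : nu_step (enc_conf (@layout E) M) C1 -> exists s, List.In (s, Start) ln /\
     C1 = encA s ([ffun=> 0], None, M).
  rewrite enc_confE => /step_inv[s0 [o [Hl Ho]]].
  by case: o Hl Ho => [||p|i|i|p|c|p l] Hl [] // _ ->; exists s0.
have Hcases : exists s C1, [/\ List.In (s, Start) ln, C1 = encA s ([ffun=> 0], None, M)
    & C1 = C \/ macro_step (@layout E) C1 C].
  case: Hm HC first => {C} [C0 C Hs|C0 C1 C Hs _ Hm] HC first.
    by have [s [H1 H2]] := first _ Hs; exists s, C; split=> //; left.
  by have [s [H1 H2]] := first _ Hs; exists s, C1; split=> //; right.
case: Hcases => s [C1 [Hl EC1 H]].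
have [ev Hev [P1 [P2 [Ep Es]]]] := start_line Hl.
have Hs0 : s != 0 by rewrite Es addnS.
case: H => [EC|Hm'].
  (* A run of length one would end just after [Start], where the control state is positive. *)
  by case: (@not_encoded s ([ffun=> 0], None, M) C M' Hs0); rewrite -?EC ?EC1 // -EC1 EC.
have HC1 : ceq C1 (encA (size (evops ev) + (size P2).+1) ([ffun=> 0], None, M)).
  by rewrite EC1 Es.
have [|y Hd] := macro_den Hm' Ep (wfs_evops ev : wfs (cp ([ffun=> 0], None, M)) _) HC1.
  by exists M'.
have [M2 Ey Hf] := (proj1 (den_evops _ _ _)) Hd.
rewrite Ey -enc_confE => -[H|[C2 H1 H2]]; last by case: (H2 _ H1).
exists ev => //; suff -> : M' = M2 by [].
by apply: enc_conf_inj; apply: ceq_trans (ceq_sym HC) H.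
Qed.

End Macro.

(** * Executions of the instructions of one event *)

Lemma count_listing (A : finType) (f : A -> nat) a : count_mem a (listing f) = f a.
Proof.
rewrite /listing count_flatten -map_comp sumnE big_map big_enum /= (bigD1 a) //=.
rewrite count_nseq /= eqxx mul1n big1 ?addn0 // => a' Ha'.
by rewrite count_nseq /= (negbTE Ha').
Qed.

(** Used to arrange the tokens of a mode in the order in which the program takes or creates tokens
    at the given places. *)
Lemma perm_map_lift (A B : eqType) (f : A -> B) s t : perm_eq (map f s) t ->
  exists2 s', perm_eq s s' & map f s' = t.
Proof.
elim: t s => [|b t IH] s.
  by move=> /perm_size /=; rewrite size_map => /size0nil->; exists [::].
move=> H; have : b \in map f s by rewrite (perm_mem H) mem_head.
case/mapP=> a Ha Eb; rewrite Eb in H *.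
have Hs := perm_to_rem Ha.
have : perm_eq (map f (rem a s)) t.
  by rewrite -(perm_cons (f a)) -(permPr H) perm_sym; exact: (perm_map f Hs).
case/IH=> s' Hs' <-; exists (a :: s') => //.
by rewrite (permPl Hs) perm_cons.
Qed.

Lemma cmem_cons (A : eqType) (a x : A) s : count_mem a (x :: s) = (a == x) + count_mem a s.
Proof. by rewrite /= eq_sym. Qed.

Section Den.
Variable E : eos.
Local Notation SP := (place (sys E)).
Local Notation tok := (token E).
Local Notation buffer := {ffun bufT E -> nat}.
Implicit Types (b : buffer) (k : tok) (M : eos_conf E) (p : SP) (x y z : st E).

Definition sumb (s : seq tok) : buffer := [ffun j => \sum_(k <- s) tokb k j].

Lemma sumb_cons k s : sumb (k :: s) = addb (tokb k) (sumb s).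
Proof. by apply/ffunP => j; rewrite !ffunE big_cons ffunE. Qed.

Lemma dop_inv o x y : dop o x y -> (forall c, o <> Fill c) -> ostep o x y true.
Proof.
case=> // {}x z {}y Hs _ H; move Ea: false Hs => a Hs.
by case: Hs Ea H => // c b k M _ _ _ /(_ c).
Qed.

Lemma den_takes_inv ps b cur M y : den [seq Take p | p <- ps] (b, cur, M) y ->
  exists l M', [/\ map tag l = ps, M = seq_mset l `+` M' & y = (addb b (sumb l), cur, M')].
Proof.
elim: ps b M => [|p ps IH] b M /=.
  move=> <-; exists [::], M; rewrite seq_mset0 mset0D; split=> //.
  by congr (_, _, _); apply/ffunP => j; rewrite !ffunE big_nil addn0.
case=> z /dop_inv Hz; have {Hz} : ostep (Take p) (b, cur, M) z true by apply: Hz.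
move Eo: (Take p) => o; move Ex: (b, cur, M) => x; move Ea: true => a Hz.
case: Hz Eo Ex Ea => // p' b' cur' M' k Hk [Ep] [<- <- ->] _ /IH[l [M'' [Hl EM ->]]].
exists (k :: l), M''; split=> /=; first by rewrite Hl Hk Ep.
  by rewrite EM mset_cons msetDA.
by congr (_, _, _); apply/ffunP => j; rewrite sumb_cons !ffunE addnA.
Qed.

Lemma den_takes l b cur M :
  den [seq Take p | p <- map tag l] (b, cur, seq_mset l `+` M) (addb b (sumb l), cur, M).
Proof.
elim: l b => [|k l IH] b /=.
  rewrite seq_mset0 mset0D; congr (_, _, _).
  by apply/ffunP => j; rewrite !ffunE big_nil addn0.
exists (addb b (tokb k), cur, seq_mset l `+` M).
  by apply: dop_adv; rewrite mset_cons -msetDA; apply: oTake.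
have := IH (addb b (tokb k)); congr den; congr (_, _, _).
by apply/ffunP => j; rewrite sumb_cons !ffunE addnA.
Qed.

Lemma den_subs_inv js b cur M y : den [seq Sub j | j <- js] (b, cur, M) y ->
  (forall j, count_mem j js <= b j) /\ y = ([ffun j => b j - count_mem j js], cur, M).
Proof.
elim: js b => [|i js IH] b.
  by move=> <-; split=> //; congr (_, _, _); apply/ffunP => j; rewrite ffunE subn0.
case=> z /dop_inv Hz; have {Hz} : ostep (Sub i) (b, cur, M) z true by apply: Hz.
move Eo: (Sub i) => o; move Ex: (b, cur, M) => x; move Ea: true => a Hz.
case: Hz Eo Ex Ea => // i' b' cur' M' Hb [Ei] [Eb Ec EM] _; subst i' b' cur' M' =>
    /IH[Hc ->]; split.
  move=> j; have := Hc j; rewrite ffunE cmem_cons; case: eqP => [->|_]; lia.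
by congr (_, _, _); apply/ffunP => j; rewrite !ffunE cmem_cons subnDA.
Qed.

Lemma den_subs js b cur M : (forall j, count_mem j js <= b j) ->
  den [seq Sub j | j <- js] (b, cur, M) ([ffun j => b j - count_mem j js], cur, M).
Proof.
elim: js b => [|i js IH] b Hb.
  by congr (_, _, _); apply/ffunP => j; rewrite ffunE subn0.
exists ([ffun j => b j - (j == i)], cur, M).
  by apply: dop_adv; apply: oSub; have := Hb i; rewrite cmem_cons eqxx; lia.
have -> : [ffun j => b j - count_mem j (i :: js)] =
   [ffun j => [ffun j0 => b j0 - (j0 == i)] j - count_mem j js].
  by apply/ffunP => j; rewrite !ffunE cmem_cons subnDA.
by apply: IH => j; rewrite ffunE; have := Hb j; rewrite cmem_cons; lia.
Qed.

(** The subtraction in the second branch is the effect of the blocking [Sub] instructions on types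
    that are not produced. *)
Definition adj (ps : seq SP) (js : seq (bufT E)) b : buffer :=
  [ffun j => if tag j \in map (@typ E) ps then b j + count_mem j js else b j - count_mem j js].

Lemma den_adds_inv ps js b cur M y : den [seq add_or_block ps j | j <- js] (b, cur, M) y ->
  (forall j, tag j \notin map (@typ E) ps -> count_mem j js <= b j) /\
  y = (adj ps js b, cur, M).
Proof.
elim: js b => [|i js IH] b.
  move=> <-; split=> //; congr (_, _, _); apply/ffunP => j; rewrite ffunE /= subn0 addn0.
  by case: ifP.
case=> z; rewrite /add_or_block; case: ifP => Hi.
  move=> /dop_inv Hz; have {Hz} : ostep (Add i) (b, cur, M) z true by apply: Hz.
  move Eo: (Add i) => o; move Ex: (b, cur, M) => x; move Ea: true => a Hz.
  case: Hz Eo Ex Ea => // i' b' cur' M' [<-] [<- <- <-] _ /IH[Hc ->]; split.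
    move=> j Hj; have := Hc j Hj; rewrite ffunE cmem_cons.
    by case: (eqVneq j i) Hj => [->|_]; rewrite ?Hi //; lia.
  congr (_, _, _); apply/ffunP => j; rewrite !ffunE cmem_cons.
  by case: ifP => Hj; [lia | case: eqP Hj => [->|_]; rewrite ?Hi ?addn0].
move=> /dop_inv Hz; have {Hz} : ostep (Sub i) (b, cur, M) z true by apply: Hz.
move Eo: (Sub i) => o; move Ex: (b, cur, M) => x; move Ea: true => a Hz.
case: Hz Eo Ex Ea => // i' b' cur' M' Hb [Ei] [Eb Ec EM] _; subst i' b' cur' M' =>
    /IH[Hc ->]; split.
  move=> j Hj; have := Hc j Hj; rewrite ffunE cmem_cons; case: eqP => [->|_]; lia.
congr (_, _, _); apply/ffunP => j; rewrite !ffunE cmem_cons.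
by case: ifP => Hj; [case: eqP Hj => [->|_]; rewrite ?Hi ?subn0 | rewrite subnDA].
Qed.

Lemma den_adds ps js b cur M :
  (forall j, tag j \notin map (@typ E) ps -> count_mem j js <= b j) ->
  den [seq add_or_block ps j | j <- js] (b, cur, M) (adj ps js b, cur, M).
Proof.
elim: js b => [|i js IH] b Hb.
  by congr (_, _, _); apply/ffunP => j; rewrite ffunE /= subn0 addn0; case: ifP.
rewrite map_cons {1}/add_or_block; case: ifP => Hi.
  exists ([ffun j => b j + (j == i)], cur, M); first by apply: dop_adv; apply: oAdd.
  rewrite (_ : adj _ _ _ = adj ps js [ffun j => b j + (j == i)]).
    by apply: IH => j Hj; rewrite ffunE; have := Hb j Hj; rewrite cmem_cons; lia.
  apply/ffunP => j; rewrite !ffunE cmem_cons.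
  by case: ifP => Hj; [lia | case: eqP Hj => [->|_]; rewrite ?Hi ?addn0].
exists ([ffun j => b j - (j == i)], cur, M).
  apply: dop_adv; apply: oSub; have := Hb i; rewrite Hi cmem_cons eqxx => /(_ isT); lia.
rewrite (_ : adj _ _ _ = adj ps js [ffun j => b j - (j == i)]).
  apply: IH => j Hj; rewrite ffunE; have := Hb j Hj; rewrite cmem_cons => H.
  by apply: leq_trans (leq_sub2r _ H); rewrite addKn.
apply/ffunP => j; rewrite !ffunE cmem_cons.
by case: ifP => Hj; [case: eqP Hj => [->|_]; rewrite ?Hi ?subn0 | rewrite subnDA].
Qed.

Lemma bufP k (j : bufT E) : tag j = typ (tag k) -> exists q, j = buf_of (N := typ (tag k)) q.
Proof. by case: j => N q /= EN; subst N; exists q. Qed.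

Lemma eq_copy_buf k (c : copyT E) (q : place (obj (typ (tag k)))) : tag k = tag c ->
  (buf_of q == to_buf c) = (copy_of (p := tag k) q == c).
Proof.
case: c => p q' /= Ep; subst p; apply/eqP/eqP => H.
  by congr existT; exact: eq_from_Tagged H.
by rewrite /to_buf /= (eq_from_Tagged H).
Qed.

Lemma tokb_bump k c j : tag k = tag c -> tokb (bump k c) j = tokb k j + (j == to_buf c).
Proof.
move=> Ec; have [Hj|Hj] := eqVneq (tag j) (typ (tag k)).
  have [q ->] := bufP Hj; rewrite (@tokb_buf E (bump k c) q) tokb_buf /= ffunE.
  by rewrite eq_copy_buf.
rewrite !tokb_neq //; case: eqP => // Ej; rewrite Ej /= Ec eqxx in Hj.
by [].
Qed.

Lemma tokb_absorb k b j :
  tokb (absorb k b) j = tokb k j + (if tag j == typ (tag k) then b j else 0).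
Proof.
case: eqVneq => Hj; last by rewrite !tokb_neq.
by have [q ->] := bufP Hj; rewrite (@tokb_buf E (absorb k b) q) tokb_buf /= ffunE.
Qed.

Lemma tokb0 p j : tokb (tok0 p) j = 0.
Proof. by rewrite ffunE big1 // => q _; rewrite ffunE. Qed.

(** A unit only moves from a buffer to the current token, so their sum is invariant; this is all
    that has to be known about the choices made. *)
Lemma den_fills_inv cs b k M y : (forall c, List.In c cs -> tag k = tag c) ->
  den [seq Fill c | c <- cs] (b, Some k, M) y ->
  exists b' k', [/\ y = (b', Some k', M), tag k' = tag k
    & forall j, b' j + tokb k' j = b j + tokb k j].
Proof.
elim: cs b k => [|c cs IH] b k Hc /=; first by move=> <-; exists b, k.
case=> z Hz Hd.
have {Hz} [b1 [k1 [Ez Ek Hb]]] : exists b' k', [/\ z = (b', Some k', M), tag k' = tag k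
    & forall j, b' j + tokb k' j = b j + tokb k j].
  have {Hc} := Hc c (or_introl erefl).
  move Eo: (Fill c) Hz => o Hz; move Ex: (b, Some k, M) Hz => x Hz.
  elim: Hz b k Eo Ex => {x z Hd} [x z|x z' z] Hz.
    move Ea: true Hz => a Hz; case: Hz Ea => // c' x' _ b k _ <- _.
    by exists b, k.
  move Ea: false Hz => a Hz; case: Hz Ea =>
      // c' b' k' M' Hb Hk _ _ IHd b0 k0 [Ec] [-> -> EM] _.
  rewrite -EM Ec in IHd.
  have [b2 [k2 [-> E2 H2]]] := IHd _ _ erefl erefl Hk.
  exists b2, k2; split=> // j; rewrite H2 ffunE tokb_bump //.
  by case: eqP => [->|_]; lia.
have [|b2 [k2 [-> E2 H2]]] := IH b1 k1 _ (eq_ind _ (fun z => den _ z y) Hd _ Ez).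
  by move=> c' Hc'; rewrite Ek; apply: Hc; right.
by exists b2, k2; split=> // [|j]; rewrite ?E2 // H2.
Qed.

(** Every target marking [m'] covered by the buffers is reachable, each place being filled by as
    many rounds as it lacks. [B] is forced by conservation. *)
Lemma den_fills p (qs : seq (place (obj (typ p)))) b (B : buffer) (m m' : marking (obj
    (typ p))) M :
  let tk := fun m : marking (obj (typ p)) => Tagged (fun p => marking (obj (typ p))) m in
  (forall q, m q <= m' q) -> (forall q, q \notin qs -> m q = m' q) ->
  (forall j, b j + tokb (tk m) j = B j + tokb (tk m') j) ->
  den [seq Fill (copy_of q) | q <- qs] (b, Some (tk m), M) (B, Some (tk m'), M).
Proof.
move=> tk; elim: qs m b => [|q qs IH] m b Hm Hq Hb /=.
  have Em : m = m' by apply/ffunP => q; apply: Hq.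
  by rewrite Em; congr (_, _, _); apply/ffunP => j; apply: (@addIn (tokb (tk m') j));
      rewrite -Hb Em.
(* Inner induction on the number of units still missing at [q]. *)
move En: (m' q - m q) => d; elim: d m b Hm Hq Hb En => [|d IHd] m b Hm Hq Hb En.
  exists (b, Some (tk m), M); first by apply: dop_adv; apply: oSkip.
  apply: IH => // q' Hq'; have [->|ne] := eqVneq q' q.
    by have := Hm q; lia.
  by apply: Hq; rewrite inE negb_or ne.
have Tq (m0 : marking (obj (typ p))) : tokb (tk m0) (buf_of q) = m0 q.
  exact: (@tokb_buf E (tk m0) q).
pose m1 : marking (obj (typ p)) := [ffun q' => m q' + (copy_of q' == copy_of q)].
have Em1 q' : m1 q' = m q' + (q' == q).
  rewrite ffunE; congr (_ + nat_of_bool _); apply/eqP/eqP => [H|->] //.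
  exact: eq_from_Tagged H.
(* Conservation at the buffer of [q]: the target needs more there than the token has, so the buffer
   holds a unit. *)
have Hb' : 0 < b (to_buf (copy_of q)).
  by have := Hb (buf_of q); rewrite !Tq /to_buf /=; lia.
have [||||z Hz Hd] := IHd m1 [ffun j => b j - (j == to_buf (copy_of q))].
- by move=> q'; rewrite Em1; have := Hm q'; case: eqP => [->|_]; lia.
- move=> q' Hq'; rewrite Em1 -Hq //; move: Hq'; rewrite inE negb_or => /andP[/negbTE-> _].
  by rewrite addn0.
- move=> j; rewrite -Hb ffunE (tokb_bump (k := tk m) (c := copy_of q)) //.
  by case: eqP => [->|_]; lia.
- by rewrite Em1 eqxx; lia.
exists z => //; apply: dop_loop Hz.
by apply: (oFill (k := tk m)).
Qed.

(** Two facts survive all choices: the total content is conserved, and the buffers of every produced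
    type end empty, since its last [Close] drains them. *)
Lemma den_posts_inv r b M y : den (posts r) (b, None, M) y ->
  exists rho b', [/\ map tag rho = r, y = (b', None, seq_mset rho `+` M),
    forall j, b j = b' j + sumb rho j & forall j, tag j \in map (@typ E) r -> b' j = 0].
Proof.
elim: r b M => [|p r IH] b M /=.
  move=> <-; exists [::], b; rewrite seq_mset0 mset0D; split=> // j.
  by rewrite ffunE big_nil addn0.
set l := _ \notin _.
case=> z /dop_inv Hz; have {Hz} : ostep (Create p) (b, None, M) z true by apply: Hz.
move Eo: (Create p) => o; move Ex: (b, None, M) => x; move Ea: true => a Hz.
case: Hz Eo Ex Ea => // p' b' M' [<-] [<- <-] _ /den_cat[z1].
rewrite /fills (map_comp (@Fill E)) => Hf.
have [|b1 [k [Ez Ek Hb]]] := den_fills_inv _ Hf.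
  by move=> c; elim: (enum _) => //= q qs IHq [<-|].
rewrite {z1 Hf}Ez => -[z2 /dop_inv Hz]; have {Hz} : ostep (Close p l)
    (b1, Some k, M) z2 true by apply: Hz.
move Eo: (Close p l) => o'; move Ex: (b1, Some k, M) => x'; move Ea: true => a' Hz.
case: Hz Eo Ex Ea => // p2 l2 b2 k2 M2 Hk [Ep El] [Eb Ek2 EM] _; subst l2 b2 k2 M2;
    rewrite -{p2}Ep in Hk *.
case/IH=> rho [b3 [Hr -> Hb3 H0]].
set k' := (if l then absorb k b1 else k); set b2' := (if l then drain p b1 else b1) in Hb3.
have Ek' : tag k' = p by rewrite /k'; case: (l).
have Hk' j : b2' j + tokb k' j = b1 j + tokb k j.
  rewrite /b2' /k'; case: (l) => //; rewrite ffunE tokb_absorb Hk.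
  by case: eqP => _; lia.
exists (k' :: rho), b3; split=> //=.
- by rewrite Ek' Hr.
- by congr (_, _, _); rewrite mset_cons; mset_count.
- move=> j; rewrite sumb_cons ffunE; have := Hb j; have := Hk' j; have := Hb3 j.
  rewrite tokb0; lia.
- move=> j; rewrite inE => /orP[/eqP Hj|]; last exact: H0.
  have [Hl|] := boolP (typ p \in map (@typ E) r); first by apply: H0; rewrite Hj.
  (* The buffers of this type are zero after [drain], and by conservation they cannot be positive
     later. *)
  by rewrite -/l => Hl; have := Hb3 j; rewrite /b2' Hl ffunE Hj eqxx; lia.
Qed.

(** Each token is filled to exactly its intended marking by [Fill] alone, so the channels of [Close]
    find nothing left to move. *)
Lemma den_posts rho b b' M : (forall j, b j = b' j + sumb rho j) ->
  (forall j, tag j \in map (@typ E) (map tag rho) -> b' j = 0) ->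
  den (posts (map tag rho)) (b, None, M) (b', None, seq_mset rho `+` M).
Proof.
elim: rho b M => [|k rho IH] b M Hb H0 /=.
  rewrite seq_mset0 mset0D; congr (_, _, _); apply/ffunP => j.
  by rewrite Hb ffunE big_nil addn0.
exists (b, Some (tok0 (tag k)), M); first by apply: dop_adv; apply: oCreate.
(* [B] is what must be left for the later tokens and for the final buffers. *)
apply/den_cat; pose B := addb b' (sumb rho).
exists (B, Some k, M).
  case: k Hb H0 => p m Hb H0; apply: den_fills => [q|q|j] /=.
  - by rewrite ffunE.
  - by rewrite mem_enum.
  - by rewrite tokb0 Hb sumb_cons !ffunE; lia.
exists (B, None, k +` M); last first.
  have -> : seq_mset (k :: rho) `+` M = seq_mset rho `+` (k +` M).
    by rewrite mset_cons; mset_count.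
  apply: IH => [j|j Hj]; first by rewrite ffunE.
  by apply: H0; rewrite /= inE Hj orbT.
apply: dop_adv; set l := _ \notin _.
(* After the last token of its type, no later token and, by [H0], no final buffer needs anything of
   that type. *)
have Hl j : l -> tag j = typ (tag k) -> B j = 0.
  move=> Hl Hj; rewrite !ffunE H0 /= ?inE ?Hj ?eqxx // add0n big_seq big1 // => k' Hk'.
  rewrite tokb_neq //; apply: contraNneq Hl => Ej; rewrite -Hj Ej.
  by apply/mapP; exists (tag k') => //; apply: map_f.
have := @oClose E (tag k) l B k M erefl; case: (boolP l) => // Hl'.
have -> : drain (tag k) B = B.
  by apply/ffunP => j; rewrite ffunE; case: eqP => // Hj; rewrite (Hl j).
suff -> : absorb k B = k by [].
have H q : B (buf_of (N := typ (tag k)) q) = 0 by exact: Hl.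
rewrite /absorb; move: (B) H {Hb H0 Hl} => B0; case: (k) => p m /= H.
by congr existT; apply/ffunP => q; rewrite ffunE H addn0.
Qed.

Lemma wfs_evops ev : wfs None (evops (E := E) ev).
Proof.
rewrite /evops.
have H1 ps l : wfs None l -> wfs None ([seq Take p | p <- ps] ++ l) by move=> H; elim: ps.
have H2 js l : wfs None l -> wfs None ([seq Sub j | j <- js] ++ l) by move=> H; elim: js.
have H3 ps js l : wfs None l -> wfs None ([seq add_or_block ps j | j <- js] ++ l).
  by move=> H; elim: js => //= j js IH; rewrite /add_or_block; case: ifP.
apply: H1; apply: H2; apply: H3; elim: (listing _) => //= p ps IH; split=> //.
by rewrite /fills; elim: (enum _) => //= q qs IHq; split.
Qed.

Lemma token_atE N k q : token_at N k q = tokb k (buf_of q).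
Proof.
rewrite /token_at; case: eqP => [EN|ne]; first by subst N; rewrite /= tokb_buf.
by rewrite ffunE tokb_neq //; apply/eqP => H; apply: ne; rewrite -H.
Qed.

Lemma Pi1E (l : seq tok) p : Pi1 (seq_mset l) p = count_mem p (map tag l).
Proof.
rewrite ffunE (perm_big _ (perm_eq_seq_mset l)) /= count_map -sum1_count [RHS]big_mkcond.
by apply: eq_bigr => k _ /=; case: eqP.
Qed.

Lemma Pi2E (l : seq tok) N q : Pi2 N (seq_mset l) q = sumb l (buf_of q).
Proof.
rewrite !ffunE (perm_big _ (perm_eq_seq_mset l)) /=.
by apply: eq_bigr => k _; exact: token_atE.
Qed.

Lemma mem_listing (A : finType) (f : A -> nat) a : (a \in listing f) = (0 < f a).
Proof. by rewrite -count_listing -has_count has_pred1. Qed.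

Lemma sumb_notin l j : tag j \notin map (@typ E) (map tag l) -> sumb l j = 0.
Proof.
move=> H; rewrite ffunE big_seq big1 // => k Hk; rewrite tokb_neq //.
by apply: contraNneq H => ->; do 2 apply: map_f.
Qed.

Hypothesis consE : conservative E.

Lemma types_pre_post ev N : N \in map (@typ E) (listing (pre (N := sys E) ev)) ->
  N \in map (@typ E) (listing (post (N := sys E) ev)).
Proof.
case/mapP=> p; rewrite mem_listing => /consE[q [Hq <-]] ->.
by apply: map_f; rewrite mem_listing.
Qed.

(** The tokens taken form [lambda] and those created form [rho]. Produced types satisfy the mode
    equation by conservation and emptiness of the final buffers; for the other types both sides are
    zero by conservativity. *)
Lemma den_evops (ev : event E) M y :
  den (evops ev) ([ffun=> 0], None, M) y <->
  exists2 M', y = ([ffun=> 0], None, M') & eos_fires ev M M'.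
Proof.
set ps := listing (pre ev.1); set r := listing (post ev.1).
have Cpre j : count_mem j (listing (preb ev)) = preb ev j by exact: count_listing.
have Cpost j : count_mem j (listing (postb ev)) = postb ev j by exact: count_listing.
split.
  case/den_cat=> z1 /den_takes_inv[l [M1 [Hl EM ->]]].
  case/den_cat=> z2 /den_subs_inv[Hs ->] /den_cat[z3 /den_adds_inv[Ha ->]].
  case/den_posts_inv=> rho [b' [Hr -> Hb H0]].
  have b1E j : addb [ffun=> 0] (sumb l) j = sumb l j by rewrite !ffunE.
  have Hs' j : preb ev j <= sumb l j by rewrite -Cpre -b1E.
  (* For a type that is not produced, conservativity shows that no token of it is consumed. Its
     buffers are then empty, so the preset is zero, and the blocking [Sub] instructions force the
     postset to be zero. *)
  have Z j : tag j \notin map (@typ E) r ->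
      [/\ sumb l j = 0, preb ev j = 0, postb ev j = 0 & b' j + sumb rho j = 0].
    move=> Hj; have Sl : sumb l j = 0.
      by apply: sumb_notin; apply: contra Hj; rewrite Hl => /types_pre_post.
    have Hp : preb ev j = 0 by have := Hs' j; rewrite Sl; lia.
    have Hq : postb ev j = 0.
      by have := Ha j Hj; rewrite Cpost ffunE b1E Sl; lia.
    split=> //; rewrite -Hb ffunE (negbTE Hj) ffunE b1E Sl; lia.
  have b'0 : b' = [ffun=> 0].
    apply/ffunP => j; rewrite ffunE; have [|/Z[_ _ _]] := boolP (tag j \in map (@typ E) r).
      exact: H0.
    by move/eqP; rewrite addn_eq0 => /andP[/eqP].
  exists (seq_mset rho `+` M1); first by rewrite b'0.
  exists (seq_mset l), (seq_mset rho); split.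
  - by apply/msubsetP => k; rewrite EM msetDE leq_addr.
  - split.
    + by apply/ffunP => p; rewrite Pi1E Hl count_listing.
    + by apply/ffunP => p; rewrite Pi1E Hr count_listing.
    + move=> N; split=> q; first by rewrite Pi2E; exact: (Hs' (buf_of q)).
      rewrite !Pi2E -/(preb ev (buf_of q)) -/(postb ev (buf_of q)).
      have [Hj|/Z[-> -> -> H]] := boolP (tag (buf_of q) \in map (@typ E) r); last by lia.
      have := Hb (buf_of q); rewrite b'0 [X in _ = X + _]ffunE add0n => <-.
      by rewrite ffunE Hj ffunE b1E Cpre Cpost.
  - by rewrite EM msetDKB msetDC.
case=> M' -> [la [rho0 [Hla [H1 H2 H3] ->]]].
have Hp1 : perm_eq (map tag la) ps.
  apply/allP => p _ /=; rewrite count_listing -H1 -{2}[la]seq_mset_id Pi1E.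
  by [].
have Hp2 : perm_eq (map tag rho0) r.
  apply/allP => p _ /=; rewrite count_listing -H2 -{2}[rho0]seq_mset_id Pi1E.
  by [].
(* Conversely, the mode prescribes which tokens to take and how to fill the new ones. *)
have [l Pl Hl] := perm_map_lift Hp1; have [rho Pr Hr] := perm_map_lift Hp2.
have El : la = seq_mset l by rewrite -[LHS]seq_mset_id; apply/eq_seq_msetP.
have Er : rho0 = seq_mset rho by rewrite -[LHS]seq_mset_id; apply/eq_seq_msetP.
have H3' j : preb ev j <= sumb l j /\ sumb rho j = sumb l j - preb ev j + postb ev j.
  case: j => N q; have [/(_ q) + /(_ q)] := H3 N.
  by rewrite El Er !Pi2E.
have b1E j : addb [ffun=> 0] (sumb l) j = sumb l j by rewrite !ffunE.
have Rz j : tag j \notin map (@typ E) r -> sumb rho j = 0.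
  by move=> Hj; apply: sumb_notin; rewrite Hr.
apply/den_cat; exists (addb [ffun=> 0] (sumb l), None, M `\` la).
  rewrite [X in den _ (_, _, X) _](_ : M = seq_mset l `+` (M `\` la)); last first.
    by rewrite -El msetBDKC.
  by rewrite -/ps -Hl; exact: den_takes.
apply/den_cat; exists ([ffun j => addb [ffun=> 0] (sumb l) j - count_mem j (listing
    (preb ev))], None, M `\` la).
  by apply: den_subs => j; rewrite b1E Cpre; have [] := H3' j.
apply/den_cat; eexists.
  apply: den_adds => j Hj; rewrite Cpost ffunE b1E Cpre.
  by have [_] := H3' j; rewrite Rz //; lia.
rewrite msetDC Er -/r -Hr; apply: den_posts => j; last by rewrite ffunE.
rewrite [X in _ = X + _]ffunE add0n ffunE Hr ffunE b1E Cpre Cpost.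
have [_ ->] := H3' j; case: ifP => // /negbT Hj.
by have [_] := H3' j; rewrite Rz //; lia.
Qed.

End Den.

(** * Computing the net *)

Lemma PT_add A (I : A -> data) (m n : A -> nat) :
  PT I (fun x => enc_nat (m x)) -> PT I (fun x => enc_nat (n x)) ->
  PT I (fun x => enc_nat (m x + n x)).
Proof.
move=> Hm Hn; apply: PT_ext (@PT_cat _ I (fun=> unit) (fun _ _ => Leaf) _ _ (PT_nat_seq Hm)
    (PT_nat_seq Hn)) => x.
by rewrite /= -nseqD -enc_natE.
Qed.

(** Each new entry is the length of the list built so far, which replaces a counter; the list comes
    out in decreasing order and is reversed. *)
Lemma PT_iota A (I : A -> data) (n : A -> nat) :
  PT I (fun x => enc_nat (n x)) -> PT I (fun x => enc_seq enc_nat (iota 0 (n x))).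
Proof.
move=> Hn; pose g (_ : unit) (s : seq nat) := size s :: s.
have E m : foldr g [::] (nseq m tt) = rev (iota 0 m).
  elim: m => // m IH; rewrite -[in RHS]addn1 iotaD /= add0n rev_cat /= IH.
  by rewrite /g size_rev size_iota.
apply: (@PT_ext _ _ (fun x => enc_seq enc_nat (rev (foldr g [::] (nseq (n x) tt))))).
  by move=> x; rewrite E revK.
apply: (@PT_rev _ I (fun=> nat) (fun _ => enc_nat)).
apply: (@PT_foldr _ I (fun=> unit) (fun=> seq nat) (fun _ _ => Leaf)
   (fun _ => enc_seq enc_nat) (fun x => nseq (n x) tt) (fun=> [::]) (fun _ => g)).
- exact: PT_nat_seq.
- exact: PT_leaf.
- have H := PT_tl (PT_tl (PT_id (ctx I (fun x (bc : unit * seq nat) =>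
      Node Leaf (enc_seq enc_nat bc.2))))).
  apply: PT_node; last exact: H.
  exact: (@PT_size_seq _ _ (fun=> nat) (fun _ => enc_nat) (fun y => (tagged y).2)).
- have [b Pb Hb] := PT_size Hn.
  exists (fun m => b m * (b m * 2 + 2) + 1); first by auto 20 with polyb.
  move=> x s1 s2 Es; set m := data_size (I x).
  have -> : s2 = nseq (size s2) tt by elim: (s2) => //= -[] s' <-.
  have Hsz : size s2 <= b m.
    apply: leq_trans (Hb x); rewrite data_size_enc_nat -[n x](size_nseq _ tt) Es size_cat; lia.
  rewrite E data_size_rev; elim: (size s2) Hsz => [|k IH] Hk; first by rewrite /= addn1.
  have := data_size_cat enc_nat (iota 0 k) (iota k 1).
  have -> : iota 0 k ++ iota k 1 = iota 0 k.+1 by rewrite -[k.+1]addn1 iotaD.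
  rewrite /= data_size_enc_nat.
  have : data_size (enc_seq enc_nat (iota 0 k)) <= k * (b m * 2 + 2) + 1.
    elim: k {IH} Hk => [|k IH] Hk; first by [].
    have := data_size_cat enc_nat (iota 0 k) (iota k 1).
    have -> : iota 0 k ++ iota k 1 = iota 0 k.+1 by rewrite -[k.+1]addn1 iotaD.
    by rewrite /= data_size_enc_nat; have := IH (ltnW Hk); rewrite mulSn; lia.
  move=> H1 H2; nia.
Qed.

Lemma enc_elt_index (T : finType) (a : T) : enc_elt a = enc_nat (index a (enum T)).
Proof.
congr enc_nat; rewrite -[a in RHS](nth_enum_rank a) index_uniq ?enum_uniq //.
by rewrite -cardE.
Qed.

Lemma ranks_iota (T : finType) : [seq nat_of_ord (enum_rank a) | a <- enum T] = iota 0 #|T|.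
Proof.
apply: (@eq_from_nth _ 0) => [|i]; first by rewrite size_map size_iota cardE.
rewrite size_map => Hi; rewrite nth_iota ?cardE //.
have [a _] : exists a, a \in enum T by case: (enum T) Hi => // a s _; exists a;
    rewrite mem_head.
have := enum_valK (Ordinal (_ : i < #|T|)); rewrite -?cardE // in Hi *.
move=> /(_ Hi) H; rewrite (nth_map a) -?cardE //.
have -> : nth a (enum T) i = enum_val (Ordinal Hi) by rewrite (enum_val_nth a).
by rewrite H.
Qed.

(** The ranks of the enumerated elements are 0, 1, and so on, so the cardinality alone determines
    the encoded enumeration. *)
Lemma PT_enum A (I : A -> data) (B : A -> finType) :
  PT I (fun x => enc_nat #|B x|) -> PT I (fun x => enc_seq (@enc_elt (B x)) (enum (B x))).
Proof.
move=> /PT_iota; apply: PT_ext => x; rewrite -ranks_iota enc_seq_map.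
by apply: eq_enc_seq.
Qed.

Lemma PT_enum_ord A (I : A -> data) (n : A -> nat) :
  PT I (fun x => enc_nat (n x)) ->
  PT I (fun x => enc_seq (fun i : 'I_(n x) => enc_nat i) (enum 'I_(n x))).
Proof.
by move=> /PT_iota; apply: PT_ext => x; rewrite -val_enum_ord enc_seq_map.
Qed.

Lemma PT_eq_elt A (I : A -> data) (B : A -> finType) (a b : forall x, B x) :
  PT I (fun x => enc_elt (a x)) -> PT I (fun x => enc_elt (b x)) ->
  PT I (fun x => enc_bool (a x == b x)).
Proof.
move=> Ha Hb; apply: PT_ext (PT_eqn Ha Hb) => x; congr (enc_bool _).
by apply/eqP/eqP => [/val_inj/enum_rank_inj|->].
Qed.

Fixpoint tails (T : Type) (l : seq T) : seq (T * seq T) :=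
  if l is a :: l' then (a, l') :: tails l' else [::].

(** The encoding of an element paired with the list behind it is literally the encoding of the
    suffix that it heads, so iterated tails suffice. *)
Lemma PT_tails A (I : A -> data) (B : A -> Type) (e : forall x, B x -> data)
    (l : forall x, seq (B x)) :
  PT I (fun x => enc_seq (@e x) (l x)) ->
  PT I (fun x => enc_seq (fun t => Node (e x t.1) (enc_seq (@e x) t.2)) (tails (l x))).
Proof.
move=> Hl.
apply: (@PT_ext _ _ (fun x => enc_seq (fun i => iter i tl (enc_seq (@e x) (l x)))
          (iota 0 (size (l x))))).
  move=> x; elim: (l x) => //= a l' <-; congr Node.
  rewrite -[1]addn0 iotaDl enc_seq_map; apply: eq_enc_seq => i.
  by rewrite iterD /= -iterS iterSr.
apply: (@PT_map _ I (fun=> nat) (fun _ => enc_nat) (fun x => iota 0 (size (l x)))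
   (fun x i => iter i tl (enc_seq (@e x) (l x)))).
  exact/PT_iota/PT_size_seq/Hl.
apply: PT_iter_tl; last exact: (PT_lift _ Hl).
exact: (PT_here I (fun _ => enc_nat)).
Qed.

Lemma PT_flatten_map A (I : A -> data) (B C : A -> Type) (e : forall x, B x -> data)
    (eC : forall x, C x -> data) (s : forall x, seq (B x)) (f : forall x, B x -> seq (C x)) :
  PT I (fun x => enc_seq (@e x) (s x)) ->
  PT (ctx I e) (fun y => enc_seq (@eC (tag y)) (f (tag y) (tagged y))) ->
  PT I (fun x => enc_seq (@eC x) (flatten [seq f x b | b <- s x])).
Proof.
move=> Hs Hf; apply: PT_flatten.
apply: (@PT_ext _ _ (fun x => enc_seq (fun b => enc_seq (@eC x) (f x b)) (s x))).
  by move=> x; rewrite enc_seq_map.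
exact: (@PT_map _ I B e s (fun x b => enc_seq (@eC x) (f x b))).
Qed.

Lemma PT_seq_map A (I : A -> data) (B C : A -> Type) (e : forall x, B x -> data)
    (eC : forall x, C x -> data) (s : forall x, seq (B x)) (f : forall x, B x -> C x) :
  PT I (fun x => enc_seq (@e x) (s x)) ->
  PT (ctx I e) (fun y => eC (tag y) (f (tag y) (tagged y))) ->
  PT I (fun x => enc_seq (@eC x) [seq f x b | b <- s x]).
Proof.
move=> Hs Hf; apply: (@PT_ext _ _ (fun x => enc_seq (fun b => eC x (f x b)) (s x))).
  by move=> x; rewrite enc_seq_map.
exact: (@PT_map _ I B e s (fun x b => eC x (f x b))).
Qed.

Lemma PT_listing A (I : A -> data) (B : A -> finType) (e : forall x, B x -> data)
    (f : forall x, B x -> nat) :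
  PT I (fun x => enc_seq (@e x) (enum (B x))) ->
  PT (ctx I e) (fun y => enc_nat (f (tag y) (tagged y))) ->
  PT I (fun x => enc_seq (@e x) (listing (f x))).
Proof.
move=> Hs Hf; apply: (@PT_flatten_map _ I B B e e (fun x => enum (B x))
  (fun x b => nseq (f x b) b)) => //.
by apply: (@PT_nseq _ _ (fun y => B (tag y)) (fun y => @e (tag y))) => //; exact: PT_here.
Qed.

(** * Reading the components of an encoded object system *)

Section Components.
Variables (A : Type) (I : A -> data).

Lemma PT_card_place (N : A -> pn) : PT I (fun x => enc_pn (N x)) ->
  PT I (fun x => enc_nat #|place (N x)|).
Proof. exact: PT_hd. Qed.

Lemma PT_card_trans (N : A -> pn) : PT I (fun x => enc_pn (N x)) ->
  PT I (fun x => enc_nat #|trans (N x)|).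
Proof. by move=> H; exact: (PT_hd (PT_tl H)). Qed.

Lemma PT_arc_in (N : A -> pn) (p : forall x, place (N x)) (t : forall x, trans (N x)) :
  PT I (fun x => enc_pn (N x)) -> PT I (fun x => enc_elt (p x)) ->
  PT I (fun x => enc_elt (t x)) -> PT I (fun x => enc_nat (arc_in (p x) (t x))).
Proof.
move=> HN Hp Ht; have H := PT_hd (PT_tl (PT_tl HN)).
have H1 := @PT_table _ I (fun x => place (N x)) (fun x p => enc_table (fun t => enc_nat
    (arc_in p t))) p H Hp.
exact: (@PT_table _ I (fun x => trans (N x)) (fun x t => enc_nat (arc_in (p x) t)) t H1 Ht).
Qed.

Lemma PT_arc_out (N : A -> pn) (p : forall x, place (N x)) (t : forall x, trans (N x)) :
  PT I (fun x => enc_pn (N x)) -> PT I (fun x => enc_elt (p x)) ->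
  PT I (fun x => enc_elt (t x)) -> PT I (fun x => enc_nat (arc_out (t x) (p x))).
Proof.
move=> HN Hp Ht; have H := PT_hd (PT_tl (PT_tl (PT_tl HN))).
have H1 := @PT_table _ I (fun x => trans (N x)) (fun x t => enc_table (fun p => enc_nat
    (arc_out t p))) t H Ht.
exact: (@PT_table _ I (fun x => place (N x)) (fun x p => enc_nat (arc_out (t x) p)) p H1 Hp).
Qed.

Variables (Ef : A -> eos).
Hypothesis HE : PT I (fun x => enc_eos (Ef x)).

Lemma PT_sys : PT I (fun x => enc_pn (sys (Ef x))).
Proof. exact: (PT_hd HE). Qed.

Lemma PT_card_net : PT I (fun x => enc_nat #|net (Ef x)|).
Proof.
have H := PT_hd (PT_tl (PT_tl HE)).
apply: PT_ext (@PT_size_seq _ I (fun x => net (Ef x)) (fun x N => enc_pn (obj N)) (fun x =>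
    enum (net (Ef x))) H).
by move=> x; rewrite -cardE.
Qed.

Lemma PT_obj (N : forall x, net (Ef x)) : PT I (fun x => enc_elt (N x)) ->
  PT I (fun x => enc_pn (obj (N x))).
Proof.
have H := PT_hd (PT_tl (PT_tl HE)).
exact: (@PT_table _ I (fun x => net (Ef x)) (fun x N => enc_pn (obj N)) N H).
Qed.

Lemma PT_typ (p : forall x, place (sys (Ef x))) : PT I (fun x => enc_elt (p x)) ->
  PT I (fun x => enc_elt (typ (p x))).
Proof.
have H := PT_hd (PT_tl (PT_tl (PT_tl (PT_tl HE)))).
exact: (@PT_table _ I (fun x => place (sys (Ef x))) (fun x p => enc_elt (typ p)) p H).
Qed.

Lemma PT_events : PT I (fun x => enc_seq (@enc_event (Ef x)) (events (Ef x))).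
Proof. exact: (PT_hd (PT_tl (PT_tl (PT_tl (PT_tl (PT_tl HE)))))). Qed.

End Components.

Lemma enum_sigT (T : finType) (U : T -> finType) :
  enum {: {t : T & U t}} = flatten [seq [seq Tagged (fun t => U t) u | u <- enum
      (U t)] | t <- enum T].
Proof.
rewrite !enumT {1}unlock /= /tag_enum; congr flatten; apply: eq_map => t.
by rewrite enumT.
Qed.

(** During the computation a dependent pair is kept as two ranks, which makes both components
    directly accessible; its single rank is not. *)
Definition enc_pair (T : finType) (U : T -> finType) (c : {t : T & U t}) : data :=
  Node (enc_elt (tag c)) (enc_elt (tagged c)).

Lemma PT_enum_sigT A (I : A -> data) (T : A -> finType) (U : forall x, T x -> finType) :
  PT I (fun x => enc_nat #|T x|) ->
  PT (ctx I (fun x => @enc_elt (T x))) (fun y => enc_nat #|U (tag y) (tagged y)|) ->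
  PT I (fun x => enc_seq (@enc_pair (T x) (U x)) (enum {: {t : T x & U x t}})).
Proof.
move=> HT HU.
apply: (@PT_ext _ _ (fun x => enc_seq (@enc_pair (T x) (U x))
  (flatten [seq [seq Tagged (fun t => U x t) u | u <- enum (U x t)] | t <- enum (T x)]))).
  by move=> x; rewrite enum_sigT.
apply: (@PT_flatten_map _ I (fun x => T x) (fun x => {t : T x & U x t})
  (fun x => @enc_elt (T x)) (fun x => @enc_pair (T x) (U x)) (fun x => enum (T x))
  (fun x t => [seq Tagged (fun t => U x t) u | u <- enum (U x t)])).
  exact: PT_enum.
apply: (@PT_seq_map _ _ (fun y => U (tag y) (tagged y)) (fun y => {t : T (tag y) & U (tag y) t})
  (fun y => @enc_elt (U (tag y) (tagged y))) (fun y => @enc_pair (T (tag y)) (U (tag y)))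
  (fun y => enum (U (tag y) (tagged y))) (fun y u => Tagged (fun t => U (tag y) t) u)).
  exact: PT_enum.
apply: PT_node; last exact: PT_here.
exact: (PT_lift _ (PT_here I (fun x => @enc_elt (T x)))).
Qed.

(** A symbolic code, used instead of the rank while the descriptions are built: it can be formed
    locally and compared by numbers. Ranks appear only in the final output. *)
Definition qcode (E : eos) (q : qplace E) : nat * nat * nat :=
  match q with
  | inl (inl p) => (0, nat_of_ord (enum_rank p), 0)
  | inl (inr c) => (1, nat_of_ord (enum_rank (tag c)), nat_of_ord (enum_rank (tagged c)))
  | inr (inl b) => (2, nat_of_ord (enum_rank (tag b)), nat_of_ord (enum_rank (tagged b)))
  | inr (inr _) => (3, 0, 0)
  end.

Lemma rank_inj (T : finType) (a b : T) :
  nat_of_ord (enum_rank a) = nat_of_ord (enum_rank b) -> a = b.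
Proof. by move/val_inj/enum_rank_inj. Qed.

Lemma qcode_inj (E : eos) : injective (@qcode E).
Proof.
move=> [[p|[p q]]|[[N q]|[]]] [[p'|[p' q']]|[[N' q']|[]]] //= [].
- by move/rank_inj ->.
- by move/rank_inj => Ep; subst p' => /rank_inj ->.
- by move/rank_inj => Ep; subst N' => /rank_inj ->.
Qed.

Definition enc_q (E : eos) (q : qplace E) : data :=
  Node (enc_nat (qcode q).1.1) (Node (enc_nat (qcode q).1.2) (enc_nat (qcode q).2)).

Definition enc_mv (E : eos) (m : qplace E * qplace E) : data :=
  Node (enc_q m.1) (enc_q m.2).

Definition enc_desc (E : eos) (d : desc (qplace E)) : data :=
  enc_list [:: enc_nat (src d); enc_nat (dst d);
    enc_seq (@enc_q E) (in0 d); enc_seq (@enc_q E) (in1 d);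
    enc_seq (@enc_q E) (out0 d); enc_seq (@enc_q E) (out1 d); enc_seq (@enc_q E) (new d);
    enc_seq (@enc_mv E) (mv10 d); enc_seq (@enc_mv E) (mv01 d)].

(* An instruction is represented by its transitions for s = 1, in which the
   control states 0, s and s.+1 are numbered 0, 1 and 2. *)
Definition enc_op (E : eos) (o : op E) : data := enc_seq (@enc_desc E) (descs_of (1, o)).

(** Sends the states 0, 1, 2 of the representative to 0, [s], [s.+1]. *)
Definition restate (s n : nat) : nat := if n is n'.+1 then s + n' else 0.

Definition instance (E : eos) (s : nat) (d : desc (qplace E)) : desc (qplace E) :=
  Desc (restate s (src d)) (restate s (dst d)) (in0 d) (in1 d) (out0 d) (out1 d) (new d)
       (mv10 d) (mv01 d).

Lemma descs_of_instance (E : eos) s (o : op E) :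
  descs_of (s, o) = [seq instance s d | d <- descs_of (1, o)].
Proof. by case: o => //= *; rewrite /instance /= ?addn0 ?addn1. Qed.

Lemma linesE (E : eos) (l : seq (op E)) : lines l = [seq (size t.2, t.1) | t <- tails l].
Proof. by elim: l => //= o l ->. Qed.

(** The flag of [Close] depends on the places behind the current one. Pairing each place with its
    suffix turns the recursion of [posts] into a map. *)
Definition post_block (E : eos) (t : place (sys E) * seq (place (sys E))) : seq (op E) :=
  Create t.1 :: fills t.1 ++ [:: Close t.1 (typ t.1 \notin [seq typ p | p <- t.2])].

Lemma postsE (E : eos) (l : seq (place (sys E))) :
  posts l = flatten [seq post_block t | t <- tails l].
Proof. by elim: l => //= p l ->; rewrite -catA. Qed.

Lemma PT_eq_q A (I : A -> data) (Ef : A -> eos) (a b : forall x, qplace (Ef x)) :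
  PT I (fun x => enc_q (a x)) -> PT I (fun x => enc_q (b x)) ->
  PT I (fun x => enc_bool (a x == b x)).
Proof.
move=> Ha Hb.
have H1 := PT_eqn (m := fun x => (qcode (a x)).1.1) (n := fun x => (qcode (b x)).1.1)
    (PT_hd Ha) (PT_hd Hb).
have H2 := PT_eqn (m := fun x => (qcode (a x)).1.2) (n := fun x => (qcode (b x)).1.2)
   (PT_hd (PT_tl Ha)) (PT_hd (PT_tl Hb)).
have H3 := PT_eqn (m := fun x => (qcode (a x)).2) (n := fun x => (qcode (b x)).2)
   (PT_tl (PT_tl Ha)) (PT_tl (PT_tl Hb)).
apply: PT_ext (PT_and H1 (PT_and H2 H3)) => x.
rewrite -(inj_eq (@qcode_inj (Ef x))); case: (qcode (a x)) (qcode (b x)) =>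
    [[t u] v] [[t' u'] v'].
by rewrite !xpair_eqE /= andbA.
Qed.

Section Places.
Variables (A : Type) (I : A -> data) (Ef : A -> eos).

Lemma PT_qid (p : forall x, place (sys (Ef x))) :
  PT I (fun x => enc_elt (p x)) -> PT I (fun x => enc_q (qid (p x))).
Proof.
move=> Hp; apply: PT_node; first exact: (PT_nat I 0).
by apply: PT_node => //; exact: (PT_nat I 0).
Qed.

Lemma PT_qcopy (c : forall x, copyT (Ef x)) :
  PT I (fun x => enc_pair (c x)) -> PT I (fun x => enc_q (qcopy (c x))).
Proof. by move=> Hc; apply: PT_node => //; exact: (PT_nat I 1). Qed.

Lemma PT_qbuf (b : forall x, bufT (Ef x)) :
  PT I (fun x => enc_pair (b x)) -> PT I (fun x => enc_q (qbuf (b x))).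
Proof. by move=> Hc; apply: PT_node => //; exact: (PT_nat I 2). Qed.

Lemma PT_qcur : PT I (fun x => enc_q (@qcur (Ef x))).
Proof.
apply: PT_node; first exact: (PT_nat I 3).
by apply: PT_node; exact: (PT_nat I 0).
Qed.
End Places.

Section Enum.
Variables (A : Type) (I : A -> data) (Ef : A -> eos).
Hypothesis HE : PT I (fun x => enc_eos (Ef x)).

Lemma PT_places : PT I (fun x => enc_seq (@enc_elt _) (enum (place (sys (Ef x))))).
Proof. exact/PT_enum/PT_card_place/PT_sys. Qed.

Lemma PT_obj_places (p : forall x, place (sys (Ef x))) : PT I (fun x => enc_elt (p x)) ->
  PT I (fun x => enc_seq (@enc_elt _) (enum (place (obj (typ (p x)))))).
Proof. by move=> Hp; apply/PT_enum/PT_card_place/PT_obj => //; exact: PT_typ. Qed.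

Lemma PT_copies : PT I (fun x => enc_seq (@enc_pair _ (fun p => place (obj (typ p))))
                          (enum {: copyT (Ef x)})).
Proof.
apply: (@PT_enum_sigT _ I (fun x => place (sys (Ef x))) (fun x p => place (obj (typ p)))).
  exact/PT_card_place/PT_sys.
apply: PT_card_place; apply: (@PT_obj _ _ (fun y => Ef (tag y))); first exact: (PT_lift _ HE).
by apply: PT_typ; [exact: (PT_lift _ HE) | exact: PT_here].
Qed.

Lemma PT_bufs : PT I (fun x => enc_seq (@enc_pair _ (fun N => place (obj N)))
                          (enum {: bufT (Ef x)})).
Proof.
apply: (@PT_enum_sigT _ I (fun x => net (Ef x)) (fun x N => place (obj N))).
  exact/PT_card_net.
apply: PT_card_place; apply: (@PT_obj _ _ (fun y => Ef (tag y))); first exact: (PT_lift _ HE).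
exact: PT_here.
Qed.

(** The order has to be that of the finite type, because the tables of the encoded net follow it. *)
Lemma PT_enum_q : PT I (fun x => enc_seq (@enc_q (Ef x)) (enum {: qplace (Ef x)})).
Proof.
apply: (@PT_ext _ _ (fun x => enc_seq (@enc_q (Ef x))
   (([seq qid p | p <- enum (place (sys (Ef x)))] ++ [seq qcopy c | c <- enum {: copyT
       (Ef x)}]) ++
    ([seq qbuf b | b <- enum {: bufT (Ef x)}] ++ [:: qcur])))).
  move=> x; congr enc_seq;
      rewrite enum_sum [enum {: _ + copyT _}]enum_sum [enum {: _ + unit}]enum_sum.
  rewrite !map_cat -!(map_comp inl) -!(map_comp inr); congr (_ ++ (_ ++ _));
    by rewrite enumT unlock.
apply: (@PT_cat _ I (fun x => qplace (Ef x)) (fun x => @enc_q (Ef x)));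
  apply: (@PT_cat _ I (fun x => qplace (Ef x)) (fun x => @enc_q (Ef x))).
- apply: (@PT_seq_map _ I (fun x => place (sys (Ef x))) (fun x => qplace (Ef x)) (fun x =>
    @enc_elt _)
     (fun x => @enc_q (Ef x)) (fun x => enum (place (sys (Ef x)))) (fun x p => qid p)).
    exact: PT_places.
  by apply: (@PT_qid _ _ (fun y => Ef (tag y))); exact: PT_here.
- apply: (@PT_seq_map _ I (fun x => copyT (Ef x)) (fun x => qplace (Ef x)) (fun x =>
    @enc_pair _ _)
     (fun x => @enc_q (Ef x)) (fun x => enum {: copyT (Ef x)}) (fun x c => qcopy c)).
    exact: PT_copies.
  by apply: (@PT_qcopy _ _ (fun y => Ef (tag y))); exact: PT_here.
- apply: (@PT_seq_map _ I (fun x => bufT (Ef x)) (fun x => qplace (Ef x)) (fun x =>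
    @enc_pair _ _)
     (fun x => @enc_q (Ef x)) (fun x => enum {: bufT (Ef x)}) (fun x c => qbuf c)).
    exact: PT_bufs.
  by apply: (@PT_qbuf _ _ (fun y => Ef (tag y))); exact: PT_here.
- by apply: PT_node; [exact: (@PT_qcur _ _ Ef) | exact: PT_leaf].
Qed.

Lemma PT_moves (p : forall x, place (sys (Ef x))) : PT I (fun x => enc_elt (p x)) ->
  PT I (fun x => enc_seq (@enc_mv (Ef x)) (moves (p x))).
Proof.
move=> Hp; apply: (@PT_seq_map _ I (fun x => place (obj (typ (p x)))) _ (fun x => @enc_elt _)
     (fun x => @enc_mv (Ef x)) (fun x => enum (place (obj (typ (p x)))))
     (fun x q => (qcopy (copy_of q), qbuf (buf_of q)))).
  exact: PT_obj_places.
apply: PT_node.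
  apply: (@PT_qcopy _ _ (fun y => Ef (tag y)) (fun y => copy_of (tagged y))).
  by apply: PT_node; [exact: (PT_lift _ Hp) | exact: PT_here].
apply: (@PT_qbuf _ _ (fun y => Ef (tag y)) (fun y => buf_of (tagged y))).
by apply: PT_node; [exact: (PT_lift _ (PT_typ HE Hp)) | exact: PT_here].
Qed.

Lemma PT_swap_moves (p : forall x, place (sys (Ef x))) : PT I (fun x => enc_elt (p x)) ->
  PT I (fun x => enc_seq (@enc_mv (Ef x)) [seq swap m | m <- moves (p x)]).
Proof.
move=> Hp; apply: (@PT_seq_map _ I (fun x => (qplace (Ef x) * qplace (Ef x))%type) _
    (fun x => @enc_mv (Ef x))
     (fun x => @enc_mv (Ef x)) (fun x => moves (p x)) (fun x m => swap m)).
  exact: PT_moves.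
have H := PT_here I (fun x => @enc_mv (Ef x)).
by apply: PT_node; [exact: (PT_tl H) | exact: (PT_hd H)].
Qed.
End Enum.

(** * Computing the instructions, the program and the transitions *)

Section Ops.
Variables (A : Type) (I : A -> data) (Ef : A -> eos).

Lemma PT_Desc (s s' : A -> nat) (i0 i1 o0 o1 nw : forall x, seq (qplace (Ef x)))
    (m10 m01 : forall x, seq (qplace (Ef x) * qplace (Ef x))) :
  PT I (fun x => enc_nat (s x)) -> PT I (fun x => enc_nat (s' x)) ->
  PT I (fun x => enc_seq (@enc_q _) (i0 x)) -> PT I (fun x => enc_seq (@enc_q _) (i1 x)) ->
  PT I (fun x => enc_seq (@enc_q _) (o0 x)) -> PT I (fun x => enc_seq (@enc_q _) (o1 x)) ->
  PT I (fun x => enc_seq (@enc_q _) (nw x)) ->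
  PT I (fun x => enc_seq (@enc_mv _) (m10 x)) -> PT I (fun x => enc_seq (@enc_mv _) (m01 x)) ->
  PT I (fun x => enc_desc (Desc (s x) (s' x) (i0 x) (i1 x) (o0 x) (o1 x) (nw x) (m10 x)
      (m01 x))).
Proof. by move=> *; do 9! [apply: PT_node => //]; exact: PT_leaf. Qed.

Lemma PT_seq1 (B : A -> Type) (e : forall x, B x -> data) (b : forall x, B x) :
  PT I (fun x => e x (b x)) -> PT I (fun x => enc_seq (@e x) [:: b x]).
Proof. by move=> H; apply: PT_node => //; exact: PT_leaf. Qed.

Lemma PT_op_jump s s' : PT I (fun x => enc_seq (@enc_desc (Ef x))
   [:: Desc s s' [::] [::] [::] [::] [::] [::] [::]]).
Proof.
apply: (@PT_seq1 _ (fun x => @enc_desc (Ef x))); apply: (@PT_Desc (fun=> s) (fun=> s'));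
  solve [exact: PT_nat | exact: PT_leaf].
Qed.

Lemma PT_op_sub (b : forall x, bufT (Ef x)) : PT I (fun x => enc_pair (b x)) ->
  PT I (fun x => enc_op (Sub (b x))).
Proof.
move=> Hb; apply: (@PT_seq1 _ (fun x => @enc_desc (Ef x))).
apply: (@PT_Desc (fun=> 2) (fun=> 1) (fun x => [:: qbuf (b x)]));
    try solve [exact: PT_nat | exact: PT_leaf].
by apply: (@PT_seq1 _ (fun x => @enc_q (Ef x))); exact: PT_qbuf.
Qed.

Lemma PT_op_add (b : forall x, bufT (Ef x)) : PT I (fun x => enc_pair (b x)) ->
  PT I (fun x => enc_op (Add (b x))).
Proof.
move=> Hb; apply: (@PT_seq1 _ (fun x => @enc_desc (Ef x))).
apply: (@PT_Desc (fun=> 2) (fun=> 1) _ _ (fun x => [:: qbuf (b x)]));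
    try solve [exact: PT_nat | exact: PT_leaf].
by apply: (@PT_seq1 _ (fun x => @enc_q (Ef x))); exact: PT_qbuf.
Qed.

Lemma PT_op_create (p : forall x, place (sys (Ef x))) : PT I (fun x => enc_op (Create (p x))).
Proof.
apply: (@PT_seq1 _ (fun x => @enc_desc (Ef x))).
apply: (@PT_Desc (fun=> 2) (fun=> 1) _ _ _ _ (fun x => [:: qcur]));
    try solve [exact: PT_nat | exact: PT_leaf].
by apply: (@PT_seq1 _ (fun x => @enc_q (Ef x))); exact: PT_qcur.
Qed.

Hypothesis HE : PT I (fun x => enc_eos (Ef x)).

Lemma PT_op_take (p : forall x, place (sys (Ef x))) : PT I (fun x => enc_elt (p x)) ->
  PT I (fun x => enc_op (Take (p x))).
Proof.
move=> Hp; apply: (@PT_seq1 _ (fun x => @enc_desc (Ef x))).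
apply: (@PT_Desc (fun=> 2) (fun=> 1) _ (fun x => [:: qid (p x)]));
    try solve [exact: PT_nat | exact: PT_leaf].
  by apply: (@PT_seq1 _ (fun x => @enc_q (Ef x))); exact: PT_qid.
exact: PT_moves.
Qed.

Lemma PT_op_close (p : forall x, place (sys (Ef x))) (l : A -> bool) :
  PT I (fun x => enc_elt (p x)) -> PT I (fun x => enc_bool (l x)) ->
  PT I (fun x => enc_op (Close (p x) (l x))).
Proof.
move=> Hp Hl; apply: (@PT_seq1 _ (fun x => @enc_desc (Ef x))).
apply: (@PT_Desc (fun=> 2) (fun=> 1) _ (fun x => [:: qcur]) _ (fun x => [:: qid (p x)]));
  try solve [exact: PT_nat | exact: PT_leaf].
- by apply: (@PT_seq1 _ (fun x => @enc_q (Ef x))); exact: PT_qcur.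
- by apply: (@PT_seq1 _ (fun x => @enc_q (Ef x))); exact: PT_qid.
- apply: PT_ext (PT_if Hl (PT_swap_moves HE Hp) (PT_leaf I)) => x.
  by case: (l x).
Qed.

Lemma PT_op_fill (p : forall x, place (sys (Ef x))) (q : forall x, place (obj (typ (p x)))) :
  PT I (fun x => enc_elt (p x)) -> PT I (fun x => enc_elt (q x)) ->
  PT I (fun x => enc_op (Fill (copy_of (q x)))).
Proof.
move=> Hp Hq; apply: PT_node; last exact: PT_op_jump.
apply: (@PT_Desc (fun=> 2) (fun=> 2) (fun x => [:: qbuf (buf_of (q x))]) (fun x => [:: qcur]) _
   (fun x => [:: qcur; qcopy (copy_of (q x))])); try solve [exact: PT_nat | exact: PT_leaf].
- apply: (@PT_seq1 _ (fun x => @enc_q (Ef x))); apply: PT_qbuf.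
  by apply: PT_node => //; exact: PT_typ.
- by apply: (@PT_seq1 _ (fun x => @enc_q (Ef x))); exact: PT_qcur.
- apply: PT_node; first exact: PT_qcur.
  by apply: (@PT_seq1 _ (fun x => @enc_q (Ef x))); apply: PT_qcopy; apply: PT_node.
Qed.
End Ops.

Section Events.
Variables (A : Type) (I : A -> data) (Ef : A -> eos).
Hypothesis HE : PT I (fun x => enc_eos (Ef x)).
Variable ev : forall x, event (Ef x).
Hypothesis Hev : PT I (fun x => enc_event (ev x)).

Lemma PT_theta (N : forall x, net (Ef x)) (t : forall x, trans (obj (N x))) :
  PT I (fun x => enc_elt (N x)) -> PT I (fun x => enc_elt (t x)) ->
  PT I (fun x => enc_nat ((ev x).2 (N x) (t x))).
Proof.
move=> HN Ht; have H := PT_tl Hev.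
have H1 := @PT_table _ I (fun x => net (Ef x)) (fun x N => enc_table (fun t => enc_nat
    ((ev x).2 N t))) N H HN.
exact: (@PT_table _ I (fun x => trans (obj (N x))) (fun x t => enc_nat ((ev x).2
    (N x) t)) t H1 Ht).
Qed.

Lemma PT_trans_elts (N : forall x, net (Ef x)) : PT I (fun x => enc_elt (N x)) ->
  PT I (fun x => enc_seq (@enc_elt _) (enum (trans (obj (N x))))).
Proof. by move=> HN; apply/PT_enum/PT_card_trans/PT_obj. Qed.

End Events.

Section EventLists.
Variables (A : Type) (I : A -> data) (Ef : A -> eos).
Hypothesis HE : PT I (fun x => enc_eos (Ef x)).
Variable ev : forall x, event (Ef x).
Hypothesis Hev : PT I (fun x => enc_event (ev x)).

Lemma PT_preb (b : forall x, bufT (Ef x)) : PT I (fun x => enc_pair (b x)) ->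
  PT I (fun x => enc_nat (preb (ev x) (b x))).
Proof.
move=> Hb; have HN := PT_hd Hb; have Hq := PT_tl Hb.
apply: (@PT_ext _ _ (fun x => enc_nat (\sum_(t <- enum (trans (obj (tag (b x)))))
    (ev x).2 (tag (b x)) t * arc_in (tagged (b x)) t))).
  move=> x; rewrite /preb ffunE big_enum; congr enc_nat; apply: eq_bigr => t _.
  by rewrite ffunE.
apply: (@PT_sum _ I (fun x => trans (obj (tag (b x)))) (fun x => @enc_elt _)
   (fun x => enum (trans (obj (tag (b x))))) (fun x t => (ev x).2 (tag (b x)) t * arc_in
       (tagged (b x)) t)).
  exact: PT_trans_elts.
apply: PT_mul.
  apply: (@PT_theta _ _ (fun y => Ef (tag y)) (fun y => ev (tag y)) _ (fun y => tag (b (tag y)))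
      (fun y => tagged y)); [exact: (PT_lift _ Hev) | exact: (PT_lift _ HN) | exact: PT_here].
apply: (@PT_arc_in _ _ (fun y => obj (tag (b (tag y)))) (fun y => tagged (b (tag y)))
    (fun y => tagged y));
  [exact: (PT_lift _ (PT_obj HE HN)) | exact: (PT_lift _ Hq) | exact: PT_here].
Qed.

Lemma PT_postb (b : forall x, bufT (Ef x)) : PT I (fun x => enc_pair (b x)) ->
  PT I (fun x => enc_nat (postb (ev x) (b x))).
Proof.
move=> Hb; have HN := PT_hd Hb; have Hq := PT_tl Hb.
apply: (@PT_ext _ _ (fun x => enc_nat (\sum_(t <- enum (trans (obj (tag (b x)))))
    (ev x).2 (tag (b x)) t * arc_out t (tagged (b x))))).
  move=> x; rewrite /postb ffunE big_enum; congr enc_nat; apply: eq_bigr => t _.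
  by rewrite ffunE.
apply: (@PT_sum _ I (fun x => trans (obj (tag (b x)))) (fun x => @enc_elt _)
   (fun x => enum (trans (obj (tag (b x))))) (fun x t => (ev x).2 (tag (b x)) t * arc_out t
       (tagged (b x)))).
  exact: PT_trans_elts.
apply: PT_mul.
  apply: (@PT_theta _ _ (fun y => Ef (tag y)) (fun y => ev (tag y)) _ (fun y => tag (b (tag y)))
      (fun y => tagged y)); [exact: (PT_lift _ Hev) | exact: (PT_lift _ HN) | exact: PT_here].
apply: (@PT_arc_out _ _ (fun y => obj (tag (b (tag y)))) (fun y => tagged (b (tag y)))
    (fun y => tagged y));
  [exact: (PT_lift _ (PT_obj HE HN)) | exact: (PT_lift _ Hq) | exact: PT_here].
Qed.

Lemma PT_pre_list : PT I (fun x => enc_seq (@enc_elt _) (listing (pre (ev x).1))).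
Proof.
apply: (@PT_listing _ I (fun x => place (sys (Ef x))) (fun x => @enc_elt _) (fun x => pre
    (ev x).1)).
  exact: PT_places.
apply: (@PT_ext _ _ (fun y => enc_nat (arc_in (tagged y) (ev (tag y)).1))).
  by move=> y; rewrite ffunE.
apply: (@PT_arc_in _ _ (fun y => sys (Ef (tag y))) (fun y => tagged y) (fun y => (ev
    (tag y)).1));
  [exact: (PT_lift _ (PT_sys HE)) | exact: PT_here | exact: (PT_lift _ (PT_hd Hev))].
Qed.

Lemma PT_post_list : PT I (fun x => enc_seq (@enc_elt _) (listing (post (ev x).1))).
Proof.
apply: (@PT_listing _ I (fun x => place (sys (Ef x))) (fun x => @enc_elt _) (fun x => post
    (ev x).1)).
  exact: PT_places.
apply: (@PT_ext _ _ (fun y => enc_nat (arc_out (ev (tag y)).1 (tagged y)))).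
  by move=> y; rewrite ffunE.
apply: (@PT_arc_out _ _ (fun y => sys (Ef (tag y))) (fun y => tagged y) (fun y => (ev
    (tag y)).1));
  [exact: (PT_lift _ (PT_sys HE)) | exact: PT_here | exact: (PT_lift _ (PT_hd Hev))].
Qed.

Lemma PT_type_mem (N : forall x, net (Ef x)) (l : forall x, seq (place (sys (Ef x)))) :
  PT I (fun x => enc_elt (N x)) -> PT I (fun x => enc_seq (@enc_elt _) (l x)) ->
  PT I (fun x => enc_bool (N x \in [seq typ p | p <- l x])).
Proof.
move=> HN Hl; apply: (@PT_ext _ _ (fun x => enc_bool (has (fun p => typ p == N x) (l x)))).
  by move=> x; rewrite -has_pred1 has_map.
apply: (@PT_has _ I (fun x => place (sys (Ef x))) (fun x => @enc_elt _) l (fun x p =>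
    typ p == N x)) => //.
apply: (@PT_eq_elt _ _ (fun y => net (Ef (tag y))) (fun y => typ (tagged y)) (fun y => N
    (tag y))).
  by apply: PT_typ; [exact: (PT_lift _ HE) | exact: PT_here].
exact: (PT_lift _ HN).
Qed.

End EventLists.

Section Posts.
Variables (A : Type) (I : A -> data) (Ef : A -> eos).
Hypothesis HE : PT I (fun x => enc_eos (Ef x)).

Lemma PT_fills (p : forall x, place (sys (Ef x))) : PT I (fun x => enc_elt (p x)) ->
  PT I (fun x => enc_seq (@enc_op (Ef x)) (fills (p x))).
Proof.
move=> Hp; apply: (@PT_seq_map _ I (fun x => place (obj (typ (p x)))) _ (fun x => @enc_elt _)
     (fun x => @enc_op (Ef x)) (fun x => enum (place (obj (typ (p x)))))
     (fun x q => Fill (copy_of q))).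
  exact: PT_obj_places.
apply: (@PT_op_fill _ _ (fun y => Ef (tag y)) _ (fun y => p (tag y)) (fun y => tagged y));
  [exact: (PT_lift _ HE) | exact: (PT_lift _ Hp) | exact: PT_here].
Qed.

End Posts.

Lemma PT_posts A (I : A -> data) (Ef : A -> eos) (l : forall x, seq (place (sys (Ef x)))) :
  PT I (fun x => enc_eos (Ef x)) -> PT I (fun x => enc_seq (@enc_elt _) (l x)) ->
  PT I (fun x => enc_seq (@enc_op (Ef x)) (posts (l x))).
Proof.
move=> HE Hl; apply: (@PT_ext _ _ (fun x => enc_seq (@enc_op (Ef x))
    (flatten [seq post_block t | t <- tails (l x)]))).
  by move=> x; rewrite postsE.
pose e x (t : place (sys (Ef x)) * seq (place (sys (Ef x)))) :=
  Node (enc_elt t.1) (enc_seq (@enc_elt _) t.2).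
apply: (@PT_flatten_map _ I (fun x => (place (sys (Ef x)) * seq (place (sys (Ef x))))%type)
  (fun x => op (Ef x)) e
  (fun x => @enc_op (Ef x)) (fun x => tails (l x)) (fun x => @post_block (Ef x))).
  exact: (@PT_tails _ I (fun x => place (sys (Ef x))) (fun x => @enc_elt _)).
have H := PT_here I e; have Hp := PT_hd H; have Hr := PT_tl H.
have HE' := PT_lift e HE.
apply: PT_node; first exact: (@PT_op_create _ _ (fun y => Ef (tag y))).
apply: (@PT_cat _ _ (fun y => op (Ef (tag y))) (fun y => @enc_op (Ef (tag y)))).
  exact: (@PT_fills _ _ (fun y => Ef (tag y)) HE' (fun y => (tagged y).1)).
apply: (@PT_seq1 _ _ _ (fun y => @enc_op (Ef (tag y)))).
apply: (@PT_op_close _ _ (fun y => Ef (tag y)) HE' (fun y => (tagged y).1)) => //.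
apply: PT_not; apply: (@PT_type_mem _ _ (fun y => Ef (tag y)) HE' (fun y => typ (tagged y).1)
    (fun y => (tagged y).2)) => //.
exact: (@PT_typ _ _ (fun y => Ef (tag y)) HE' (fun y => (tagged y).1)).
Qed.

Lemma PT_evops A (I : A -> data) (Ef : A -> eos) (ev : forall x, event (Ef x)) :
  PT I (fun x => enc_eos (Ef x)) -> PT I (fun x => enc_event (ev x)) ->
  PT I (fun x => enc_seq (@enc_op (Ef x)) (evops (ev x))).
Proof.
move=> HE Hev; apply: (@PT_cat _ _ (fun x => op (Ef x)) (fun x => @enc_op (Ef x)));
  last apply: (@PT_cat _ _ (fun x => op (Ef x)) (fun x => @enc_op (Ef x)));
  last apply: (@PT_cat _ _ (fun x => op (Ef x)) (fun x => @enc_op (Ef x))).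
- apply: (@PT_seq_map _ I (fun x => place (sys (Ef x))) (fun x => op (Ef x)) (fun x =>
    @enc_elt _)
     (fun x => @enc_op (Ef x)) (fun x => listing (pre (ev x).1)) (fun x p => Take p)).
    exact: PT_pre_list.
  by apply: (@PT_op_take _ _ (fun y => Ef (tag y))); [exact: (PT_lift _ HE) | exact: PT_here].
- apply: (@PT_seq_map _ I (fun x => bufT (Ef x)) (fun x => op (Ef x)) (fun x => @enc_pair _ _)
     (fun x => @enc_op (Ef x)) (fun x => listing (preb (ev x))) (fun x b => Sub b)).
    apply: (@PT_listing _ I (fun x => {: bufT (Ef x)}) (fun x => @enc_pair _ _) (fun x =>
        preb (ev x))).
      exact: PT_bufs.
    by apply: (@PT_preb _ _ (fun y => Ef (tag y)) _ (fun y => ev (tag y)));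
      [exact: (PT_lift _ HE) | exact: (PT_lift _ Hev) | exact: PT_here].
  by apply: (@PT_op_sub _ _ (fun y => Ef (tag y))); exact: PT_here.
- apply: (@PT_seq_map _ I (fun x => bufT (Ef x)) (fun x => op (Ef x)) (fun x => @enc_pair _ _)
     (fun x => @enc_op (Ef x)) (fun x => listing (postb (ev x)))
     (fun x b => add_or_block (listing (post (ev x).1)) b)).
    apply: (@PT_listing _ I (fun x => {: bufT (Ef x)}) (fun x => @enc_pair _ _) (fun x =>
        postb (ev x))).
      exact: PT_bufs.
    by apply: (@PT_postb _ _ (fun y => Ef (tag y)) _ (fun y => ev (tag y)));
      [exact: (PT_lift _ HE) | exact: (PT_lift _ Hev) | exact: PT_here].
  have H := PT_here I (fun x => @enc_pair _ (fun N : net (Ef x) => place (obj N))).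
  apply: (@PT_ext _ _ (fun y => if tag (tagged y) \in [seq typ p | p <- listing (post (ev
      (tag y)).1)]
     then enc_op (Add (tagged y)) else enc_op (Sub (tagged y)))).
    by move=> y; rewrite /add_or_block; case: ifP.
  apply: PT_if.
  + apply: (@PT_type_mem _ _ (fun y => Ef (tag y)) _ (fun y => tag (tagged y))
        (fun y => listing (post (ev (tag y)).1))).
    * exact: (PT_lift _ HE).
    * exact: (PT_hd H).
    * exact: (PT_lift _ (PT_post_list HE Hev)).
  + exact: (@PT_op_add _ _ (fun y => Ef (tag y))).
  + exact: (@PT_op_sub _ _ (fun y => Ef (tag y))).
- by apply: PT_posts => //; exact: PT_post_list.
Qed.

Lemma PT_prog A (I : A -> data) (Ef : A -> eos) :
  PT I (fun x => enc_eos (Ef x)) -> PT I (fun x => enc_seq (@enc_op (Ef x)) (prog (Ef x))).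
Proof.
move=> HE; apply: (@PT_flatten_map _ I (fun x => event (Ef x)) (fun x => op (Ef x))
  (fun x => @enc_event (Ef x)) (fun x => @enc_op (Ef x)) (fun x => events (Ef x))
  (fun x ev => Start :: rcons (evops ev) Stop)).
  exact: PT_events.
apply: (@PT_ext _ _ (fun y => enc_seq (@enc_op (Ef (tag y))) (Start :: evops
    (tagged y) ++ [:: Stop]))).
  by move=> y; rewrite cats1.
apply: PT_node; first exact: (@PT_op_jump _ _ (fun y => Ef (tag y)) 0 1).
apply: (@PT_cat _ _ (fun y => op (Ef (tag y))) (fun y => @enc_op (Ef (tag y)))).
  by apply: (@PT_evops _ _ (fun y => Ef (tag y))); [exact: (PT_lift _ HE) | exact: PT_here].
apply: (@PT_seq1 _ _ _ (fun y => @enc_op (Ef (tag y)))).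
exact: (@PT_op_jump _ _ (fun y => Ef (tag y)) 2 0).
Qed.

Lemma PT_restate A (I : A -> data) (s n : A -> nat) :
  PT I (fun x => enc_nat (s x)) -> PT I (fun x => enc_nat (n x)) ->
  PT I (fun x => enc_nat (restate (s x) (n x))).
Proof.
move=> Hs Hn; have H1 : PT I (fun x => enc_nat (n x).-1).
  by apply: PT_ext (PT_tl Hn) => x; case: (n x).
by apply: PT_ext (PT_case Hn (PT_leaf I) (PT_add Hs H1)) => x; case: (n x).
Qed.

Lemma PT_descs A (I : A -> data) (Ef : A -> eos) :
  PT I (fun x => enc_eos (Ef x)) -> PT I (fun x => enc_seq (@enc_desc (Ef x)) (descs (Ef x))).
Proof.
move=> HE; pose el (E : eos) (l : nat * op E) := Node (enc_nat l.1) (enc_op l.2).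
apply: (@PT_flatten_map _ I (fun x => (nat * op (Ef x))%type) _
  (fun x => @el (Ef x)) (fun x => @enc_desc (Ef x)) (fun x => lines (prog (Ef x)))
  (fun x => @descs_of (Ef x))).
  apply: (@PT_ext _ _ (fun x => enc_seq (@el (Ef x)) [seq (size t.2, t.1) | t <- tails (prog
      (Ef x))])).
    by move=> x; rewrite linesE.
  pose et x (t : op (Ef x) * seq (op (Ef x))) := Node (enc_op t.1) (enc_seq (@enc_op _) t.2).
  apply: (@PT_seq_map _ I (fun x => (op (Ef x) * seq (op (Ef x)))%type) _ et (fun x => @el
      (Ef x))
    (fun x => tails (prog (Ef x))) (fun x t => (size t.2, t.1))).
    by apply: (@PT_tails _ I (fun x => op (Ef x)) (fun x => @enc_op (Ef x))); exact: PT_prog.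
  have H := PT_here I et; apply: PT_node; last exact: (PT_hd H).
  exact: (@PT_size_seq _ _ _ (fun y => @enc_op (Ef (tag y))) (fun y => (tagged y).2) (PT_tl H)).
have H : PT (ctx I (fun x => @el (Ef x))) (fun y => el _ (tagged y)) := PT_here I (fun x =>
    @el (Ef x)).
apply: (@PT_ext _ _ (fun y => enc_seq (@enc_desc (Ef (tag y)))
   [seq instance (tagged y).1 d | d <- descs_of (1, (tagged y).2)])).
  by move=> [x [s o]]; rewrite [in RHS]descs_of_instance.
apply: (@PT_seq_map _ _ (fun y => desc (qplace (Ef (tag y)))) _ (fun y => @enc_desc (Ef
    (tag y)))
  (fun y => @enc_desc (Ef (tag y))) (fun y => descs_of (1, (tagged y).2))
  (fun y d => instance (tagged y).1 d)).
  exact: (PT_tl H).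
pose e (y : {x : A & (nat * op (Ef x))%type}) := @enc_desc (Ef (tag y)).
have Hd := PT_here (ctx I (fun x => @el (Ef x))) e.
have Hs := PT_lift e (PT_hd H).
apply: PT_node; first exact: (@PT_restate _ _ (fun y => (tagged (tag y)).1) (fun y => src
    (tagged y)) Hs (PT_hd Hd)).
apply: PT_node; first exact: (@PT_restate _ _ (fun y => (tagged (tag y)).1) (fun y => dst
    (tagged y)) Hs (PT_hd (PT_tl Hd))).
exact: (PT_tl (PT_tl Hd)).
Qed.

(** * Computing the tables of the net and the layout *)

Lemma PT_sum_table A (I : A -> data) (Q R : A -> finType) (f : forall x, Q x + R x -> data) :
  PT I (fun x => enc_seq (fun q => f x (inl q)) (enum (Q x))) ->
  PT I (fun x => enc_seq (fun r => f x (inr r)) (enum (R x))) ->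
  PT I (fun x => enc_table (f x)).
Proof.
move=> H1 H2; apply: (@PT_ext _ _ (fun x => enc_seq id
   ([seq f x (inl q) | q <- enum (Q x)] ++ [seq f x (inr r) | r <- enum (R x)]))).
  move=> x; rewrite /enc_table enum_sum -[RHS](enc_seq_map id (f x)) map_cat.
  by rewrite -(map_comp _ inl) -(map_comp _ inr).
apply: (@PT_cat _ I (fun=> data) (fun _ => id)).
  by apply: PT_ext H1 => x; rewrite enc_seq_map.
by apply: PT_ext H2 => x; rewrite enc_seq_map.
Qed.

(** Transitions are positions in the list of descriptions, so a table over them is a map over that
    list. *)
Lemma enc_table_dnth (Q : finType) (ds : seq (desc Q)) (g : desc Q -> data) :
  enc_table (fun t => g (dnth (ds := ds) t)) = enc_seq g ds.
Proof.
transitivity (enc_seq g [seq tnth (in_tuple ds) t | t <- enum 'I_(size ds)]).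
  by rewrite enc_seq_map.
by rewrite map_tnth_enum.
Qed.

Section DescPrograms.
Variables (A : Type) (I : A -> data) (Ef : A -> eos) (n : A -> nat).
Variable d : forall x, desc (qplace (Ef x)).
Hypothesis Hd : PT I (fun x => enc_desc (d x)).
Local Notation pl x := (qplace (Ef x) + 'I_(n x).+1)%type.

Lemma PT_src : PT I (fun x => enc_nat (src (d x))).
Proof. exact: (PT_hd Hd). Qed.
Lemma PT_dst : PT I (fun x => enc_nat (dst (d x))).
Proof. exact: (PT_hd (PT_tl Hd)). Qed.
Lemma PT_in0 : PT I (fun x => enc_seq (@enc_q _) (in0 (d x))).
Proof. exact: (PT_hd (PT_tl (PT_tl Hd))). Qed.
Lemma PT_in1 : PT I (fun x => enc_seq (@enc_q _) (in1 (d x))).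
Proof. exact: (PT_hd (PT_tl (PT_tl (PT_tl Hd)))). Qed.
Lemma PT_out0 : PT I (fun x => enc_seq (@enc_q _) (out0 (d x))).
Proof. exact: (PT_hd (PT_tl (PT_tl (PT_tl (PT_tl Hd))))). Qed.
Lemma PT_out1 : PT I (fun x => enc_seq (@enc_q _) (out1 (d x))).
Proof. exact: (PT_hd (PT_tl (PT_tl (PT_tl (PT_tl (PT_tl Hd)))))). Qed.
Lemma PT_new : PT I (fun x => enc_seq (@enc_q _) (new (d x))).
Proof. exact: (PT_hd (PT_tl (PT_tl (PT_tl (PT_tl (PT_tl (PT_tl Hd))))))). Qed.
Lemma PT_mv10 : PT I (fun x => enc_seq (@enc_mv _) (mv10 (d x))).
Proof. exact: (PT_hd (PT_tl (PT_tl (PT_tl (PT_tl (PT_tl (PT_tl (PT_tl Hd)))))))). Qed.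
Lemma PT_mv01 : PT I (fun x => enc_seq (@enc_mv _) (mv01 (d x))).
Proof. exact: (PT_hd (PT_tl (PT_tl (PT_tl (PT_tl (PT_tl (PT_tl (PT_tl (PT_tl Hd))))))))). Qed.

Lemma PT_count_q (q : forall x, qplace (Ef x)) (l : forall x, seq (qplace (Ef x))) :
  PT I (fun x => enc_q (q x)) -> PT I (fun x => enc_seq (@enc_q _) (l x)) ->
  PT I (fun x => enc_nat (count_mem (q x) (l x))).
Proof.
move=> Hq Hl; apply: (@PT_count _ I (fun x => qplace (Ef x)) (fun x => @enc_q (Ef x)) l
  (fun x => pred1 (q x))) => //.
apply: (@PT_eq_q _ _ (fun y => Ef (tag y)) (fun y => tagged y) (fun y => q (tag y))).
  exact: PT_here.
exact: (PT_lift _ Hq).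
Qed.

Lemma PT_var (k : A -> nat) v : PT I (fun x => enc_nat (k x)) ->
  PT I (fun x => enc_seq enc_var (nseq (k x) v)).
Proof.
move=> Hk; apply: (@PT_nseq _ I (fun=> var) (fun _ => enc_var)) => //.
by case: v => i; apply: PT_node; exact: PT_nat.
Qed.

Lemma PT_arcs_in_q (q : forall x, qplace (Ef x)) : PT I (fun x => enc_q (q x)) ->
  PT I (fun x => enc_seq enc_var (darc_in (inl (q x) : pl x) (d x))).
Proof.
move=> Hq; apply: (@PT_cat _ I (fun=> var) (fun _ => enc_var)); apply: PT_var.
  exact: (PT_count_q Hq PT_in0).
exact: (PT_count_q Hq PT_in1).
Qed.

Lemma PT_arcs_in_pc (i : forall x, 'I_(n x).+1) : PT I (fun x => enc_nat (i x)) ->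
  PT I (fun x => enc_seq enc_var (darc_in (inr (i x) : pl x) (d x))).
Proof.
move=> Hi; apply: (@PT_cat _ I (fun=> var) (fun _ => enc_var)); apply: PT_var; last exact:
    (PT_nat I 0).
apply: PT_add; last exact: (PT_nat I 0).
exact: (PT_eqn Hi PT_src).
Qed.

Lemma PT_arcs_out_q (q : forall x, qplace (Ef x)) : PT I (fun x => enc_q (q x)) ->
  PT I (fun x => enc_seq enc_var (darc_out (d x) (inl (q x) : pl x))).
Proof.
move=> Hq; apply: (@PT_cat _ I (fun=> var) (fun _ => enc_var));
  last apply: (@PT_cat _ I (fun=> var) (fun _ => enc_var)); apply: PT_var.
- exact: (PT_count_q Hq PT_out1).
- exact: (PT_count_q Hq PT_new).
- exact: (PT_count_q Hq PT_out0).
Qed.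

Lemma PT_arcs_out_pc (i : forall x, 'I_(n x).+1) : PT I (fun x => enc_nat (i x)) ->
  PT I (fun x => enc_seq enc_var (darc_out (d x) (inr (i x) : pl x))).
Proof.
move=> Hi; apply: (@PT_cat _ I (fun=> var) (fun _ => enc_var));
  last apply: (@PT_cat _ I (fun=> var) (fun _ => enc_var)); apply: PT_var.
- exact: (PT_nat I 0).
- exact: (PT_nat I 0).
apply: PT_add; last exact: (PT_nat I 0).
exact: (PT_eqn Hi PT_dst).
Qed.

(** The value of [std_vars] by [std_varsE], as a function of the description alone, so that it can
    be computed without the net. *)
Definition dvars (Q : finType) (d : desc Q) : seq nat := if has1 d then [:: 1; 0] else [:: 0].

Lemma PT_dvars : PT I (fun x => enc_seq enc_nat (dvars (d x))).
Proof.
apply: (@PT_ext _ _ (fun x => if ~~ nilp (in1 (d x)) then enc_seq enc_nat [:: 1; 0]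
    else enc_seq enc_nat [:: 0])).
  by move=> x; rewrite /dvars /has1; case: (in1 (d x)).
apply: PT_if; first exact: (PT_not (PT_nilp PT_in1)).
  apply: PT_node; first exact: (PT_nat I 1).
  by apply: PT_node; [exact: (PT_nat I 0) | exact: PT_leaf].
by apply: PT_node; [exact: (PT_nat I 0) | exact: PT_leaf].
Qed.

Lemma PT_dchan_q (x y : A -> nat) (q q' : forall a, qplace (Ef a)) :
  PT I (fun a => enc_nat (x a)) -> PT I (fun a => enc_nat (y a)) ->
  PT I (fun a => enc_q (q a)) -> PT I (fun a => enc_q (q' a)) ->
  PT I (fun a => enc_bool (dchan (d a) (x a) (y a) (inl (q a) : pl a) (inl (q' a)))).
Proof.
move=> Hx Hy Hq Hq'.
pose mv a := if x a == 0 then mv01 (d a) else mv10 (d a).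
have Hmv : PT I (fun a => enc_seq (@enc_mv _) (mv a)).
  apply: PT_ext (PT_if (PT_eqn Hx (PT_nat I 0)) PT_mv01 PT_mv10) => a.
  by rewrite /mv; case: ifP.
pose e a := @enc_mv (Ef a).
have H1 : PT (ctx I e) (fun z => enc_bool ((tagged z).1 == q (tag z))).
  apply: (@PT_eq_q _ _ (fun z => Ef (tag z)) (fun z => (tagged z).1) (fun z => q (tag z))).
    exact: (PT_hd (PT_here I e)).
  exact: (PT_lift _ Hq).
have H2 : PT (ctx I e) (fun z => enc_bool ((tagged z).2 == q' (tag z))).
  apply: (@PT_eq_q _ _ (fun z => Ef (tag z)) (fun z => (tagged z).2) (fun z => q' (tag z))).
    exact: (PT_tl (PT_here I e)).
  exact: (PT_lift _ Hq').
apply: (@PT_ext _ _ (fun a => if x a == y a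
   then enc_bool ((q a == q' a) && ~~ has (fun m => m.1 == q a) (mv a))
   else enc_bool (has (fun m => (m.1 == q a) && (m.2 == q' a)) (mv a)))).
  move=> a; rewrite /= -/(mv a); case: ifP => _; congr enc_bool.
    congr (_ && ~~ _); rewrite -has_pred1 has_map; exact: eq_has.
  by rewrite -has_pred1; apply: eq_has => m; rewrite /= -xpair_eqE -surjective_pairing.
apply: PT_if; first exact: PT_eqn.
  apply: PT_and; first exact: PT_eq_q.
  apply: PT_not; exact: (@PT_has _ I _ e mv (fun a m => m.1 == q a)).
apply: (@PT_has _ I _ e mv (fun a m => (m.1 == q a) && (m.2 == q' a))) => //.
exact: PT_and.
Qed.

End DescPrograms.

Section Tables.
Variables (A : Type) (I : A -> data) (Ef : A -> eos) (n : A -> nat).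
Hypothesis HE : PT I (fun x => enc_eos (Ef x)).
Hypothesis Hn : PT I (fun x => enc_nat (n x)).
Local Notation pl x := (qplace (Ef x) + 'I_(n x).+1)%type.

(** Splits a table over all places into the symbolic places, handled through [enc_q], and the
    control states, handled as plain numbers. *)
Lemma PT_place_table (f : forall x, pl x -> data) :
  PT (ctx I (fun x => @enc_q (Ef x))) (fun y => f (tag y) (inl (tagged y))) ->
  PT (ctx I (fun x (i : 'I_(n x).+1) => enc_nat i)) (fun y => f (tag y) (inr (tagged y))) ->
  PT I (fun x => enc_table (f x)).
Proof.
move=> H1 H2; apply: (@PT_sum_table _ I (fun x => {: qplace (Ef x)}) (fun x =>
    {: 'I_(n x).+1})).
  exact: (@PT_map _ I _ (fun x => @enc_q (Ef x)) (fun x => enum {: qplace (Ef x)})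
     (fun x q => f x (inl q)) (PT_enum_q HE)).
apply: (@PT_map _ I _ (fun x (i : 'I_(n x).+1) => enc_nat i) (fun x => enum 'I_(n x).+1)
     (fun x i => f x (inr i))) => //.
exact/PT_enum_ord/PT_succ.
Qed.

End Tables.

Lemma PT_chan_table A (I : A -> data) (Ef : A -> eos) (n : A -> nat)
    (d : forall a, desc (qplace (Ef a))) (x y : A -> nat) :
  PT I (fun a => enc_eos (Ef a)) -> PT I (fun a => enc_nat (n a)) ->
  PT I (fun a => enc_desc (d a)) ->
  PT I (fun a => enc_nat (x a)) -> PT I (fun a => enc_nat (y a)) ->
  PT I (fun a => enc_table (fun w : qplace (Ef a) + 'I_(n a).+1 =>
     enc_table (fun w' => enc_bool (dchan (d a) (x a) (y a) w w')))).
Proof.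
move=> HE Hn Hd Hx Hy; apply: PT_place_table => //.
  set I' := ctx _ _; have Hq : PT I' (fun z => enc_q (tagged z)) := PT_here I _.
  apply: (@PT_place_table _ I' (fun z => Ef (tag z)) (fun z => n (tag z))
    (PT_lift _ HE) (PT_lift _ Hn)
    (fun z w' => enc_bool (dchan (d (tag z)) (x (tag z)) (y (tag z)) (inl (tagged z)) w'))).
    set I2 := ctx _ _.
    apply: (@PT_dchan_q _ I2 (fun z => Ef (tag (tag z))) (fun z => n (tag (tag z)))
      (fun z => d (tag (tag z))) _ (fun z => x (tag (tag z))) (fun z => y (tag (tag z)))
      (fun z => tagged (tag z)) (fun z => tagged z)).
    - exact: (PT_lift _ (PT_lift _ Hd)).
    - exact: (PT_lift _ (PT_lift _ Hx)).
    - exact: (PT_lift _ (PT_lift _ Hy)).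
    - exact: (PT_lift _ Hq).
    - exact: PT_here.
  exact: PT_leaf.
set I' := ctx _ _; have Hi : PT I' (fun z => enc_nat (tagged z)) := PT_here I _.
apply: (@PT_place_table _ I' (fun z => Ef (tag z)) (fun z => n (tag z))
    (PT_lift _ HE) (PT_lift _ Hn)
    (fun z w' => enc_bool (dchan (d (tag z)) (x (tag z)) (y (tag z)) (inr (tagged z)) w'))).
  exact: PT_leaf.
apply: PT_and.
  by apply: PT_eqn; [exact: (PT_lift _ (PT_lift _ Hx)) | exact: (PT_lift _ (PT_lift _ Hy))].
apply: (@PT_eqn _ _ (fun z => nat_of_ord (tagged (tag z))) (fun z => nat_of_ord (tagged z))).
  exact: (PT_lift _ Hi).
exact: PT_here.
Qed.

Lemma PT_chan A (I : A -> data) (Ef : A -> eos) (n : A -> nat)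
    (d : forall a, desc (qplace (Ef a))) :
  PT I (fun a => enc_eos (Ef a)) -> PT I (fun a => enc_nat (n a)) ->
  PT I (fun a => enc_desc (d a)) ->
  PT I (fun a => enc_seq (fun x => enc_seq (fun y => Node (Node (enc_nat x) (enc_nat y))
     (enc_table (fun w : qplace (Ef a) + 'I_(n a).+1 =>
        enc_table (fun w' => enc_bool (dchan (d a) x y w w')))))
     (dvars (d a))) (dvars (d a))).
Proof.
move=> HE Hn Hd; have Hv := PT_dvars Hd; pose e (_ : A) := enc_nat.
pose T a x y := enc_table (fun w : qplace (Ef a) + 'I_(n a).+1 =>
        enc_table (fun w' => enc_bool (dchan (d a) x y w w'))).
apply: (@PT_map _ I (fun=> nat) e (fun a => dvars (d a)) (fun a x =>
   enc_seq (fun y => Node (Node (enc_nat x) (enc_nat y)) (T a x y)) (dvars (d a)))) => //.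
have Hx := PT_here I e; pose e' (_ : {a : A & nat}) := enc_nat.
apply: (@PT_map _ (ctx I e) (fun=> nat) e' (fun z => dvars (d (tag z))) (fun z y =>
   Node (Node (enc_nat (tagged z)) (enc_nat y)) (T (tag z) (tagged z) y))).
  exact: (PT_lift _ Hv).
have Hx' := PT_lift e' Hx; have Hy := PT_here (ctx I e) e'.
apply: PT_node; first exact: PT_node.
apply: (@PT_chan_table _ _ (fun z => Ef (tag (tag z))) (fun z => n (tag (tag z)))
  (fun z => d (tag (tag z))) (fun z => tagged (tag z)) (fun z => tagged z)) => //.
- exact: (PT_lift _ (PT_lift _ HE)).
- exact: (PT_lift _ (PT_lift _ Hn)).
- exact: (PT_lift _ (PT_lift _ Hd)).
Qed.

Lemma PT_simnet : PT enc_eos (fun E => enc_cnupn (simnet E)).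
Proof.
have HE := PT_id enc_eos.
have Hn : PT enc_eos (fun E => enc_nat (size (prog E))).
  exact: (@PT_size_seq _ _ (fun E => op E) (fun E => @enc_op E) (fun E => prog E) (PT_prog HE)).
have Hds : PT enc_eos (fun E => enc_seq (@enc_desc E) (descs E)) := PT_descs HE.
have HdE : PT (ctx enc_eos (fun E => @enc_desc E)) (fun z => enc_desc (tagged z)) :=
  PT_here enc_eos (fun E => @enc_desc E).
apply: PT_node; last first.
  apply: (@PT_ext _ _ (fun E => enc_seq (fun d => enc_seq (fun x => enc_seq (fun y =>
     Node (Node (enc_nat x) (enc_nat y))
     (enc_table (fun w : qplace E + 'I_(size (prog E)).+1 =>
        enc_table (fun w' => enc_bool (dchan d x y w w')))))
     (dvars d)) (dvars d)) (descs E))).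
    move=> E; rewrite -enc_table_dnth; apply: eq_enc_seq => t.
    by rewrite /enc_chan (@std_varsE _ _ _ (@wf_descs E)).
  apply: (@PT_map _ enc_eos (fun E => desc (qplace E)) (fun E => @enc_desc E) (fun E => descs E)
   (fun E d => enc_seq (fun x => enc_seq (fun y =>
     Node (Node (enc_nat x) (enc_nat y))
     (enc_table (fun w : qplace E + 'I_(size (prog E)).+1 =>
        enc_table (fun w' => enc_bool (dchan d x y w w')))))
     (dvars d)) (dvars d))) => //.
  apply: (@PT_chan _ _ (fun z => tag z) (fun z => size (prog (tag z))) (fun z =>
      tagged z)) => //.
    exact: (PT_lift _ HE).
  exact: (PT_lift _ Hn).
apply: PT_node.
  apply: (@PT_ext _ _ (fun E => enc_nat (size (enum {: qplace E}) + (size (prog E)).+1))).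
    by move=> E; rewrite -cardE -[(size _).+1]card_ord -card_sum.
  apply: PT_add; last exact: PT_succ.
  exact: (@PT_size_seq _ _ _ (fun E => @enc_q E) _ (PT_enum_q HE)).
apply: PT_node.
  apply: (@PT_ext _ _ (fun E => enc_nat (size (descs E)))).
    by move=> E; rewrite -[size _]card_ord.
  exact: (@PT_size_seq _ _ _ (fun E => @enc_desc E) _ Hds).
apply: PT_node.
  apply: (@PT_ext _ _ (fun E => enc_table (fun w : qplace E + 'I_(size (prog E)).+1 =>
     enc_seq (fun d => enc_seq enc_var (darc_in w d)) (descs E)))).
    by move=> E; apply: eq_enc_seq => w; rewrite -enc_table_dnth.
  apply: PT_place_table => //.
    apply: (@PT_map _ _ (fun z => desc (qplace (tag z))) (fun z => @enc_desc (tag z))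
       (fun z => descs (tag z)) (fun z d => enc_seq enc_var (darc_in (inl (tagged z)) d))).
      exact: (PT_lift _ Hds).
    apply: (@PT_arcs_in_q _ _ (fun z => tag (tag z)) (fun z => size (prog (tag (tag z))))
      (fun z => tagged z) _ (fun z => tagged (tag z))); first exact: PT_here.
    exact: (PT_lift _ (PT_here _ _)).
  apply: (@PT_map _ _ (fun z => desc (qplace (tag z))) (fun z => @enc_desc (tag z))
       (fun z => descs (tag z)) (fun z d => enc_seq enc_var (darc_in (inr (tagged z)) d))).
    exact: (PT_lift _ Hds).
  apply: (@PT_arcs_in_pc _ _ (fun z => tag (tag z)) (fun z => size (prog (tag (tag z))))
      (fun z => tagged z) _ (fun z => tagged (tag z))); first exact: PT_here.
  exact: (PT_lift _ (PT_here _ _)).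
apply: PT_node; last exact: PT_leaf.
apply: (@PT_ext _ _ (fun E => enc_seq (fun d => enc_table (fun w : qplace E + 'I_(size
    (prog E)).+1 =>
     enc_seq enc_var (darc_out d w))) (descs E))).
  by move=> E; rewrite -enc_table_dnth.
apply: (@PT_map _ enc_eos (fun E => desc (qplace E)) (fun E => @enc_desc E) (fun E => descs E)
   (fun E d => enc_table (fun w : qplace E + 'I_(size (prog E)).+1 =>
     enc_seq enc_var (darc_out d w)))) => //.
apply: (@PT_place_table _ _ (fun z => tag z) (fun z => size (prog (tag z))) (PT_lift _ HE)
    (PT_lift _ Hn)
   (fun z w => enc_seq enc_var (darc_out (tagged z) w))).
  apply: (@PT_arcs_out_q _ _ (fun z => tag (tag z)) (fun z => size (prog (tag (tag z))))
      (fun z => tagged (tag z)) _ (fun z => tagged z)); last exact: PT_here.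
  exact: (PT_lift _ HdE).
apply: (@PT_arcs_out_pc _ _ (fun z => tag (tag z)) (fun z => size (prog (tag (tag z))))
      (fun z => tagged (tag z)) _ (fun z => tagged z)); last exact: PT_here.
exact: (PT_lift _ HdE).
Qed.

(** Translates the symbolic code of a place into its rank, by searching for it in the
    enumeration. *)
Lemma PT_index_q A (I : A -> data) (Ef : A -> eos) (q : forall x, qplace (Ef x)) :
  PT I (fun x => enc_eos (Ef x)) -> PT I (fun x => enc_q (q x)) ->
  PT I (fun x => enc_nat (index (q x) (enum {: qplace (Ef x)}))).
Proof.
move=> HE Hq; apply: (@PT_find _ I (fun x => qplace (Ef x)) (fun x => @enc_q (Ef x))
  (fun x => enum {: qplace (Ef x)}) (fun x => pred1 (q x))).
  exact: PT_enum_q.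
apply: (@PT_eq_q _ _ (fun y => Ef (tag y)) (fun y => tagged y) (fun y => q (tag y))).
  exact: PT_here.
exact: (PT_lift _ Hq).
Qed.

Lemma enc_elt_inl (Q R : finType) (q : Q) :
  enc_elt (inl q : (Q + R)%type) = enc_nat (index q (enum Q)).
Proof.
rewrite enc_elt_index enum_sum index_cat map_f ?mem_enum // index_map //.
by move=> a b [].
Qed.

Lemma enc_elt_inr (Q R : finType) (r : R) :
  enc_elt (inr r : (Q + R)%type) = enc_nat (size (enum Q) + index r (enum R)).
Proof.
rewrite enc_elt_index enum_sum index_cat.
have -> : (inr r \in [seq inl q | q <- enum Q]) = false by apply/mapP => -[].
by rewrite size_map index_map // => a b [].
Qed.

Lemma PT_layout : PT enc_eos (fun E => enc_layout (@layout E)).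
Proof.
have HE := PT_id enc_eos.
apply: PT_node.
  (* Control state 0 is the first place after all of [qplace E]. *)
  apply: (@PT_ext _ _ (fun E => enc_nat (size (enum {: qplace E})))).
    move=> E; have := @enc_elt_inr {: qplace E} 'I_(size (prog E)).+1 ord0.
    by rewrite index_enum_ord addn0 => <-.
  exact: (@PT_size_seq _ _ _ (fun E => @enc_q E) _ (PT_enum_q HE)).
apply: PT_node.
  apply: (@PT_map _ _ (fun E => place (sys E)) (fun E => @enc_elt _) (fun E => enum (place
      (sys E)))
    (fun E p => enc_elt (p_id (@layout E) p))); first exact: PT_places.
  apply: (@PT_ext _ _ (fun z => enc_nat (index (qid (tagged z)) (enum {: qplace (tag z)})))).
    by move=> z; rewrite -(@enc_elt_inl _ 'I_(size (prog (tag z))).+1).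
  apply: (@PT_index_q _ _ (fun z => tag z)); first exact: (PT_lift _ HE).
  by apply: (@PT_qid _ _ (fun z => tag z)); exact: PT_here.
apply: PT_node; last exact: PT_leaf.
apply: (@PT_map _ _ (fun E => place (sys E)) (fun E => @enc_elt _) (fun E => enum (place
    (sys E)))
    (fun E p => enc_table (fun q => enc_elt (p_copy (@layout E) q)))); first exact: PT_places.
set I' := ctx _ _; have Hp : PT I' (fun z => enc_elt (tagged z)) := PT_here _ _.
apply: (@PT_map _ I' (fun z => place (obj (typ (tagged z)))) (fun z => @enc_elt _)
   (fun z => enum (place (obj (typ (tagged z))))) (fun z q => enc_elt (p_copy (@layout
       (tag z)) q))).
  by apply: (@PT_obj_places _ _ (fun z => tag z)) => //; exact: (PT_lift _ HE).
apply: (@PT_ext _ _ (fun z => enc_nat (index (qcopy (copy_of (tagged z))) (enum {: qplace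
    (tag (tag z))})))).
  by move=> z; rewrite -(@enc_elt_inl _ 'I_(size (prog (tag (tag z)))).+1).
apply: (@PT_index_q _ _ (fun z => tag (tag z))); first exact: (PT_lift _ (PT_lift _ HE)).
apply: (@PT_qcopy _ _ (fun z => tag (tag z)) (fun z => copy_of (tagged z))).
by apply: PT_node; [exact: (PT_lift _ Hp) | exact: PT_here].
Qed.

(** Encodings have size at least 1, so [n + d] is at most [d.+1 * n]; this gives the coefficient
    [d.+1 ^ d] and the degree [d]. *)
Lemma PT_runs_in A (I f : A -> data) : PT I f ->
  exists (c : cmd) (a b : nat), forall x, runs_in c (I x) (f x) (a * data_size (I x) ^ b + a).
Proof.
case=> c [d H]; exists (c 0), (d.+1 ^ d), d => x.
have [s' [t [H1 H2 _ H3]]] := H x 0 (fun j => if j == 0 then I x else Leaf) erefl.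
exists s', t; split=> //; apply: leq_trans H3 _; apply: leq_trans (leq_addr _ _).
rewrite -expnMn; case: (d) => // e; rewrite leq_exp2r //.
by have := data_size_gt0 (I x); nia.
Qed.

Theorem theorem3 :
  exists (prog : cmd) (a b : nat),
  forall E : eos, conservative E ->
  exists (W : cnupn) (L : sim_place E -> nplace W),
    runs_in prog (enc_eos E) (Node (enc_cnupn W) (enc_layout L))
            (a * data_size (enc_eos E) ^ b + a)
    /\ simulates L.
Proof.
(* Program and constants are fixed before the object system; conservativity enters through
   [den_evops]. *)
have [c [a [b H]]] := PT_runs_in (PT_node PT_simnet PT_layout).
exists c, a, b => E consE; exists (simnet E), (@layout E); split; first exact: H.
apply: simnet_simulates; first exact: wfs_evops.
by move=> ev M y; exact: den_evops.
Qed.
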